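(* Let $\mathfrak g$ be a complex simple Lie algebra with the grading determined by a set of simple roots $\Sigma$. If $\dim\mathfrak g_{-1}>2$, then $(\mathfrak g,\Sigma)$ is a parabolic geometry of Monge type if and only if (i) there is a root $\zeta\in\Sigma$ which is adjacent to every other root in $\Sigma$ in the Dynkin diagram of $\mathfrak g$; and (ii) for each $\alpha\in\Sigma\setminus\{\zeta\}$, the parabolic geometry for the complex simple Lie algebra $\mathfrak g(\Upsilon_\alpha)$ defined by the single simple root $\{\alpha\}$ is $|1|$-graded.
   Context: **Gradings.** A $|k|$-grading of $\mathfrak g$ is a vector space decomposition $\mathfrak g=\mathfrak g_k\oplus\cdots\oplus\mathfrak g_0\oplus\cdots\oplus\mathfrak g_{-k}$ with $[\mathfrak g_i,\mathfrak g_j]\subset\mathfrak g_{i+j}$, $[\mathfrak g_{-1},\mathfrak g_m]=\mathfrak g_{m-1}$ for $m<0$, and $\mathfrak g_{\pm k}\ne0$. Fix a Cartan subalgebra $\mathfrak h$ and simple roots $\Delta^0$. A non-empty subset $\Sigma\subset\Delta^0$ determines a grading, called the parabolic geometry $(\mathfrak g,\Sigma)$: with $\mathrm{ht}_\Sigma(\sum_{\alpha\in\Delta^0} n_\alpha\alpha)=\sum_{\alpha\in\Sigma}n_\alpha$, $\mathfrak g_j$ ($j\ne0$) is the sum of the root spaces of roots of $\Sigma$-height $j$, and $\mathfrak g_0$ is the sum of $\mathfrak h$ and the root spaces of roots of $\Sigma$-height $0$. **Monge type.** $(\mathfrak g,\Sigma)$ is a parabolic geometry of Monge type if $\mathfrak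 g_{-1}$ contains a non-zero abelian subalgebra $\mathfrak y$ of codimension $1$ in $\mathfrak g_{-1}$ and $\dim\mathfrak g_{-2}=\dim\mathfrak y$. **The algebras $\mathfrak g(\Upsilon_\alpha)$.** Given $\zeta$ as in (i), remove the node $\zeta$ from the Dynkin diagram of $\mathfrak g$. For $\alpha\in\Sigma\setminus\{\zeta\}$, $\Upsilon_\alpha$ is the connected component of the resulting graph containing $\alpha$, and $\mathfrak g(\Upsilon_\alpha)$ is the complex simple Lie algebra with Dynkin diagram $\Upsilon_\alpha$.
   Formalization: Condition (i) is strengthened: besides ζ∈Σ being adjacent to every other root in Σ, every simple root adjacent to ζ must lie in Σ; without this the ''if'' direction fails, e.g. for A_4 with Σ={α_2,α_3}, where dim g_{-1}=dim g_{-2}=4. *)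

(* Defs.v *)
From HB Require Import structures.
From mathcomp Require Import all_boot all_order all_algebra.
From mathcomp Require Import boolp classical_sets fsbigop.
From mathcomp Require Export reals complex.

Set Implicit Arguments.
Unset Strict Implicit.
Unset Printing Implicit Defensive.

Import Order.TTheory GRing.Theory Num.Theory.
Local Open Scope ring_scope.

HB.mixin Record Vector_isLie (K : fieldType) (L : Type) of Vector K L := {
  lieb : L -> L -> L;
  lieb_linearl : forall y, linear (lieb^~ y);
  lieb_linearr : forall x, linear (lieb x);
  liebxx : forall x, lieb x x = 0;
  lieb_jacobi : forall x y z,
    lieb x (lieb y z) + lieb y (lieb z x) + lieb z (lieb x y) = 0 }.

#[short(type="lieAlgType")]
HB.structure Definition Lie (K : fieldType) :=
  {L of Vector_isLie K L & Vector K L}.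

Notation dualv K h := 'Hom(subvs_of h, K^o) (only parsing).

Section LieAlgebra.
Variables (K : fieldType) (g : lieAlgType K).
Implicit Types (x y : g) (U V I h : {vspace g}).

Definition ad x : 'End(g) := linfun (lieb x).

(* [U, V]: the span of all brackets, by bilinearity generated on bases *)
Definition liev U V : {vspace g} :=
  <<[seq lieb x y | x <- vbasis U, y <- vbasis V]>>%VS.

Definition lie_ideal I : Prop := forall x y, y \in I -> lieb x y \in I.

Definition simple_lie : Prop :=
  (exists x y, lieb x y != 0) /\
  (forall I, lie_ideal I -> I = 0%VS \/ I = fullv).

Definition lie_nilpotent h : Prop :=
  exists n, iter n (liev h) h = 0%VS.

Definition lie_self_normalizing h : Prop :=
  forall x, (forall y, y \in h -> lieb x y \in h) -> x \in h.

Definition cartan_subalgebra h : Prop :=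
  [/\ (liev h h <= h)%VS, lie_nilpotent h & lie_self_normalizing h].

Definition killing x y : K :=
  \tr (passmx.mxof (vbasis fullv) (vbasis fullv) (ad x \o ad y)%VF).

(* {x | [u, x] = b(u) x for all u in h}; it suffices to let u run through a
   basis of h *)
Definition root_space h (b : dualv K h) : {vspace g} :=
  (\bigcap_(u <- vbasis h) 
     lker (ad u - (b (vsproj h u) : K) *: (\1%VF : 'End(g))))%VS.

Definition is_root h (b : dualv K h) : Prop :=
  b != 0 /\ root_space b != 0%VS.

Definition simple_roots h r (D : r.-tuple (dualv K h)) : Prop :=
  [/\ forall i, is_root (tnth D i),
      basis_of fullv D
    & forall b : dualv K h, is_root b ->
        exists n : 'I_r -> nat,
          b = \sum_i tnth D i *+ n i \/ b = - \sum_i tnth D i *+ n i].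

(* the Sigma-height; it is an integer at the roots *)
Definition height h r (D : r.-tuple (dualv K h)) (S : {set 'I_r}) (b : dualv K h)
  : K := \sum_(i in S) coord D i b.

(* The sum over the roots b of height j is meant to be finite, as there are only
   finitely many roots. *)
Definition parabolic_grading h r (D : r.-tuple (dualv K h)) (S : {set 'I_r})
    (j : int) : {vspace g} :=
  ((if (j == 0)%R then h else 0) +
   \big[@addv K g/0]_(b \in [set b : dualv K h |
      is_root b /\ (height D S b = j%:~R)%R]%classic) root_space b)%VS.

(* The family G is indexed by all of int, with G_i = 0 for |i| > k. *)
Definition is_kgrading (k : nat) (G : int -> {vspace g}) : Prop :=
  (forall i : int, (k < `|i|)%N -> G i = 0%VS) /\
  (directv (\sum_(i < k.*2.+1) G (i%:Z - k%:Z)%R) /\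
   (\sum_(i < k.*2.+1) G (i%:Z - k%:Z)%R)%VS = fullv) /\
  (forall i j : int, (liev (G i) (G j) <= G (i + j)%R)%VS) /\
  (forall m : int, m < 0 -> liev (G (-1)) (G m) = G (m - 1)) /\
  (G k%:Z != 0%VS /\ G (- k%:Z) != 0%VS).

Definition monge_type (G : int -> {vspace g}) : Prop :=
  exists y : {vspace g},
    [/\ y != 0%VS, (y <= G (-1))%VS, liev y y = 0%VS,
        \dim (G (-1)) = (\dim y).+1
      & \dim (G (-2)) = \dim y].

(* The element t_b of h dual to b under the restriction of the Killing form to
   h (which is nondegenerate when h is a Cartan subalgebra of a simple g in
   characteristic 0). *)
Definition killing_dual h (b : dualv K h) : subvs_of h :=
  ((linfun (fun u : subvs_of h =>
      (linfun (fun v : subvs_of h => killing (vsval u) (vsval v) : K^o)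
        : dualv K h)))^-1)%VF b.

Definition root_form h (a b : dualv K h) : K :=
  killing (vsval (killing_dual a)) (vsval (killing_dual b)).

Section DynkinDiagram.
Variables (h : {vspace g}) (r : nat) (D : r.-tuple (dualv K h)).

Definition cartan_integer (i j : 'I_r) : K :=
  2 * root_form (tnth D i) (tnth D j) / root_form (tnth D j) (tnth D j).

(* the number of edges joining the nodes i <> j *)
Definition dynkin_edges (i j : 'I_r) : K :=
  cartan_integer i j * cartan_integer j i.

Definition dynkin_adj : rel 'I_r :=
  fun i j => (i != j) && (dynkin_edges i j != 0).

(* Upsilon_a: the component of a after removal of the node z *)
Definition dynkin_component (z a : 'I_r) : {set 'I_r} :=
  [set b | connect (fun i j => [&& i != z, j != z & dynkin_adj i j]) a b].

End DynkinDiagram.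
End LieAlgebra.

Section DynkinSubdiagram.
Variable (K : numFieldType).

(* i and j are adjacent and the arrow on the edge points from i to j, i.e.,
   the i-th simple root is longer *)
Definition dynkin_arrow (g : lieAlgType K) (h : {vspace g}) r
    (D : r.-tuple (dualv K h)) (i j : 'I_r) : bool :=
  dynkin_adj D i j &&
  (root_form (tnth D j) (tnth D j) < root_form (tnth D i) (tnth D i)).

(* f identifies the Dynkin diagram of D' with the full subdiagram, on the set of
   nodes Y, of the Dynkin diagram of D *)
Definition dynkin_iso (g' g : lieAlgType K) (h' : {vspace g'}) (h : {vspace g})
    r' r (D' : r'.-tuple (dualv K h')) (D : r.-tuple (dualv K h))
    (Y : {set 'I_r}) (f : 'I_r' -> 'I_r) : Prop :=
  [/\ injective f,
      f @: [set: 'I_r'] = Y,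
      forall i j, i != j -> dynkin_edges D' i j = dynkin_edges D (f i) (f j)
    & forall i j, dynkin_arrow D' i j = dynkin_arrow D (f i) (f j)].

End DynkinSubdiagram.

(* Main.v *)
(* Monge type means that some root z of Sigma-height one is a "star": adding z
   to any other root of height one gives a root, while no two of the others sum
   to a root.  Indeed, if a root vector of g_-1 lies outside the abelian
   subalgebra y, then bracketing with it maps y onto g_-2, bijectively by the
   dimension hypothesis; comparing the sums of the weights of g_-2 shows that
   there is only one such root vector.

   A star z is fixed by the simple reflections that preserve the height, so it
   is orthogonal to the simple roots outside Sigma; if it were not simple, then
   z - a, z + a, 2 z + a and finally 2 z would be roots for some simple root a.
   Hence z is a simple root zeta, its neighbours in the Dynkin diagram are the
   other elements of Sigma, and no root without zeta has height two.  Conversely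
   these properties give a star.  As Dynkin diagrams have no cycles, each
   component left by the removal of zeta contains one element of Sigma, so that
   the property of the height is condition (ii): a root system is determined by
   its Cartan matrix, and the subalgebra attached to a component is simple with
   the expected diagram. *)

From HB Require Import structures.
Require Import Defs.
From mathcomp Require Import spectral boolp classical_sets fsbigop.
(* Imported last, as classical_sets shadows set0, imageP, inE and others. *)
From mathcomp Require Import all_boot all_order all_algebra.
From mathcomp Require Import ring lra zify.

Set Implicit Arguments.
Unset Strict Implicit.
Unset Printing Implicit Defensive.

Import Order.TTheory GRing.Theory Num.Theory.
Local Open Scope ring_scope.

(** * Linear algebra *)

(** Condition (ii) quantifies over every simple Lie algebra with the given diagram, so the two
    directions need different things. To derive it, an arbitrary such algebra has to be shown to
    have the roots of the full subsystem; to apply it, one such algebra has to be exhibited, and a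
    subalgebra of g serves. The roots are compared in [root_system], a list of properties of integer
    coordinate vectors whose only strings are those in simple directions, and which therefore
    restricts to any set of nodes. Of the Cartan matrix a diagram records only the products of
    opposite entries and the direction of the inequality between them; that this suffices rests on
    the products being less than 4.

    On the Lie side, representations of sl_2 are replaced by one device: the trace of a commutator
    on a stable span of weight vectors is 0. It gives the rationality of the weights at t_a,
    multiplicity one, unbroken strings and nonzero brackets. The Killing form is complex; positivity
    is recovered from rationality, by sums of squares of real values of weights. *)

Section MatrixSemisimplePart.
Variables (K : closedFieldType) (n : nat) (A : 'M[K]_n).

Lemma kermxpoly_dvd (p q : {poly K}) : p %| q -> (kermxpoly A p <= kermxpoly A q)%MS.
Proof.
case/dvdpP => s ->; case: n A => [|k] B; first by rewrite thinmx0 sub0mx.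
apply/sub_kermxP.
by rewrite (mulrC s p) rmorphM /= -mulmxE mulmxA mulmx_ker mul0mx.
Qed.

Lemma sub_kermxpoly_iter d N (v : 'rV[K]_n) :
  (v <= kermxpoly A (('X - d%:P) ^+ N))%MS
    = (iter N (fun w => w *m A - d *: w) v == 0).
Proof.
case: n A v => [|k] B v; first by rewrite thinmx0 sub0mx [iter _ _ _]thinmx0 eqxx.
rewrite (sameP sub_kermxP eqP); congr (_ == 0).
elim: N => [|N IH] /=; first by rewrite expr0 rmorph1 mulmx1.
rewrite exprSr rmorphM /= -mulmxE mulmxA IH rmorphB /= horner_mx_X horner_mx_C.
by rewrite mulmxBr mul_mx_scalar.
Qed.

(** The semisimple part of the Jordan decomposition: the sum of [c i] times the projections onto the
    primary components of [A]. The exponent [M] is the number of roots of the characteristic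
    polynomial counted with multiplicity, hence a common bound for all multiplicities. *)
Lemma mx_semisimple_part : exists (S : 'M[K]_n) (m : nat) (c : 'I_m -> K) (M : nat),
  (forall v d N, (v <= kermxpoly A (('X - d%:P) ^+ N))%MS -> v *m S = d *: v :> 'rV_n)
  /\ (1%:M <= \sum_i kermxpoly A (('X - (c i)%:P) ^+ M))%MS.
Proof.
have [r Dr] := closed_field_poly_normal (char_poly A).
move: Dr; rewrite (monicP (char_poly_monic A)) scale1r => Dr.
pose s := undup r; pose M := size r.
pose c (i : 'I_(size s)) := s`_i.
have c_inj : injective c.
  move=> i j /eqP; rewrite nth_uniq ?undup_uniq // => /eqP; exact: val_inj.
pose p i := ('X - (c i)%:P) ^+ M.
have copX a b k l : a != b -> coprimep (('X - a%:P) ^+ k) (('X - b%:P) ^+ l : {poly K}).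
  move=> neq; rewrite coprimep_expl // coprimep_expr //.
  by rewrite coprimep_XsubC root_XsubC eq_sym.
have cop : {in predT &, forall i j, j != i -> coprimep (p i) (p j)}.
  by move=> i j _ _ neq; apply: copX; rewrite (inj_eq c_inj) eq_sym.
(* Cayley-Hamilton: the characteristic polynomial divides the product of the [p i], whose kernel is
   therefore the whole space. *)
have full : (1%:M <= \sum_i kermxpoly A (p i))%MS.
  have /= E := kermxpoly_prod A cop; rewrite -E {E}.
  have dv : char_poly A %| \prod_i p i.
    have -> : \prod_i p i = (\prod_(z <- s) ('X - z%:P)) ^+ M.
      by rewrite (big_nth 0) big_mkord -prodrXl.
    rewrite Dr /M; have: all [in s] r by apply/allP => z; rewrite mem_undup.
    elim: (r) => [|z t IH] /=; first by rewrite big_nil dvd1p.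
    case/andP => zs ts; rewrite big_cons exprS dvdp_mul ?IH //.
    by rewrite (big_rem z) //= dvdp_mulr.
  apply: submx_trans (kermxpoly_dvd dv).
  case: n A => [|k] B; first by rewrite thinmx0 sub0mx.
  by rewrite kermxpoly_min // mxminpoly_dvd_char.
have /sub_sumsmxP[u Du] := full.
pose U i := u i *m kermxpoly A (p i).
have UK i (v : 'rV_n) : (v *m U i <= kermxpoly A (p i))%MS.
  by rewrite /U mulmxA submxMl.
have U1 (v : 'rV_n) : v = \sum_i v *m U i.
  by rewrite -mulmx_sumr -Du mulmx1.
exists (\sum_i c i *: U i), (size s), c, M; split => // v d N vK.
have vU i : c i != d -> v *m U i = 0.
  (* [q] is coprime to [p i], and its kernel contains [v] and all components of [v] except the
     [i]-th; so the [i]-th component lies in two independent kernels. *)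
  move=> neq; pose q := ('X - d%:P) ^+ N * \prod_(j | j != i) p j.
  have copq : coprimep (p i) q.
    rewrite coprimepMr copX //=.
    rewrite (@big_morph _ _ _ true andb) ?coprimep1 //; last first.
      by move=> a b; rewrite coprimepMr.
    rewrite big_all_cond; apply/allP => j _; apply/implyP => ji.
    exact: cop.
  have dir := mxdirect_kermxpoly A copq.
  apply/eqP; rewrite -submx0 -dir sub_capmx UK /=.
  have -> : v *m U i = v - \sum_(j | j != i) v *m U j.
    by apply/esym/eqP; rewrite subr_eq {1}(U1 v) (bigD1 i).
  apply: addmx_sub; first by apply: submx_trans vK (kermxpoly_dvd (dvdp_mulIl _ _)).
  rewrite -scaleN1r scalemx_sub // summx_sub // => j ji.
  apply: submx_trans (UK j v) (kermxpoly_dvd _).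
  by rewrite /q (bigD1 j) //= mulrCA dvdp_mulIl.
rewrite mulmx_sumr [in RHS](U1 v) scaler_sumr; apply: eq_bigr => i _.
rewrite -scalemxAr; have [->//|neq] := eqVneq (c i) d.
by rewrite vU // !scaler0.
Qed.
End MatrixSemisimplePart.

Lemma linfun_linear (K : fieldType) (aT rT : vectType K) (f : aT -> rT) :
  linear f -> linfun f =1 f.
Proof.
move=> linf x.
pose F := HB.pack_for {linear aT -> rT} f
  (GRing.isSemilinear.Build K aT rT _ f (GRing.semilinear_linear linf)).
exact: (lfunE F x).
Qed.

Section Trace.
Import passmx.
Variables (K : fieldType) (V : vectType K).
Implicit Types (f g : 'End(V)) (X Y : (\dim {:V}).-tuple V).

Definition trl f := \tr (mxof (vbasis fullv) (vbasis fullv) f).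

Lemma trl_basis X f : basis_of fullv X -> trl f = \sum_i coord X i (f X`_i).
Proof.
move=> bX; have bE := vbasisP (@fullv K V); set E := vbasis fullv in bE.
have -> : trl f = \tr (mxof X X f).
  rewrite -[f in LHS]comp_lfun1r -[f in LHS]comp_lfun1l /trl.
  rewrite (mxof_comp _ _ bX) (mxof_comp _ _ bX) mulmxA mxtrace_mulC mulmxA.
  by rewrite -(mxof_comp _ _ bE) comp_lfun1r mxof1 ?mul1mx // (basis_free bX).
by apply: eq_bigr => i _; rewrite !mxE /= vecof_delta.
Qed.

Lemma trlD f g : trl (f + g) = trl f + trl g.
Proof. by rewrite /trl linearD mxtraceD. Qed.
Lemma trlZ a f : trl (a *: f) = a * trl f.
Proof. by rewrite /trl linearZ mxtraceZ. Qed.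
Lemma trlB f g : trl (f - g) = trl f - trl g.
Proof. by rewrite /trl linearB raddfB. Qed.
Lemma trlC f g : trl (f \o g)%VF = trl (g \o f)%VF.
Proof.
have bE := vbasisP (@fullv K V).
by rewrite /trl !(mxof_comp _ _ bE) mxtrace_mulC.
Qed.
End Trace.

(** * Traces of squares, semisimple parts and simultaneous diagonalization *)

Section SquareTrace.
Import passmx.
Variables (K : numClosedFieldType).

(** After triangularization the diagonal of the square consists of the squares of the eigenvalues,
    all real and not all zero. *)
Lemma mx_sq_trace_gt0 n (A : 'M[K]_n) :
  (forall c, eigenvalue A c -> c \is Num.real) ->
  (exists2 c, c != 0 & eigenvalue A c) -> 0 < \tr (A *m A).
Proof.
move=> Areal [c c0 Ac].
have [|P Pu] := @cotrigonalization K n [:: A].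
  by move=> B C; rewrite !inE => /eqP-> /eqP->.
rewrite /= andbT => Ptrig.
have Pun := unitarymx_unit Pu.
pose T := P *m A *m invmx P.
have DT : conjmx P A = T by rewrite conjumx.
have {}Ptrig : is_trig_mx T by rewrite -DT; exact: Ptrig.
have trT : \tr (A *m A) = \tr (T *m T).
  by rewrite /T !mulmxA (mulmxKV Pun) -!mulmxA [in RHS]mxtrace_mulC !mulmxA (mulmxKV Pun).
have cpT a : eigenvalue A a = [exists i, a == T i i].
  have -> : eigenvalue A a = eigenvalue T a.
    apply/eigenvalueP/eigenvalueP => -[v vA v0].
      exists (v *m invmx P); first by rewrite /T !mulmxA (mulmxKV Pun) vA scalemxAl.
      by apply: contraNneq v0 => vP0; rewrite -(mulmxKV Pun v) vP0 mul0mx.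
    exists (v *m P); last first.
      by apply: contraNneq v0 => vP0; rewrite -(mulmxK Pun v) vP0 mul0mx.
    have -> : v *m P *m A = v *m T *m P by rewrite /T !mulmxA mulmxKV.
    by rewrite vA -scalemxAl.
  rewrite eigenvalue_root_char (char_poly_trig Ptrig).
  rewrite -(big_map (fun i => T i i) xpredT (fun z => 'X - z%:P)) root_prod_XsubC.
  apply/mapP/existsP => [[i _ ->]|[i /eqP->]]; exists i => //.
  exact: mem_index_enum.
have Treal i : T i i \is Num.real by apply: Areal; rewrite cpT; apply/existsP; exists i.
have TT i : (T *m T) i i = T i i ^+ 2.
  rewrite mxE (bigD1 i) //= expr2 big1 ?addr0 // => j ji.
  have [ij|jlei] := ltnP i j; first by rewrite (is_trig_mxP Ptrig) // mul0r.
  rewrite [T j i](is_trig_mxP Ptrig) ?mulr0 //.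
  by rewrite ltn_neqAle jlei andbT.
have [i /eqP ci] : exists i, c == T i i by apply/existsP; rewrite -cpT.
rewrite trT /mxtrace (eq_bigr _ (fun i _ => TT i)) (bigD1 i) //=.
rewrite ltr_pwDl //; first by rewrite -ci lt_def sqrf_eq0 c0 real_exprn_even_ge0 // ci.
by apply: sumr_ge0 => j _; rewrite real_exprn_even_ge0.
Qed.

Variable V : vectType K.
Implicit Types (f : 'End(V)).

Lemma leigenvalueE f a : leigenvalue f a = eigenvalue (mxof (vbasis fullv) (vbasis fullv) f) a.
Proof. by rewrite /leigenvalue (leigenspaceE (vbasisP _)) vsof_eq0 // vbasisP. Qed.

Lemma leigenvalueP f a : reflect (exists2 v, v != 0 & f v = a *: v) (leigenvalue f a).
Proof.
apply: (iffP idP) => [h|[v v0 fv]].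
  exists (vpick (leigenspace f a)); first by rewrite vpick0.
  have := memv_pick (leigenspace f a); rewrite memv_ker.
  by rewrite add_lfunE opp_lfunE scale_lfunE id_lfunE subr_eq0 => /eqP.
apply/eqP/vspaceP => /(_ v); rewrite memv0 (negPf v0) memv_ker.
by rewrite add_lfunE opp_lfunE scale_lfunE id_lfunE fv subrr eqxx.
Qed.

Lemma sq_trace_gt0 f :
  (forall c, leigenvalue f c -> c \is Num.real) ->
  (exists2 c, c != 0 & leigenvalue f c) -> 0 < trl (f \o f)%VF.
Proof.
move=> fr [c c0 fc]; rewrite /trl (mxof_comp _ _ (vbasisP _)) ?vbasisP //.
apply: mx_sq_trace_gt0; last by exists c; rewrite // -leigenvalueE.
by move=> d; rewrite -leigenvalueE; apply: fr.
Qed.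

Definition gen_eigen f c (x : V) := exists N, iter N (fun y => f y - c *: y) x = 0.

Lemma semisimple_part f : exists S : 'End(V),
  (forall c x, gen_eigen f c x -> S x = c *: x) /\
  (forall x, exists (m : nat) (c : 'I_m -> K) (y : 'I_m -> V),
     (forall i, gen_eigen f (c i) (y i)) /\ x = \sum_i y i).
Proof.
pose E := vbasis (@fullv K V); have bE : basis_of fullv E := vbasisP _.
pose A := mxof E E f.
have [S [m [c [M [HS Hd]]]]] := mx_semisimple_part A.
have rVofX d N x : rVof E (iter N (fun y => f y - d *: y) x)
    = iter N (fun w => w *m A - d *: w) (rVof E x).
  elim: N => [//|N IH] /=; rewrite -IH linearB linearZ /=.
  by rewrite (rVof_app E bE).
exists (hommx E E S); split=> [d x [N xN]|x].
  rewrite hommxE // (HS _ d N) ?linearZ /= ?rVofK //.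
  by rewrite sub_kermxpoly_iter -rVofX xN linear0.
have /(submx_trans (submx1 (rVof E x)))/sub_sumsmxP[u Du] := Hd.
exists m, c, (fun i => vecof E (u i *m kermxpoly A (('X - (c i)%:P) ^+ M))); split.
  move=> i; exists M; apply/eqP; rewrite -(rVof_eq0 bE) rVofX vecofK //.
  by rewrite -sub_kermxpoly_iter submxMl.
by rewrite -[LHS](rVofK bE) Du linear_sum.
Qed.

(** Diagonalizability is assumed vector by vector, with eigenvalues depending on the vector; the
    finitely many eigenvalues occurring for the members of one basis suffice for all vectors. *)
Lemma codiagonal_basis (fs : seq 'End(V)) :
  {in fs &, forall f g, f \o g = g \o f}%VF ->
  {in fs, forall f x, exists (m : nat) (c : 'I_m -> K) (y : 'I_m -> V),
     (forall i, f (y i) = c i *: y i) /\ x = \sum_i y i} ->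
  exists2 X : (\dim {:V}).-tuple V, basis_of fullv X &
    {in fs, forall f (i : 'I_(\dim {:V})), exists a, f X`_i = a *: X`_i}.
Proof.
pose E := vbasis (@fullv K V); have bE : basis_of fullv E := vbasisP _.
move=> fsC fsD.
have diag : {in fs, forall f, diagonalizable (mxof E E f)}.
  move=> f ffs; apply/diagonalizablePeigen.
  have D1 (s : seq V) : exists rs, forall x, x \in s ->
      (rVof E x <= \sum_(r <- rs) eigenspace (mxof E E f) r)%MS.
    elim: s => [|x s [rs IH]]; first by exists [::].
    have [m [c [y [fy ->]]]] := fsD f ffs x.
    exists ([seq c i | i <- enum 'I_m] ++ rs) => z; rewrite big_cat /= inE.
    case/predU1P => [->|/IH zs]; last by apply: submx_trans zs (addsmxSr _ _).
    apply: submx_trans (addsmxSl _ _); rewrite linear_sum; apply: summx_sub => i _.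
    rewrite big_image /= (sumsmx_sup i) //; apply/eigenspaceP.
    by rewrite -(rVof_app E bE) fy linearZ.
  have [rs Hrs] := D1 E; exists (undup rs); first exact: undup_uniq.
  apply/eqmxP; rewrite submx1 /=; apply/row_subP => i.
  rewrite rowE mulmx1 -(rVofE bE).
  have /Hrs : E`_i \in (E : seq V) by rewrite mem_nth // size_tuple.
  move/submx_trans; apply.
  elim: (rs) => [|r l IH] /=; first by rewrite !big_nil sub0mx.
  case: ifP => [rl|_]; rewrite !big_cons; last by rewrite addsmxS.
  rewrite addsmx_sub IH andbT; apply: submx_trans IH.
  by rewrite (big_rem r) //= addsmxSl.
have [P Pu /allP/= Pd] : codiagonalizable [seq mxof E E f | f <- fs].
  apply/codiagonalizableP; split; last by move=> _ /mapP[f ffs ->]; apply: diag.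
  move=> _ _ /mapP[f ffs ->] /mapP[g gfs ->].
  by rewrite /comm_mx -!(mxof_comp _ _ bE) fsC.
pose X := [tuple vecof E (row i P) | i < \dim {:V}].
have Xi (i : 'I__) : X`_i = vecof E (row i P) by rewrite -tnth_nth tnth_mktuple.
have full : (fullv <= <<X>>)%VS.
  apply/subvP => v _; rewrite -(rVofK bE v) -(mulmxKV Pu (rVof E v)).
  rewrite mulmx_sum_row linear_sum; apply: rpred_sum => i _.
  by rewrite linearZ rpredZ //= -[vecof E _]Xi memv_span // mem_nth ?size_tuple.
exists X; first by rewrite basisEdim full size_tuple leqnn.
move=> f ffs i; have := Pd _ (map_f _ ffs) => /diagonalizable_forPex[D].
move/(simmxP Pu) => PD; exists (D 0 i).
by rewrite Xi (hom_vecof E bE) -row_mul PD row_mul row_diag_mx -scalemxAl -rowE linearZ.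
Qed.
End SquareTrace.

(** * Lie algebras and the Killing form *)

Section LieBasics.
Variables (K : fieldType) (g : lieAlgType K).
Implicit Types (x y z : g) (U V W h : {vspace g}).

HB.instance Definition _ x := GRing.isSemilinear.Build K g g _ (lieb x)
  (GRing.semilinear_linear (lieb_linearr x)).

Lemma adE x y : ad x y = lieb x y. Proof. exact: lfunE. Qed.

Lemma liebDl x y z : lieb (x + y) z = lieb x z + lieb y z.
Proof. by have := lieb_linearl z 1 x y; rewrite !scale1r. Qed.

Lemma liebZl a x z : lieb (a *: x) z = a *: lieb x z.
Proof.
have l0 : lieb 0 z = 0.
  by apply: (addIr (lieb 0 z)); rewrite -[LHS]liebDl !add0r.
by have /= := lieb_linearl z a x 0; rewrite addr0 l0 addr0.
Qed.

Lemma lieb0l z : lieb 0 z = 0. Proof. by have := liebZl 0 0 z; rewrite !scale0r. Qed.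

Lemma liebC x y : lieb x y = - lieb y x.
Proof.
have := liebxx (x + y); rewrite liebDl !linearD /= !liebxx add0r addr0.
by move/eqP; rewrite addr_eq0 => /eqP.
Qed.

Lemma liebNl x z : lieb (- x) z = - lieb x z.
Proof. by rewrite -scaleN1r liebZl scaleN1r. Qed.
Lemma liebBl x y z : lieb (x - y) z = lieb x z - lieb y z.
Proof. by rewrite liebDl liebNl. Qed.
Lemma liebDr x y z : lieb x (y + z) = lieb x y + lieb x z.
Proof. exact: linearD. Qed.
Lemma liebZr x a z : lieb x (a *: z) = a *: lieb x z.
Proof. exact: linearZ. Qed.
Lemma liebBr x y z : lieb x (y - z) = lieb x y - lieb x z.
Proof. exact: linearB. Qed.
Lemma lieb_suml I (s : seq I) P (F : I -> g) z :
  lieb (\sum_(i <- s | P i) F i) z = \sum_(i <- s | P i) lieb (F i) z.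
Proof.
apply: (big_morph (fun x => lieb x z)); last exact: lieb0l.
by move=> x y; rewrite liebDl.
Qed.

Lemma lieb_sumr I (s : seq I) P (F : I -> g) z :
  lieb z (\sum_(i <- s | P i) F i) = \sum_(i <- s | P i) lieb z (F i).
Proof. exact: linear_sum. Qed.

Lemma lieb_der x y z : lieb x (lieb y z) = lieb (lieb x y) z + lieb y (lieb x z).
Proof.
have := lieb_jacobi x y z; rewrite (liebC z (lieb x y)) (liebC z x) linearN /=.
by move/eqP; rewrite subr_eq add0r subr_eq => /eqP.
Qed.

Lemma ad_lie x y : ad (lieb x y) = (ad x \o ad y)%VF - (ad y \o ad x)%VF.
Proof.
apply/lfunP => z; rewrite add_lfunE opp_lfunE !comp_lfunE !adE lieb_der.
by rewrite addrK.
Qed.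

Lemma adD x y : ad (x + y) = ad x + ad y.
Proof. by apply/lfunP => z; rewrite add_lfunE !adE liebDl. Qed.
Lemma adZ a x : ad (a *: x) = a *: ad x.
Proof. by apply/lfunP => z; rewrite scale_lfunE !adE liebZl. Qed.

Lemma lieb_liev U V x y : x \in U -> y \in V -> lieb x y \in liev U V.
Proof.
move=> xU yV; rewrite (coord_vbasis xU) lieb_suml rpred_sum // => i _.
rewrite liebZl rpredZ // (coord_vbasis yV) linear_sum rpred_sum // => j _.
rewrite linearZ rpredZ // memv_span //; apply/allpairsP.
by exists ((vbasis U)`_i, (vbasis V)`_j); rewrite !mem_nth ?size_tuple.
Qed.

Lemma liev_subP U V W :
  reflect (forall x y, x \in U -> y \in V -> lieb x y \in W) (liev U V <= W)%VS.
Proof.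
apply: (iffP idP) => [/subvP sub x y xU yV|sub]; first exact/sub/lieb_liev.
apply/span_subvP => _ /allpairsP[[x y] /= [xU yV ->]].
by apply: sub; apply: vbasis_mem.
Qed.

Lemma liev_span (s t : seq g) W :
  (forall x y, x \in s -> y \in t -> lieb x y \in W) -> (liev <<s>> <<t>> <= W)%VS.
Proof.
move=> H; apply/liev_subP => x y xs yt.
rewrite (coord_span (X := in_tuple s) xs) lieb_suml rpred_sum // => i _.
rewrite liebZl rpredZ // (coord_span (X := in_tuple t) yt) lieb_sumr rpred_sum // => j _.
by rewrite liebZr rpredZ // H // mem_nth.
Qed.

Lemma killingE x y : killing x y = trl (ad x \o ad y)%VF. Proof. by []. Qed.
Lemma killing_sym x y : killing x y = killing y x.
Proof. exact: trlC. Qed.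
Lemma killingDl x y z : killing (x + y) z = killing x z + killing y z.
Proof. by rewrite !killingE adD comp_lfunDl trlD. Qed.
Lemma killingZl a x z : killing (a *: x) z = a * killing x z.
Proof. by rewrite !killingE adZ -comp_lfunZl trlZ. Qed.
Lemma killing_linearr x : linear (fun y => killing x y : K^o).
Proof. by move=> a y z; rewrite !(killing_sym x) killingDl killingZl. Qed.
Lemma killingZr x a y : killing x (a *: y) = a * killing x y.
Proof. by rewrite killing_sym killingZl killing_sym. Qed.
Lemma killing_inv x y z : killing (lieb x y) z = killing x (lieb y z).
Proof.
have E (A B C : 'End(g)) : trl (((A \o B) - (B \o A)) \o C)%VF = trl (A \o ((B \o C) - (C \o B)))%VF.
  rewrite comp_lfunDl comp_lfunDr comp_lfunNl comp_lfunNr !trlB.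
  by rewrite !comp_lfunA; congr (_ - _); rewrite -[in LHS]comp_lfunA trlC.
by rewrite !killingE !ad_lie; apply: E.
Qed.

HB.instance Definition _ x := GRing.isSemilinear.Build K g K^o _ (killing x : g -> K^o)
  (GRing.semilinear_linear (killing_linearr x)).

Definition killing_flat : 'Hom(g, 'Hom(g, K^o)) :=
  linfun (fun x => linfun (killing x : g -> K^o)).
Lemma killing_flatE x y : killing_flat x y = killing x y.
Proof.
rewrite /killing_flat linfun_linear; first by rewrite lfunE.
move=> a u v; apply/lfunP => z; rewrite add_lfunE scale_lfunE !lfunE /=.
by rewrite killingDl killingZl.
Qed.

End LieBasics.

(** * Weights of a Cartan subalgebra *)

(* Outside h, vsproj and hence weval take junk values. *)
Definition weval (K : fieldType) (g : lieAlgType K) (h : {vspace g})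
  (b : dualv K h) (u : g) : K := b (vsproj h u).

Section Weights.
Variables (K : fieldType) (g : lieAlgType K) (h : {vspace g}).
Implicit Types (b c : dualv K h) (x y u v : g).

Lemma wevalD b u v : weval b (u + v) = weval b u + weval b v.
Proof. by rewrite /weval !linearD. Qed.
Lemma wevalZ b a u : weval b (a *: u) = a * weval b u.
Proof. by rewrite /weval !linearZ. Qed.
Lemma wevalDl b c u : weval (b + c) u = weval b u + weval c u.
Proof. by rewrite /weval add_lfunE. Qed.
Lemma wevalNl b u : weval (- b) u = - weval b u.
Proof. by rewrite /weval opp_lfunE. Qed.
Lemma weval0l u : weval (0 : dualv K h) u = 0.
Proof. by rewrite /weval zero_lfunE. Qed.
Lemma weval_suml I (s : seq I) P (F : I -> dualv K h) u :
  weval (\sum_(i <- s | P i) F i) u = \sum_(i <- s | P i) weval (F i) u.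
Proof. by rewrite /weval sum_lfunE. Qed.
Lemma wevalZl a b u : weval (a *: b) u = a * weval b u.
Proof. by rewrite /weval scale_lfunE. Qed.
Lemma wevalMnl b n u : weval (b *+ n) u = weval b u *+ n.
Proof. by elim: n => [|n IH]; rewrite ?mulr0n ?weval0l // !mulrS wevalDl IH. Qed.

Lemma weval_inj b c : {in h, weval b =1 weval c} -> b = c.
Proof.
move=> e; apply/lfunP => w; have := e (vsval w) (subvsP w).
by rewrite /weval vsvalK.
Qed.

Lemma root_spaceP b x :
  reflect (forall u, u \in h -> lieb u x = weval b u *: x) (x \in root_space b).
Proof.
have E u : (x \in lker (ad u - (b (vsproj h u) : K) *: (\1%VF : 'End(g)))) =
    (lieb u x == weval b u *: x).
  by rewrite memv_ker add_lfunE opp_lfunE scale_lfunE id_lfunE subr_eq0 adE.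
have -> : (x \in root_space b) = all (fun u => lieb u x == weval b u *: x) (vbasis h).
  rewrite /root_space; elim: (vbasis h : seq g) => [|u s IH] /=.
    by rewrite big_nil memvf.
  by rewrite big_cons memv_cap IH E.
apply: (iffP allP) => [H u uh|H u /vbasis_mem uh]; last by rewrite H.
rewrite (coord_vbasis uh) lieb_suml.
rewrite (_ : weval b _ = \sum_i weval b (coord (vbasis h) i u *: (vbasis h)`_i)); last first.
  by rewrite /weval !linear_sum.
rewrite scaler_suml; apply: eq_bigr => i _; rewrite liebZl wevalZ -scalerA.
by congr (_ *: _); apply/eqP/H; rewrite mem_nth ?size_tuple.
Qed.

Lemma root_space_lieb b c x y : x \in root_space b -> y \in root_space c ->
  lieb x y \in root_space (b + c).
Proof.
move=> /root_spaceP xb /root_spaceP yc; apply/root_spaceP => u uh.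
by rewrite lieb_der (xb u uh) (yc u uh) liebZl linearZ /= -scalerDl wevalDl.
Qed.
End Weights.

(** * The Cartan subalgebra: nondegenerate Killing form, inner derivations, weight basis *)

Section Cartan.
Variables (K : numClosedFieldType) (g : lieAlgType K) (h : {vspace g}).
Variables (r : nat) (D : r.-tuple (dualv K h)).
Hypothesis (gS : simple_lie g) (hC : cartan_subalgebra h) (DS : simple_roots D).
Hypothesis (r_gt0 : (0 < r)%N).
Implicit Types (b c : dualv K h) (x y u v : g).

Lemma simple_root_vector i : exists2 x, x != 0 & x \in root_space (tnth D i).
Proof.
case: DS => /(_ i)[_ nz] _ _; exists (vpick (root_space (tnth D i))).
  by rewrite vpick0.
exact: memv_pick.
Qed.

Lemma dual_span b : exists a : 'I_r -> K, b = \sum_i a i *: tnth D i.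
Proof.
case: DS => _ bD _; exists (fun i => coord D i b).
rewrite {1}(coord_basis bD (memvf b)); apply: eq_bigr => i _.
by rewrite (tnth_nth 0).
Qed.

(** The simple roots span the dual of [h], so where they vanish all coordinates vanish.
    Commutativity of [h] and the nonvanishing of a(t_a) rest on this separation. *)
Lemma dual_sep u : u \in h -> (forall i, weval (tnth D i) u = 0) -> u = 0.
Proof.
move=> uh Du; have bu b : weval b u = 0.
  have [a ->] := dual_span b; rewrite weval_suml big1 // => i _.
  by rewrite wevalZl Du mulr0.
rewrite -(vsprojK uh); apply/eqP; set w := vsproj h u; apply/eqP.
suff -> : w = 0 by rewrite linear0.
rewrite (coord_vbasis (memvf w)) big1 // => i _.
pose f : dualv K h := linfun (coord (vbasis fullv) i : subvs_of h -> K^o).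
by have := bu f; rewrite /weval lfunE /= => ->; rewrite scale0r.
Qed.

(** Evaluation at the simple roots is injective, and [h] has dimension [r] because its dual has a
    basis of [r] elements. The constant family 1 gives the element that grades g by the height of
    roots. *)
Lemma dual_surj (c : 'I_r -> K) : exists2 u, u \in h & forall i, weval (tnth D i) u = c i.
Proof.
pose F (w : subvs_of h) : 'rV[K]_r := \row_i (tnth D i w).
have linF : linear F.
  by move=> a u v; apply/rowP => i; rewrite !mxE linearP.
pose phi : 'Hom(subvs_of h, 'rV[K]_r) := linfun F.
have phiE w : phi w = F w by rewrite linfun_linear.
have ker0 : lker phi = 0%VS.
  apply/eqP; rewrite -subv0; apply/subvP => w; rewrite memv_ker memv0 phiE.
  move/eqP/rowP => Fw; apply/eqP/val_inj.
  by apply: dual_sep (subvsP w) _ => i; have := Fw i; rewrite !mxE /weval vsvalK.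
have hr : \dim {: subvs_of h} = r.
  case: DS => _ bD _; have := size_basis bD; rewrite !dimvf /dim /=.
  by rewrite muln1.
have full : limg phi = fullv.
  apply/eqP; rewrite eqEdim subvf limg_dim_eq ?ker0 ?capv0 // hr dimvf.
  by rewrite /dim /= mul1n.
have : \row_i c i \in limg phi by rewrite full memvf.
case/memv_imgP => w _ wE; exists (vsval w); first exact: subvsP.
by move=> i; have /rowP/(_ i) := wE; rewrite phiE !mxE /weval vsvalK.
Qed.

(** On a root vector [lieb u v] acts as the commutator of two scalars, so every simple root vanishes
    on it. *)
Lemma cartan_abelian u v : u \in h -> v \in h -> lieb u v = 0.
Proof.
move=> uh vh; case: hC => /liev_subP hh _ _; apply: dual_sep => [|i]; first exact: hh.
have [x x0 xD] := simple_root_vector i.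
have /root_spaceP Dx := xD.
have := Dx _ (hh _ _ uh vh).
have -> : lieb (lieb u v) x = 0.
  have := lieb_der u v x; rewrite (Dx v vh) (Dx u uh) !linearZ /= (Dx v vh) (Dx u uh).
  rewrite !scalerA [_ * weval _ u]mulrC.
  by move/eqP; rewrite -subr_eq addrN eq_sym => /eqP.
by move/esym/eqP; rewrite scaler_eq0 (negPf x0) orbF => /eqP.
Qed.

Lemma cartan_centralizer x : (forall u, u \in h -> lieb u x = 0) -> x \in h.
Proof.
case: hC => _ _ hn Cx; apply: hn => y yh; rewrite liebC Cx // oppr0; exact: mem0v.
Qed.

Lemma root_space0 : root_space (0 : dualv K h) = h.
Proof.
apply/vspaceP => x; apply/root_spaceP/idP => [H|xh u uh].
  by apply: cartan_centralizer => u uh; rewrite H // weval0l scale0r.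
by rewrite cartan_abelian // weval0l scale0r.
Qed.

Lemma h_eigenvalue (U : {vspace g}) u : U != 0%VS ->
  (forall x, x \in U -> lieb u x \in U) ->
  exists2 a, exists2 x, x != 0 & x \in U & exists2 x, x != 0 & x \in U /\ lieb u x = a *: x.
Proof.
move=> U0 Uu.
pose f : 'End(subvs_of U) := (linfun (vsproj U) \o ad u \o linfun vsval)%VF.
have fE w : vsval (f w) = lieb u (vsval w).
  rewrite !comp_lfunE adE !lfunE /=.
  by rewrite vsprojK // Uu // subvsP.
pose E := vbasis {: subvs_of U}.
have d0 : (0 < \dim {: subvs_of U})%N.
  by rewrite dimvf /dim /= lt0n dimv_eq0.
have [a] := eigenvalue_closed (passmx.mxof E E f) d0.
rewrite -leigenvalueE => /leigenvalueP[w w0 fw].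
have w0' : vsval w != 0 by apply: contraNneq w0 => w0; apply/eqP/val_inj.
exists a; exists (vsval w) => //; rewrite ?subvsP //; split=> //.
by rewrite -fE fw linearZ.
Qed.

Lemma joint_eigenspace (U : {vspace g}) (s : seq g) : U != 0%VS -> {subset s <= h} ->
  (forall u x, u \in h -> x \in U -> lieb u x \in U) ->
  exists U' : {vspace g}, [/\ U' != 0%VS, (U' <= U)%VS,
    forall u x, u \in h -> x \in U' -> lieb u x \in U'
   & {in s, forall u, exists a, {in U', forall x, lieb u x = a *: x}}].
Proof.
move=> U0; elim: s => [|u s IH] sh Uh; first by exists U; split.
have [|U' [U'0 U'U U'h U's]] := IH _ Uh; first by move=> v vs; rewrite sh // inE vs orbT.
have uh : u \in h by rewrite sh // inE eqxx.
have [a _ [x x0 [xU' ux]]] := h_eigenvalue U'0 (U'h u ^~ uh).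
exists (U' :&: lker (ad u - a *: \1%VF))%VS.
have mE y : (y \in lker (ad u - a *: \1%VF)) = (lieb u y == a *: y).
  by rewrite memv_ker add_lfunE opp_lfunE scale_lfunE id_lfunE subr_eq0 adE.
split.
- apply/eqP => /vspaceP/(_ x); rewrite memv0 (negPf x0) memv_cap xU' mE ux eqxx //.
- by apply: subv_trans U'U; apply: capvSl.
- move=> v y vh; rewrite !memv_cap !mE => /andP[yU /eqP uy]; rewrite U'h //=.
  by rewrite lieb_der (cartan_abelian uh vh) lieb0l add0r uy linearZ.
- move=> v; rewrite inE => /predU1P[->|vs].
    by exists a => y; rewrite memv_cap mE => /andP[_ /eqP].
  have [c Hc] := U's v vs; exists c => y; rewrite memv_cap => /andP[yU' _]; exact: Hc.
Qed.

Lemma weight_of_eigen x : x != 0 -> {in vbasis h, forall u, exists a, lieb u x = a *: x} ->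
  exists b, x \in root_space b.
Proof.
move=> x0 Hx.
have Hx' u : u \in h -> exists a, lieb u x = a *: x.
  move=> uh; have /choice[c cE] : forall i : 'I_(\dim h), exists a, lieb (vbasis h)`_i x = a *: x.
    by move=> i; apply: Hx; rewrite mem_nth ?size_tuple.
  rewrite (coord_vbasis uh) lieb_suml.
  exists (\sum_i coord (vbasis h) i u * c i); rewrite scaler_suml.
  by apply: eq_bigr => i _; rewrite liebZl cE scalerA.
pose F (w : subvs_of h) : K^o := coord [tuple x] 0 (lieb (vsval w) x).
have linF : linear F by move=> a u v; rewrite /F linearP liebDl liebZl linearP.
exists (linfun F).
apply/root_spaceP => u uh; rewrite /weval linfun_linear // /F vsprojK //.
have [a ->] := Hx' u uh; rewrite linearZ /=.
have -> : coord [tuple x] 0 x = 1.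
  by have := @coord_free _ _ _ [tuple x] 0 0; rewrite /= seq1_free x0 => ->.
by rewrite mulr1.
Qed.

Lemma joint_eigenvector (U : {vspace g}) : U != 0%VS ->
  (forall u x, u \in h -> x \in U -> lieb u x \in U) ->
  exists x b, [/\ x != 0, x \in U & x \in root_space b].
Proof.
move=> U0 Uh.
have [U' [U'0 U'U _ U's]] := joint_eigenspace U0 (@vbasis_mem _ _ ^~ h) Uh.
have x0 : vpick U' != 0 by rewrite vpick0.
have [|b bx] := weight_of_eigen x0.
  by move=> u uh; have [a Ha] := U's u uh; exists a; apply/Ha/memv_pick.
by exists (vpick U'), b; split=> //; apply: (subvP U'U); apply: memv_pick.
Qed.

(* If every simple root takes the value 1 at u0, then ad u0 has integral
   eigenvalues, so killing u0 u0 > 0 and the radical, an ideal, is not g. *)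
Lemma killing_nondeg x : (forall y, killing x y = 0) -> x = 0.
Proof.
move=> xR.
have [u0 u0h Du0] := dual_surj (fun _ => 1).
have trpos : 0 < killing u0 u0.
  apply: sq_trace_gt0 => [c|].
    move=> cE; have U0 : passmx.leigenspace (ad u0) c != 0%VS by [].
    have mE y : (y \in passmx.leigenspace (ad u0) c) = (lieb u0 y == c *: y).
      by rewrite memv_ker add_lfunE opp_lfunE scale_lfunE id_lfunE subr_eq0 adE.
    have [|y [b [y0 yU yb]]] := joint_eigenvector U0.
      move=> u y uh; rewrite !mE => /eqP uy.
      by rewrite lieb_der (cartan_abelian u0h uh) lieb0l add0r uy linearZ.
    have cb : c = weval b u0.
      move: yU; rewrite mE (root_spaceP _ _ yb) // -subr_eq0 -scalerBl scaler_eq0.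
      by rewrite (negPf y0) orbF subr_eq0 => /eqP.
    have [b0|b0] := eqVneq b 0; first by rewrite cb b0 weval0l real0.
    have br : is_root b.
      split=> //; apply: contraNneq y0 => U0'.
      by move: yb; rewrite U0' memv0.
    case: DS => _ _ /(_ b br)[n H].
    have nr : \sum_i (n i)%:R \is @Num.real K by rewrite rpred_sum // => i _; apply: realn.
    have [->|->] : c = \sum_i (n i)%:R \/ c = - \sum_i (n i)%:R; rewrite ?rpredN //.
    rewrite cb; case: H => ->; [left|right]; rewrite ?wevalNl weval_suml; last congr (- _);
      by apply: eq_bigr => i _; rewrite wevalMnl Du0.
  exists 1; first exact: oner_neq0.
  have [y y0 yD] := simple_root_vector (Ordinal r_gt0).
  apply/leigenvalueP; exists y => //.
  by rewrite adE (root_spaceP _ _ yD) // Du0.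
pose R := lker (killing_flat g).
have RP y : (y \in R) = `[< forall z, killing y z = 0 >].
  rewrite memv_ker; apply/eqP/asboolP => [H z|H].
    by rewrite -killing_flatE H zero_lfunE.
  by apply/lfunP => z; rewrite killing_flatE H zero_lfunE.
have Rid : lie_ideal R.
  move=> a y; rewrite !RP => /asboolP H; apply/asboolP => z.
  by rewrite liebC -scaleN1r killingZl killing_inv H mulr0.
case: gS => _ /(_ R Rid)[R0|R1].
  by apply/eqP; rewrite -memv0 -R0 RP; apply/asboolP.
have := memvf u0; rewrite -R1 RP => /asboolP/(_ u0) e.
by rewrite e ltxx in trpos.
Qed.

Lemma killing_repr (f : g -> K^o) : linear f -> exists d, forall x, killing d x = f x.
Proof.
move=> linf.
have ker0 : lker (killing_flat g) == 0%VS.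
  apply/eqP/eqP; rewrite -subv0; apply/subvP => x; rewrite memv_ker memv0 => /eqP H.
  by apply/eqP/killing_nondeg => y; rewrite -killing_flatE H zero_lfunE.
have full : limg (killing_flat g) = fullv.
  apply/eqP; rewrite eqEdim subvf limg_dim_eq ?(eqP ker0) ?capv0 // !dimvf /dim /=.
  by rewrite muln1.
pose phi : 'Hom(g, K^o) := linfun f.
have : phi \in limg (killing_flat g) by rewrite full memvf.
by case/memv_imgP => d _ dE; exists d => x; rewrite -killing_flatE -dE linfun_linear.
Qed.

(** Let [s] represent the functional x -> tr(d ad x) for the Killing form, and let e = d - ad s.
    Then tr(e ad y) = 0 for all y, and ad(e x) = [e, ad x] turns [killing (e x) y] into tr(e ad
    [x, y]) = 0. *)
Lemma derivation_inner (d : 'End(g)) :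
  (forall x y, d (lieb x y) = lieb (d x) y + lieb x (d y)) ->
  exists s, forall x, d x = lieb s x.
Proof.
move=> der.
have [|s sE] := @killing_repr (fun x => trl (d \o ad x)%VF).
  by move=> a x y; rewrite adD adZ comp_lfunDr -comp_lfunZr trlD trlZ.
exists s => x; apply/eqP; rewrite -subr_eq0; apply/eqP.
pose e : 'End(g) := d - ad s.
have eE y : e y = d y - lieb s y by rewrite add_lfunE opp_lfunE adE.
have eder y z : e (lieb y z) = lieb (e y) z + lieb y (e z).
  by rewrite !eE der lieb_der liebBl linearB opprD addrACA.
have ee y : ad (e y) = (e \o ad y)%VF - (ad y \o e)%VF.
  apply/lfunP => z; rewrite add_lfunE opp_lfunE !comp_lfunE !adE eder.
  by rewrite addrK.
have tr0 y : trl (e \o ad y)%VF = 0.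
  by rewrite comp_lfunDl comp_lfunNl trlB -sE killingE subrr.
rewrite -eE; apply: killing_nondeg => y.
rewrite killingE ee comp_lfunDl comp_lfunNl trlB.
rewrite -!comp_lfunA [X in _ - X]trlC -comp_lfunA -trlB -comp_lfunNr -comp_lfunDr.
by rewrite -ad_lie.
Qed.

(* The semisimple part of ad u is a derivation, hence inner, say ad s; s lies in
   h and the simple roots do not separate it from u. *)
Lemma ad_semisimple u x : u \in h -> exists (m : nat) (c : 'I_m -> K) (y : 'I_m -> g),
  (forall i, lieb u (y i) = c i *: y i) /\ x = \sum_i y i.
Proof.
move=> uh; have [S [SE Sdec]] := semisimple_part (ad u).
(* With T_c = ad u - c one has T_(c+d) [a, b] = [T_c a, b] + [a, T_d b], and each term lowers
   [N + M] by one. *)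
have gen_lie (c d : K) (a b : g) : gen_eigen (ad u) c a -> gen_eigen (ad u) d b ->
    gen_eigen (ad u) (c + d) (lieb a b).
  pose T (e : K) (y : g) := ad u y - e *: y.
  have iter0 L e : iter L (T e) 0 = 0.
    by elim: L => //= L ->; rewrite /T linear0 scaler0 subr0.
  have iterD L e p q : iter L (T e) (p + q) = iter L (T e) p + iter L (T e) q.
    by elim: L => //= L ->; rewrite /T linearD scalerDr opprD addrACA.
  have Tlie p q : T (c + d) (lieb p q) = lieb (T c p) q + lieb p (T d q).
    by rewrite /T !adE lieb_der scalerDl opprD liebBl liebZl liebBr liebZr addrACA.
  move=> [N aN] [M bM]; exists (N + M)%N; move: aN bM.
  rewrite -/(T c) -/(T d) -/(T (c + d)).
  have [k] := ubnP (N + M); elim: k => // k IH in N M a b *.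
  case: N => [|N] NMk aN bM; first by rewrite /= in aN; rewrite aN lieb0l iter0.
  case: M bM NMk => [|M] bM NMk; first by rewrite /= in bM; rewrite bM linear0 iter0.
  rewrite addSn iterSr Tlie iterD IH ?add0r //; last by rewrite -iterSr.
  by rewrite addnS -addSn IH // -?iterSr // addSnnS.
have Sder (a b : g) : S (lieb a b) = lieb (S a) b + lieb a (S b).
  have [m [c [y [yc ->]]]] := Sdec a; have [p [d [z [zd ->]]]] := Sdec b.
  rewrite lieb_suml !(linear_sum S) !lieb_suml -big_split /=; apply: eq_bigr => i _.
  rewrite !(linear_sum (lieb _)) (linear_sum S) -big_split /=; apply: eq_bigr => j _.
  rewrite (SE (c i + d j)); last exact: gen_lie.
  by rewrite (SE _ _ (yc i)) (SE _ _ (zd j)) liebZl linearZ -scalerDl.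
have [s sE] := derivation_inner Sder.
have sh : s \in h.
  apply: cartan_centralizer => v vh; rewrite liebC -sE (SE 0).
    by rewrite scale0r oppr0.
  by exists 1%N; rewrite /= adE cartan_abelian // scale0r subr0.
have su : s - u = 0.
  apply: dual_sep => [|i]; first exact: memvB.
  have [z z0 zD] := simple_root_vector i.
  have : lieb s z = weval (tnth D i) u *: z.
    rewrite -sE (SE (weval (tnth D i) u)) //; exists 1%N.
    by rewrite /= adE (root_spaceP _ _ zD) // subrr.
  rewrite (root_spaceP _ _ zD) // => /eqP; rewrite -subr_eq0 -scalerBl scaler_eq0.
  by rewrite (negPf z0) orbF -mulN1r -wevalZ -wevalD scaleN1r => /eqP.
have {su} su : s = u by apply/eqP; rewrite -subr_eq0 su.
have [m [c [y [yc ->]]]] := Sdec x; exists m, c, y; split=> // i.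
by rewrite -su -sE (SE _ _ (yc i)).
Qed.

Lemma weight_basis : exists (X : (\dim {:g}).-tuple g) (w : 'I_(\dim {:g}) -> dualv K h),
  basis_of fullv X /\ forall i : 'I_(\dim {:g}), X`_i \in root_space (w i).
Proof.
have [||X bX XE] := @codiagonal_basis K g [seq ad u | u <- vbasis h].
- move=> _ _ /mapP[u /vbasis_mem uh ->] /mapP[v /vbasis_mem vh ->].
  apply/eqP; rewrite -subr_eq0 -ad_lie cartan_abelian //; apply/eqP/lfunP => z.
  by rewrite adE lieb0l zero_lfunE.
- move=> _ /mapP[u /vbasis_mem uh ->] x.
  have [m [c [y [yc ->]]]] := ad_semisimple x uh; exists m, c, y; split=> // i.
  by rewrite adE.
have : forall i : 'I_(\dim {:g}), exists b, X`_i \in root_space b.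
  move=> i; apply: weight_of_eigen.
    by apply: (basis_not0 bX); rewrite mem_nth ?size_tuple.
  by move=> u uh; have [|a aE] := XE (ad u) _ i; [exact: map_f|exists a; rewrite -adE].
by case/choice => w wE; exists X, w.
Qed.
End Cartan.

(** * Root spaces, the vectors t_a and traces of commutators *)

Section RootSpaces.
Variables (K : numClosedFieldType) (g : lieAlgType K) (h : {vspace g}).
Variables (r : nat) (D : r.-tuple (dualv K h)).
Hypothesis (gS : simple_lie g) (hC : cartan_subalgebra h) (DS : simple_roots D).
Hypothesis (r_gt0 : (0 < r)%N).
Local Notation n := (\dim {:g}).
Variables (X : n.-tuple g) (w : 'I_n -> dualv K h).
Hypothesis (bX : basis_of fullv X) (Xw : forall i : 'I_n, X`_i \in root_space (w i)).
Implicit Types (a b c : dualv K h) (x y u v : g) (i j : 'I_n).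

(** Read off the basis [X], hence decidable. The functional 0 counts as a weight, so the roots are
    the nonzero ones. *)
Definition is_weight b := [exists i, w i == b].

Lemma X_neq0 i : X`_i != 0.
Proof. by apply: (basis_not0 bX); rewrite mem_nth ?size_tuple. Qed.

Lemma coordX i j : coord X i X`_j = (j == i)%:R.
Proof. exact/coord_free/(basis_free bX). Qed.

Lemma coordXE x : x = \sum_i coord X i x *: X`_i.
Proof. exact/(coord_basis bX)/memvf. Qed.

Lemma lieb_hX u i : u \in h -> lieb u X`_i = weval (w i) u *: X`_i.
Proof. exact/root_spaceP. Qed.

Lemma coord_root_space b x i : x \in root_space b -> coord X i x != 0 -> w i = b.
Proof.
move=> /root_spaceP xb xi; apply: weval_inj => u uh; apply/eqP.
rewrite -subr_eq0; apply/eqP/(mulIf xi); rewrite mul0r mulrBl.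
have := congr1 (coord X i) (xb u uh).
rewrite linearZ /= => <-; rewrite {2}(coordXE x) !linear_sum (bigD1 i) //= big1.
  by rewrite addr0 liebZr (lieb_hX _ uh) !linearZ /= coordX eqxx mulr1 mulrC subrr.
move=> j ji; rewrite liebZr (lieb_hX _ uh) !linearZ /= coordX (negPf ji).
by rewrite !mulr0.
Qed.

Lemma root_space_weight b x : x \in root_space b -> x != 0 -> is_weight b.
Proof.
move=> xb x0; suff [i xi] : exists i, coord X i x != 0.
  by apply/existsP; exists i; apply/eqP; apply: coord_root_space xb xi.
apply/existsP; apply: contraNT x0 => /existsPn H.
by rewrite (coordXE x) big1 // => i _; have := H i; rewrite negbK => /eqP->; rewrite scale0r.
Qed.

Lemma is_rootE b : is_root b <-> (b != 0) && is_weight b.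
Proof.
split=> [[b0 rs]|/andP[b0 /existsP[i /eqP bi]]].
  by rewrite b0; apply: (root_space_weight (memv_pick _)); rewrite vpick0.
split=> //; apply: contraNneq (X_neq0 i) => rs0.
by rewrite -memv0 -rs0 -bi.
Qed.

Lemma is_weightP b : reflect (exists i, w i = b) (is_weight b).
Proof. by apply: (iffP existsP) => -[i e]; exists i; apply/eqP. Qed.

Lemma simple_weight k : is_weight (tnth D k) && (tnth D k != 0).
Proof. by case: DS => /(_ k)/is_rootE; rewrite andbC. Qed.

Lemma weval_neq0 b : b != 0 -> exists2 u, u \in h & weval b u != 0.
Proof.
move=> b0; apply: contrapT => H; move/eqP: b0; apply; apply: weval_inj => u uh.
rewrite weval0l; apply: contrapT => bu; apply: H; exists u => //; exact/eqP.
Qed.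

Lemma killing_root a b x y : x \in root_space a -> y \in root_space b ->
  a + b != 0 -> killing x y = 0.
Proof.
move=> /root_spaceP xa /root_spaceP yb /weval_neq0[u uh]; rewrite wevalDl => ab.
apply: (mulfI ab); rewrite mulr0 mulrDl.
have -> : weval a u * killing x y = killing (lieb u x) y by rewrite xa // killingZl.
have -> : weval b u * killing x y = killing x (lieb u y) by rewrite yb // linearZ.
by rewrite (liebC u x) -scaleN1r killingZl mulN1r -killing_inv addNr.
Qed.

Lemma killing_h_nondeg u : u \in h -> (forall v, v \in h -> killing u v = 0) -> u = 0.
Proof.
move=> uh H; apply: (killing_nondeg gS hC DS r_gt0) => y.
rewrite (coordXE y) (linear_sum (killing u : g -> K^o)) big1 //= => i _.
rewrite linearZ /=; have [w0|w0] := eqVneq (w i) 0.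
  have Xh : X`_i \in h by rewrite -(root_space0 hC DS) -w0.
  by rewrite H // scaler0.
have u0 : u \in root_space (0 : dualv K h) by rewrite (root_space0 hC DS).
by rewrite (killing_root u0 (Xw i)) ?scaler0 // add0r.
Qed.

Lemma killing_pair a x : x \in root_space a -> x != 0 ->
  exists i, w i = - a /\ killing x X`_i != 0.
Proof.
move=> xa x0; apply: contrapT => H; move/eqP: x0; apply.
apply: (killing_nondeg gS hC DS r_gt0) => y.
rewrite (coordXE y) (linear_sum (killing x : g -> K^o)) big1 //= => i _.
rewrite linearZ /=; have [wa|wa] := eqVneq (a + w i) 0; last first.
  by rewrite (killing_root xa (Xw i)) ?scaler0.
have [->|kx] := eqVneq (killing x X`_i) 0; first by rewrite scaler0.
case: H; exists i; split=> //; apply/eqP.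
by rewrite -addr_eq0 addrC wa.
Qed.

(** This is t_b, not the coroot 2 t_b / b(t_b); the normalization appears as explicit factors in the
    statements that follow. *)
Definition coroot_dual b : g := vsval (killing_dual b).

Lemma coroot_dual_h b : coroot_dual b \in h. Proof. exact: subvsP. Qed.

(** [killing_dual] is an inverse of a linear map, so it has the expected meaning only when that map
    is bijective: it is injective because the Killing form is nondegenerate on [h], and the
    dimensions agree. *)
Lemma coroot_dualE b u : u \in h -> killing (coroot_dual b) u = weval b u.
Proof.
move=> uh; rewrite /coroot_dual /killing_dual.
pose F (v : subvs_of h) : dualv K h :=
  linfun (fun z : subvs_of h => killing (vsval v) (vsval z) : K^o).
have linF0 (v : subvs_of h) : linear (fun z : subvs_of h => killing (vsval v) (vsval z) : K^o).
  by move=> c p q; exact: (killing_linearr (vsval v) c (vsval p) (vsval q)).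
have FE (v z : subvs_of h) : F v z = killing (vsval v) (vsval z).
  by rewrite /F linfun_linear.
have linF : linear F.
  move=> a p q; apply/lfunP => z; rewrite add_lfunE scale_lfunE !FE linearP /=.
  by rewrite killingDl killingZl.
pose phi : 'Hom(subvs_of h, dualv K h) := linfun F.
have phiE (v : subvs_of h) : phi v = F v by rewrite linfun_linear.
have ker0 : lker phi == 0%VS.
  rewrite -subv0; apply/subvP => v; rewrite memv_ker memv0 phiE => /eqP Fv.
  apply/eqP/val_inj; apply: killing_h_nondeg (subvsP v) _ => z zh.
  by have := FE v (vsproj h z); rewrite vsprojK // Fv zero_lfunE.
have full : limg phi = fullv.
  apply/eqP; rewrite eqEdim subvf limg_dim_eq ?(eqP ker0) ?capv0 // !dimvf /dim /=.
  by rewrite muln1.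
have inv : phi (phi^-1%VF b) = b by apply: limg_lfunVK; rewrite full memvf.
by rewrite /weval -{2}inv phiE FE vsprojK.
Qed.

Lemma lieb_coroot a x y : x \in root_space a -> y \in root_space (- a) ->
  lieb x y = killing x y *: coroot_dual a.
Proof.
move=> xa ya; apply/eqP; rewrite -subr_eq0; apply/eqP; apply: killing_h_nondeg.
  rewrite memvB // ?memvZ ?coroot_dual_h // -(root_space0 hC DS) -(subrr a).
  exact: root_space_lieb.
move=> v vh; rewrite killingDl -scaleN1r !killingZl coroot_dualE // killing_inv.
rewrite liebC (root_spaceP _ _ ya) // wevalNl scaleNr opprK.
by rewrite killingZr mulN1r mulrC subrr.
Qed.

Lemma weightN a : is_weight a -> is_weight (- a).
Proof.
case/is_weightP => i <-; have [j [wj _]] := killing_pair (Xw i) (X_neq0 i).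
by apply/is_weightP; exists j.
Qed.

(** This pair plays the role of an sl_2-triple; [y] is scaled so that the bracket is t_a itself. *)
Lemma root_triple a x : x \in root_space a -> x != 0 ->
  exists2 y, y \in root_space (- a) & lieb x y = coroot_dual a.
Proof.
move=> xa x0; have [j [wj kj]] := killing_pair xa x0.
have ya : (killing x X`_j)^-1 *: X`_j \in root_space (- a) by rewrite memvZ // -wj.
exists ((killing x X`_j)^-1 *: X`_j) => //.
by rewrite (lieb_coroot xa ya) killingZr mulVf // scale1r.
Qed.

Definition stable_set (P : pred 'I_n) x :=
  forall i j, P i -> coord X j (lieb x X`_i) != 0 -> P j.

(* A commutator of endomorphisms of the span of the basis vectors in P has
   trace 0; all facts on root strings come from choices of P. *)
Lemma stable_trace (P : pred 'I_n) x y : stable_set P x -> stable_set P y ->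
  \sum_(i | P i) coord X i (lieb (lieb x y) X`_i) = 0.
Proof.
move=> sx sy.
have cE p q i : P i -> stable_set P q -> coord X i (lieb p (lieb q X`_i)) =
    \sum_(j | P j) coord X j (lieb q X`_i) * coord X i (lieb p X`_j).
  move=> Pi sq; rewrite {1}(coordXE (lieb q X`_i)) !linear_sum /= [RHS]big_mkcond.
  apply: eq_bigr => j _; rewrite !linearZ /=; case: ifPn => // /negP nPj.
  have [->|H] := eqVneq (coord X j (lieb q X`_i)) 0; first by rewrite mul0r.
  by case: nPj; apply: sq H.
transitivity (\sum_(i | P i) \sum_(j | P j) (coord X j (lieb y X`_i) * coord X i (lieb x X`_j)
   - coord X j (lieb x X`_i) * coord X i (lieb y X`_j))).
  apply: eq_bigr => i Pi; rewrite -adE ad_lie add_lfunE opp_lfunE !comp_lfunE !adE.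
  by rewrite linearB /= !cE // -sumrB.
under eq_bigr do rewrite sumrB.
rewrite sumrB [X in _ - X]exchange_big /=.
by apply/eqP; rewrite subr_eq0; apply/eqP/eq_bigr => i _; apply: eq_bigr => j _; rewrite mulrC.
Qed.

Lemma stable_weights (P : pred 'I_n) x y u : u \in h -> lieb x y = u ->
  stable_set P x -> stable_set P y -> \sum_(i | P i) weval (w i) u = 0.
Proof.
move=> uh xy sx sy; rewrite -[RHS](stable_trace sx sy); apply: eq_bigr => i _.
by rewrite xy (lieb_hX _ uh) linearZ /= coordX eqxx mulr1.
Qed.

Lemma coord_lieb_root a x i j : x \in root_space a ->
  coord X j (lieb x X`_i) != 0 -> w j = a + w i.
Proof. by move=> xa; apply/coord_root_space/root_space_lieb. Qed.

Local Notation t := coroot_dual.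

(** Trace over all basis vectors whose weight lies on the line [w i + Z a]; [m] is their number.
    Thus the value of any weight at t_a is a rational multiple of that of [a]. *)
Lemma weval_string a i : a != 0 -> is_weight a ->
  exists k : int, exists2 m : nat, (0 < m)%N &
    weval (w i) (t a) *+ m = weval a (t a) *~ k.
Proof.
move=> a0 /is_weightP[ia wa].
have xa : X`_ia \in root_space a by rewrite -wa.
have [y ya xy] := root_triple xa (X_neq0 ia).
pose P j := `[< exists k : int, w j = w i + a *~ k >].
have sx : stable_set P X`_ia.
  move=> j l /asboolP[k wj] /(coord_lieb_root xa) wl; apply/asboolP; exists (k + 1).
  by rewrite wl wj mulrzDr addrC addrA.
have sy : stable_set P y.
  move=> j l /asboolP[k wj] /(coord_lieb_root ya) wl; apply/asboolP; exists (k - 1).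
  by rewrite wl wj mulrzBr addrC addrA.
have := stable_weights (coroot_dual_h a) xy sx sy.
have /choice[k kE] : forall j, exists k : int, P j -> w j = w i + a *~ k.
  move=> j; case: (boolP (P j)) => [/asboolP[k kE]|nP]; [by exists k|by exists 0].
rewrite (eq_bigr (fun j => weval (w i) (t a) + weval a (t a) *~ k j)); last first.
  move=> j Pj; rewrite kE // wevalDl; congr (_ + _).
  by case: (k j) => m; rewrite ?NegzE ?mulrNz ?wevalNl -?pmulrn wevalMnl.
rewrite big_split /= sumr_const -mulrz_sumr => /eqP; rewrite addr_eq0 => /eqP H.
exists (- \sum_(j | P j) k j), #|P|; first by apply/card_gt0P; exists i; apply/asboolP; exists 0; rewrite addr0.
by rewrite H mulrNz.
Qed.

(** Otherwise every weight vanishes at t_a, the simple roots among them, so that t_a = 0 and then a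
    = 0. *)
Lemma coroot_norm_neq0 a : a != 0 -> is_weight a -> weval a (t a) != 0.
Proof.
move=> a0 wa; have := a0; apply: contra_neq => at0.
suff ta0 : t a = 0.
  apply: weval_inj => u uh; rewrite -coroot_dualE // ta0 weval0l.
  by rewrite -(scale0r (0 : g)) killingZl mul0r.
apply: (dual_sep DS (coroot_dual_h a)) => k.
have /andP[/is_weightP[i <-] _] := simple_weight k.
have [m [l l0]] := weval_string i a0 wa.
by rewrite at0 mul0rz => /eqP; rewrite mulrn_eq0 eqn0Ngt l0 => /eqP.
Qed.

Lemma killing_weights u v : u \in h -> v \in h ->
  killing u v = \sum_i weval (w i) u * weval (w i) v.
Proof.
move=> uh vh; rewrite killingE (trl_basis _ bX); apply: eq_bigr => i _.
rewrite comp_lfunE !adE (lieb_hX _ vh) liebZr (lieb_hX _ uh) !linearZ /= coordX eqxx.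
by rewrite mulr1 mulrC.
Qed.

Lemma coroot_normE a : weval a (t a) = \sum_i weval (w i) (t a) ^+ 2.
Proof.
by rewrite -coroot_dualE ?coroot_dual_h // killing_weights ?coroot_dual_h.
Qed.

Lemma weval_ratio_real a i : a != 0 -> is_weight a ->
  weval (w i) (t a) / weval a (t a) \is Num.real.
Proof.
move=> a0 wa; have [k [m m0 e]] := weval_string i a0 wa.
have at0 := coroot_norm_neq0 a0 wa.
have mK : m%:R != 0 :> K by rewrite pnatr_eq0 -lt0n.
have -> : weval (w i) (t a) / weval a (t a) = k%:~R / m%:R.
  apply/eqP; rewrite eqr_div // mulr_natr e mulrC -mulrzr //.
by rewrite realM // ?realV ?realn // realz.
Qed.

(** With c = a(t_a), the trace formula for the Killing form reads c = c^2 q, where [q] is a sum of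
    squares of real ratios; hence c q = 1 and both factors are positive. *)
Lemma coroot_norm_gt0 a : a != 0 -> is_weight a -> 0 < weval a (t a).
Proof.
move=> a0 wa; have at0 := coroot_norm_neq0 a0 wa.
set q := \sum_i (weval (w i) (t a) / weval a (t a)) ^+ 2.
have q1 : weval a (t a) * q = 1.
  apply: (mulfI at0); rewrite mulr1 [RHS]coroot_normE mulrA -expr2 mulr_sumr.
  by apply: eq_bigr => i _; rewrite -exprMn mulrCA mulfV ?mulr1.
have q0 : 0 <= q.
  by apply: sumr_ge0 => i _; rewrite real_exprn_even_ge0 // weval_ratio_real.
have {}q0 : 0 < q.
  by rewrite lt_def q0 andbT; apply: contraTneq (@ltr01 K) => q0'; rewrite -q1 q0' mulr0 ltxx.
by rewrite -(pmulr_lgt0 _ q0) q1 ltr01.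
Qed.

Lemma weval_real a i : a != 0 -> is_weight a -> weval (w i) (t a) \is Num.real.
Proof.
move=> a0 wa; rewrite -[weval (w i) _](divfK (coroot_norm_neq0 a0 wa)).
by rewrite realM ?weval_ratio_real // gtr0_real // coroot_norm_gt0.
Qed.
End RootSpaces.

(** * Root strings *)

Section RootStrings.
Variables (K : numClosedFieldType) (g : lieAlgType K) (h : {vspace g}).
Variables (r : nat) (D : r.-tuple (dualv K h)).
Hypothesis (gS : simple_lie g) (hC : cartan_subalgebra h) (DS : simple_roots D).
Hypothesis (r_gt0 : (0 < r)%N).
Local Notation n := (\dim {:g}).
Variables (X : n.-tuple g) (w : 'I_n -> dualv K h).
Hypothesis (bX : basis_of fullv X) (Xw : forall i : 'I_n, X`_i \in root_space (w i)).
Implicit Types (a b c : dualv K h) (x y u v : g) (i j : 'I_n).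

Local Notation t := coroot_dual.
Local Notation is_weight := (is_weight w).

Lemma weval_mulrz a (k : int) u : weval (a *~ k) u = weval a u *~ k.
Proof. by case: k => m; rewrite ?NegzE ?mulrNz ?wevalNl -?pmulrn wevalMnl. Qed.

Lemma dualv_mulrIz a (k l : int) : a != 0 -> a *~ k = a *~ l -> k = l.
Proof.
case/weval_neq0 => u _ au /(congr1 (fun b : dualv K h => weval b (u : g))); rewrite !weval_mulrz.
exact: mulrIz.
Qed.

(* On the span of x_a, h and the root spaces of - k a, the trace of ad t_a is
   a(t_a) times 1 minus the sum of the k, counted with multiplicity. *)
Lemma root_mult_neg a : a != 0 -> is_weight a ->
  (forall i j, w i = - a -> w j = - a -> i = j) /\
  (forall i k, (1 < k)%N -> w i != - (a *+ k)).
Proof.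
move=> a0 wa; case/is_weightP: (wa) => ia wia.
have xa : X`_ia \in root_space a by rewrite -wia.
have [y ya xy] := root_triple gS hC DS r_gt0 bX Xw xa (X_neq0 bX ia).
have at0 := coroot_norm_neq0 gS hC DS r_gt0 bX Xw a0 wa.
pose Q i := `[< exists k : nat, w i = - (a *+ k) >].
pose P i := (i == ia) || Q i.
have Qia : ~~ Q ia.
  apply/asboolP => -[k]; rewrite wia => /eqP; rewrite -addr_eq0 -mulrS => e.
  have := @dualv_mulrIz a k.+1 0 a0; rewrite mulr0z => /(_ (eqP e)).
  by [].
have sx : stable_set X P X`_ia.
  move=> i j /orP[/eqP->|/asboolP[k wk]] ne; first by rewrite liebxx linear0 eqxx in ne.
  case: k wk => [|k] wk; last first.
    apply/orP; right; apply/asboolP; exists k; rewrite (coord_lieb_root bX Xw xa ne) wk.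
    by rewrite mulrS opprD addNKr.
  apply/orP; left; apply: contraNT ne => jia.
  have w0 : w i = 0 by rewrite wk mulr0n oppr0.
  have Xh : X`_i \in h by rewrite -(root_space0 hC DS) -w0.
  rewrite liebC (lieb_hX Xw _ Xh) linearN linearZ /= (coordX bX) [ia == j]eq_sym (negPf jia).
  by rewrite mulr0 oppr0.
have sy : stable_set X P y.
  move=> i j + /(coord_lieb_root bX Xw ya) wj.
  case/orP => [/eqP e|/asboolP[k wk]]; apply/orP; right; apply/asboolP.
    by exists 0%N; rewrite wj e wia addNr mulr0n oppr0.
  by exists k.+1; rewrite wj wk mulrS opprD.
have := stable_weights bX Xw (coroot_dual_h a) xy sx sy.
have /choice[c cE] : forall i, exists k : nat, Q i -> w i = - (a *+ k).
  by move=> i; case: (boolP (Q i)) => [/asboolP[k kE]|_]; [exists k|exists 0%N].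
rewrite (bigD1 ia) /=; last by rewrite /P eqxx.
rewrite (eq_bigl Q) => [|i]; last first.
  by rewrite /P; have [->|] := eqVneq i ia; rewrite ?andbT //= (negPf Qia).
rewrite (eq_bigr (fun i => - (weval a (t a) *+ c i))) => [|i Qi]; last first.
  by rewrite cE // wevalNl wevalMnl.
rewrite sumrN sumrMnr wia => /eqP; rewrite subr_eq0 => /eqP sum1.
have {sum1}sum1 : (\sum_(i | Q i) c i = 1)%N by apply: (mulrIn at0); rewrite -sum1.
have c_uniq i k : w i = - (a *+ k) -> Q i /\ c i = k.
  move=> wi; have Qi : Q i by apply/asboolP; exists k.
  split=> //; have /oppr_inj := etrans (esym wi) (cE i Qi); rewrite !pmulrn.
  by case/(dualv_mulrIz a0).
split=> [i j wi wj|i k k1].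
  have [Qi ci] := c_uniq i 1%N wi; have [Qj cj] := c_uniq j 1%N wj.
  apply/eqP; apply/negPn/negP => ij; move: sum1.
  by rewrite (bigD1 i) //= (bigD1 j) /= ?ci ?cj // Qj eq_sym.
apply/eqP => wi; have [Qi ci] := c_uniq i k wi.
by move: sum1 k1; rewrite (bigD1 i) //= ci => <-; rewrite ltnNge leq_addr.
Qed.

Lemma root_mult a : a != 0 ->
  (forall i j, w i = a -> w j = a -> i = j) /\
  (forall i k, (1 < k)%N -> is_weight a -> w i != a *+ k).
Proof.
move=> a0.
have na0 : - a != 0 by rewrite oppr_eq0.
split=> [i j wi wj|i k k1 wa].
  have wa : is_weight (- a).
    by apply: (weightN gS hC DS r_gt0 bX Xw); apply/is_weightP; exists i.
  by have [H _] := root_mult_neg na0 wa; apply: H; rewrite opprK.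
have wna := weightN gS hC DS r_gt0 bX Xw wa.
by have [_ /(_ i k k1)] := root_mult_neg na0 wna; rewrite mulNrn opprK.
Qed.

Lemma root_space_dim1 i x : w i != 0 -> x \in root_space (w i) -> x = coord X i x *: X`_i.
Proof.
move=> wi0 xi; rewrite {1}(coordXE bX x) (bigD1 i) //= big1 ?addr0 // => j ji.
have [->|xj] := eqVneq (coord X j x) 0; first by rewrite scale0r.
have [H _] := root_mult wi0.
by rewrite (H j i) ?eqxx // in ji; apply: coord_root_space xi xj.
Qed.

Lemma sum_arith_progression (A B : K) (p m : nat) :
  (\sum_(k < m) (B + A * (k%:R - p%:R))) * 2 = m%:R * (2 * B + A * (m%:R - 1 - 2 * p%:R)).
Proof.
elim: m => [|m IH]; first by rewrite big_ord0 !mul0r.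
rewrite big_ord_recr /= mulrDl IH -(natr1 m); ring.
Qed.

(** Keeps the string of [b] in the direction [a] away from the weight 0, whose space [h] need not be
    a line. *)
Definition not_multiple a b := forall k : int, b + a *~ k != 0.

(** Trace of ad t_a over the weights b - p a, ..., b + q a, each of multiplicity one. The upper end
    is expressed by a vanishing bracket rather than by a missing weight, so that the identity also
    applies to a string cut short by a bracket supposed to vanish. *)
Lemma string_trace a b (p q : nat) : a != 0 -> is_weight a -> not_multiple a b ->
  (forall k : nat, (k <= p + q)%N -> is_weight (b + a *~ (k%:Z - p%:Z))) ->
  ~~ is_weight (b + a *~ (- p%:Z - 1)) ->
  (forall j x, w j = b + a *~ q%:Z -> x \in root_space a -> lieb x X`_j = 0) ->
  2 * weval b (t a) = weval a (t a) * (p%:R - q%:R).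
Proof.
move=> a0 wa nm seg bot top; case/is_weightP: (wa) => ia wia.
have xa : X`_ia \in root_space a by rewrite -wia.
have [y ya xy] := root_triple gS hC DS r_gt0 bX Xw xa (X_neq0 bX ia).
have /choice[f fE] : forall k : 'I_(p + q).+1, exists i, w i = b + a *~ (k%:Z - p%:Z).
  by move=> k; apply/is_weightP/seg; rewrite -ltnS.
have f_inj : injective f.
  move=> k l fkl; have := fE k; rewrite fkl fE => /addrI/(dualv_mulrIz a0).
  by move/addIr => -[] /val_inj.
have fU i k : w i = b + a *~ (k%:Z - p%:Z) -> forall lk : (k < (p + q).+1)%N, f (Ordinal lk) = i.
  move=> wi lk; have [H _] := root_mult (nm (k%:Z - p%:Z)).
  by apply: H; rewrite ?fE.
pose P i := i \in f @: predT.
have PP i : reflect (exists2 k : 'I_(p + q).+1, w i = b + a *~ (k%:Z - p%:Z) & f k = i) (P i).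
  by apply: (iffP imsetP) => [[k _ ->]|[k _ <-]]; exists k; rewrite ?fE ?inE //.
have sx : stable_set X P X`_ia.
  move=> i j /PP[k _ <-] ne; have := coord_lieb_root bX Xw xa ne; rewrite fE => wj.
  have [kq|kq] := ltnP k (p + q); last first.
    have ek : nat_of_ord k = (p + q)%N by apply/eqP; rewrite eqn_leq kq -ltnS ltn_ord.
    rewrite top ?linear0 ?eqxx // in ne.
    by rewrite fE ek PoszD addrAC subrr add0r.
  have wj' : w j = b + a *~ (k.+1%:Z - p%:Z).
    rewrite wj addrCA; congr (_ + _); rewrite -{1}[a]mulr1z -mulrzDr; congr (_ *~ _); lia.
  have lk : (k.+1 < (p + q).+1)%N by rewrite ltnS.
  by apply/PP; exists (Ordinal lk) => //; apply: fU.
have sy : stable_set X P y.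
  move=> i j /PP[k _ <-] ne; have := coord_lieb_root bX Xw ya ne; rewrite fE => wj.
  have wj' : w j = b + a *~ (k%:Z - p%:Z - 1).
    by rewrite wj addrCA; congr (b + _); rewrite [RHS]mulrzBr mulr1z addrC.
  have [k0|k0] := posnP k.
    case/negP: bot; apply/is_weightP; exists j; rewrite wj' k0; congr (_ + a *~ _); lia.
  have lk : (k.-1 < (p + q).+1)%N by rewrite (leq_ltn_trans (leq_pred _)).
  have wj2 : w j = b + a *~ (k.-1%:Z - p%:Z) by rewrite wj'; congr (_ + a *~ _); lia.
  by apply/PP; exists (Ordinal lk) => //; apply: fU.
have := stable_weights bX Xw (coroot_dual_h a) xy sx sy.
rewrite big_imset /=; last by move=> k l _ _; apply: f_inj.
rewrite big_mkcond /= (eq_bigr (fun k : 'I__ => weval b (t a) + weval a (t a) * (k%:R - p%:R))); last first.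
  move=> k _; rewrite ?inE fE wevalDl weval_mulrz; congr (_ + _).
  by rewrite -mulrzr rmorphB.
move/(congr1 (fun z => z * 2)); rewrite sum_arith_progression mul0r => /eqP.
rewrite mulf_eq0 pnatr_eq0 /= => /eqP e.
apply/eqP; rewrite -subr_eq0; apply/eqP; rewrite -[RHS]e -(natr1 (p + q)) natrD; ring.
Qed.

Lemma string_end a b : a != 0 -> is_weight b -> exists2 q : nat,
  ~~ is_weight (b + a *+ q.+1) & forall k, (k <= q)%N -> is_weight (b + a *+ k).
Proof.
move=> a0 wb.
have ex : exists m, ~~ is_weight (b + a *+ m).
  apply: contrapT => H.
  have /choice[f fE] : forall m : 'I_n.+1, exists i, w i = b + a *+ m.
    by move=> m; apply/is_weightP; apply: contraT => nw; case: H; exists m.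
  have f_inj : injective f.
    move=> k l fkl; have := fE k; rewrite fkl fE => /addrI; rewrite !pmulrn.
    by move/(dualv_mulrIz a0) => -[] /val_inj.
  by have := leq_card f f_inj; rewrite !card_ord ltnn.
case: (ex_minnP ex) => -[|q] nw min; first by rewrite mulr0n addr0 wb in nw.
by exists q => // k kq; apply: contraT => /min; rewrite ltnNge kq.
Qed.

Lemma string_segment a b : a != 0 -> is_weight a -> is_weight b -> not_multiple a b ->
  exists p q : nat, [/\ 2 * weval b (t a) = weval a (t a) * (p%:R - q%:R),
    forall k : int, (- p%:Z <= k <= q%:Z) -> is_weight (b + a *~ k),
    ~~ is_weight (b + a *~ (q%:Z + 1)) & ~~ is_weight (b + a *~ (- p%:Z - 1))].
Proof.
move=> a0 wa wb nm.
have na0 : - a != 0 by rewrite oppr_eq0.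
have [q nq wq] := string_end a0 wb; have [p np wp] := string_end na0 wb.
have seg (k : int) : - p%:Z <= k <= q%:Z -> is_weight (b + a *~ k).
  case: (intP k) => [|m|m] H; first by rewrite mulr0z addr0.
    by rewrite -pmulrn; apply: wq; lia.
  by rewrite mulrNz -mulNrz -pmulrn; apply: wp; lia.
have nq' : ~~ is_weight (b + a *~ (q%:Z + 1)).
  rewrite (_ : a *~ (q%:Z + 1) = a *+ q.+1) // pmulrn; congr (a *~ _); lia.
have np' : ~~ is_weight (b + a *~ (- p%:Z - 1)).
  rewrite (_ : a *~ (- p%:Z - 1) = - a *+ p.+1) // mulNrn pmulrn -mulrNz; congr (a *~ _); lia.
exists p, q; split; [|exact: seg|exact: nq'|exact: np'].
apply: (string_trace a0 wa nm _ np').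
  by move=> k kpq; apply: seg; lia.
move=> j x wj xa; apply/eqP; apply: contraNT nq' => ne.
have := root_space_weight bX Xw (root_space_lieb xa (Xw j)) ne.
by rewrite wj addrCA mulrzDr mulr1z [a + _]addrC.
Qed.

(** By the trace identity b(t_a) determines the midpoint of a segment of weights, so all segments on
    the same line have the same midpoint. A weight outside the first segment would lie in a longer
    one, which contains the positions where the first one stops. *)
Lemma root_string a b : a != 0 -> is_weight a -> is_weight b -> not_multiple a b ->
  exists p q : nat, 2 * weval b (t a) = weval a (t a) * (p%:R - q%:R) /\
    forall k : int, is_weight (b + a *~ k) = (- p%:Z <= k <= q%:Z).
Proof.
move=> a0 wa wb nm; have at0 := coroot_norm_neq0 gS hC DS r_gt0 bX Xw a0 wa.
have [p [q [pq seg nq np]]] := string_segment a0 wa wb nm.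
exists p, q; split=> // k; apply/idP/idP => [wk|]; last exact: seg.
have nm' : not_multiple a (b + a *~ k) by move=> l; rewrite -addrA -mulrzDr.
have [p' [q' [pq' seg' _ _]]] := string_segment a0 wa wk nm'.
have e : (p%:Z - q%:Z + 2 * k = p'%:Z - q'%:Z).
  move: pq'; rewrite wevalDl weval_mulrz mulrDr pq => pq'.
  apply: (mulrIz at0); rewrite mulrzDr !mulrzBr [2 * k]mulrC mulrzA.
  rewrite -!pmulrn -!(mulr_natr (weval a (t a))) -!mulrBr -pq' mulr2n mulrDl.
  by rewrite !mul1r.
clear - nq np seg' e.
apply: contraT => /nandP nk.
have {}nk : k < - p%:Z \/ q%:Z < k by case: nk; lia.
case: nk => nk.
  suff: is_weight (b + a *~ (- p%:Z - 1)) by rewrite (negPf np).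
  have -> : b + a *~ (- p%:Z - 1) = b + a *~ k + a *~ (- p%:Z - 1 - k).
    by rewrite -addrA -mulrzDr; congr (_ + a *~ _); lia.
  by apply: seg'; lia.
suff: is_weight (b + a *~ (q%:Z + 1)) by rewrite (negPf nq).
have -> : b + a *~ (q%:Z + 1) = b + a *~ k + a *~ (q%:Z + 1 - k).
  by rewrite -addrA -mulrzDr; congr (_ + a *~ _); lia.
by apply: seg'; lia.
Qed.

(** If the bracket vanished, [string_trace] would hold with [q = 0]; the actual string has the same
    lower end but a positive [q]. *)
Lemma root_bracket a b x z : a != 0 -> is_weight a -> is_weight b -> not_multiple a b ->
  is_weight (a + b) -> x \in root_space a -> z \in root_space b -> x != 0 -> z != 0 ->
  lieb x z != 0.
Proof.
move=> a0 wa wb nm wab xa zb x0 z0; apply/negP => /eqP xz0.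
have at0 := coroot_norm_neq0 gS hC DS r_gt0 bX Xw a0 wa.
have [p [q [pq str]]] := root_string a0 wa wb nm.
have q1 : (0 < q)%N.
  by have := str 1; rewrite mulr1z addrC wab => /esym/andP[_]; rewrite lez_nat.
have b0 : b != 0 by have := nm 0; rewrite mulr0z addr0.
case/is_weightP: (wa) => ia wia; case/is_weightP: (wb) => ib wib.
have X0 : lieb X`_ia X`_ib = 0.
  have [xe ze] := (@root_space_dim1 ia x, @root_space_dim1 ib z).
  rewrite wia wib in xe ze; move: x0 z0 xz0; rewrite xe // ze //.
  rewrite !scaler_eq0 !negb_or => /andP[c1 _] /andP[c2 _] /eqP.
  by rewrite liebZl liebZr !scaler_eq0 (negPf c1) (negPf c2) /= => /eqP.
have : 2 * weval b (t a) = weval a (t a) * (p%:R - 0%:R).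
  apply: (string_trace a0 wa nm).
  - move=> k; rewrite addn0 => kp; rewrite str; clear - kp; lia.
  - rewrite str; clear; lia.
  move=> j x' wj x'a; rewrite -wia in x'a.
  rewrite (root_space_dim1 (i := ia) _ x'a) ?wia //.
  rewrite liebZl; have -> : j = ib; last by rewrite X0 scaler0.
  by have [H _] := root_mult b0; apply: H; rewrite // wj mulr0z addr0.
rewrite pq => /(mulfI at0)/addrI/oppr_inj/eqP; rewrite eqr_nat.
by rewrite eqn0Ngt q1.
Qed.
End RootStrings.

(** * Abstract root systems *)

Lemma lez_m1 (x : int) : x <= 0 -> x != 0 -> x <= -1.
Proof. lia. Qed.

Lemma sum_le0 (x y z : int) : x <= -1 -> y <= -1 -> z <= 0 -> 2 + (x + (y + z)) <= 0.
Proof. lia. Qed.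

Section RootSystem.
Variable r : nat.
Implicit Types (u v x y : 'rV[int]_r) (i j : 'I_r) (S : {set 'I_r}).

Definition pairing (A : 'I_r -> 'I_r -> int) v i : int := \sum_j v 0 j * A j i.
Definition vge0 v := [forall i, 0 <= v 0 i].
Definition shape_height S v : int := \sum_(i in S) v 0 i.

(* Phi v: the combination of simple roots with coordinates v is a root;
   A i j is the pairing of the i-th simple root with the j-th simple coroot.
   rs_pos is what remains of the positivity of the form, and rs_jacobi of the
   Jacobi identity for three root vectors. *)
Record root_system (A : 'I_r -> 'I_r -> int) (Phi : pred 'rV[int]_r) : Prop := RootSystem {
  rs_opp : forall v, Phi v -> Phi (- v);
  rs_simple : forall i, Phi 'e_i;
  rs_sign : forall v, Phi v -> vge0 v || vge0 (- v);
  rs_double : forall v, Phi v -> ~~ Phi (v + v);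
  rs_mul : forall i (k : nat), Phi (k%:Z *: 'e_i) -> k = 1%N;
  rs_diag : forall i, A i i = 2;
  rs_string : forall v i, Phi v -> (exists2 j, j != i & v 0 j != 0) ->
    exists p q : nat, pairing A v i = p%:Z - q%:Z /\
      forall k : int, Phi (v + k *: 'e_i) = (- p%:Z <= k <= q%:Z);
  rs_pos : forall v, vge0 v -> v != 0 -> exists2 i, 0 < v 0 i & 0 < pairing A v i;
  rs_jacobi : forall u v x, Phi u -> Phi v -> Phi x -> Phi (u + v) -> Phi (u + v + x) ->
    [|| Phi (u + x), u + x == 0, Phi (v + x) | v + x == 0] }.

Lemma vge0P v : reflect (forall i, 0 <= v 0 i) (vge0 v).
Proof. exact: forallP. Qed.

Lemma vge0_coord v i : vge0 v -> 0 <= v 0 i.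
Proof. by move/vge0P. Qed.

Lemma e_E i j : ('e_i : 'rV[int]_r) 0 j = (i == j)%:R.
Proof. by rewrite mxE eqxx eq_sym. Qed.

Lemma addeE v i (k : int) j : (v + k *: 'e_i) 0 j = v 0 j + k * (i == j)%:R.
Proof. by rewrite !mxE eqxx eq_sym. Qed.

Lemma shape_heightD S u v : shape_height S (u + v) = shape_height S u + shape_height S v.
Proof. by rewrite /shape_height -big_split; apply: eq_bigr => i _; rewrite mxE. Qed.

Lemma shape_heightN S u : shape_height S (- u) = - shape_height S u.
Proof. by rewrite /shape_height -sumrN; apply: eq_bigr => i _; rewrite mxE. Qed.

Lemma shape_heightZ S k u : shape_height S (k *: u) = k * shape_height S u.
Proof. by rewrite /shape_height mulr_sumr; apply: eq_bigr => i _; rewrite mxE. Qed.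

Lemma shape_height_e S i : shape_height S 'e_i = (i \in S)%:R.
Proof.
rewrite /shape_height; have [iS|iS] := boolP (i \in S).
  rewrite (bigD1 i) //= e_E eqxx big1 ?addr0 // => j /andP[_ ji].
  by rewrite e_E eq_sym (negPf ji).
by rewrite big1 // => j jS; rewrite e_E; case: eqP jS iS => [->->|].
Qed.

Lemma shape_height_ge S v i : vge0 v -> i \in S -> v 0 i <= shape_height S v.
Proof.
move=> /vge0P v0 iS; rewrite /shape_height (bigD1 i) //= lerDl.
by apply: sumr_ge0.
Qed.

Lemma shape_height_gt0 S v : 0 < shape_height S v -> exists2 i, i \in S & 0 < v 0 i.
Proof.
move=> v0; apply: contrapT => H; move: v0; rewrite ltNge => /negP; apply.
apply: sumr_le0 => i iS; rewrite leNgt; apply/negP => vi; apply: H; by exists i.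
Qed.

Section Theory.
Variables (A : 'I_r -> 'I_r -> int) (Phi : pred 'rV[int]_r).
Hypothesis RS : root_system A Phi.
Local Notation "<< v , i >>" := (pairing A v i) (format "<< v ,  i >>").

Lemma pairingD u v i : <<u + v, i>> = <<u, i>> + <<v, i>>.
Proof. by rewrite /pairing -big_split; apply: eq_bigr => j _; rewrite mxE mulrDl. Qed.
Lemma pairingZ k u i : <<k *: u, i>> = k * <<u, i>>.
Proof. by rewrite /pairing mulr_sumr; apply: eq_bigr => j _; rewrite mxE mulrA. Qed.
Lemma pairing_e j i : <<'e_j, i>> = A j i.
Proof.
rewrite /pairing (bigD1 j) //= e_E eqxx mul1r big1 ?addr0 // => k kj.
by rewrite e_E eq_sym (negPf kj) mul0r.
Qed.

Lemma rs_neq0 v : Phi v -> v != 0.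
Proof.
move=> Pv; apply/eqP => v0; have := rs_double RS Pv.
by rewrite v0 addr0 -v0 Pv.
Qed.

Lemma rs_ge0 v i : Phi v -> 0 < v 0 i -> vge0 v.
Proof.
move=> Pv vi; case/orP: (rs_sign RS Pv) => // /vge0P/(_ i); by rewrite mxE oppr_ge0 leNgt vi.
Qed.

Lemma rs_height_ge0 S v : Phi v -> 0 < shape_height S v -> vge0 v.
Proof. by move=> Pv /shape_height_gt0[i _]; apply: rs_ge0. Qed.

Lemma rs_mixed v i j : v 0 i < 0 -> 0 < v 0 j -> ~~ Phi v.
Proof.
by move=> vi vj; apply/negP => /rs_ge0/(_ vj)/vge0P/(_ i); rewrite leNgt vi.
Qed.

Lemma root_reflection v i : Phi v -> (exists2 j, j != i & v 0 j != 0) ->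
  Phi (v - <<v, i>> *: 'e_i).
Proof.
move=> Pv ne; have [p [q [-> H]]] := rs_string RS Pv ne.
rewrite -scaleNr H; lia.
Qed.

Lemma root_addsimple v i : Phi v -> (exists2 j, j != i & v 0 j != 0) ->
  <<v, i>> < 0 -> Phi (v + 'e_i).
Proof.
move=> Pv ne; have [p [q [-> H]]] := rs_string RS Pv ne => pq.
rewrite -['e_i]scale1r H; lia.
Qed.

Lemma root_subsimple v i : Phi v -> (exists2 j, j != i & v 0 j != 0) ->
  0 < <<v, i>> -> Phi (v - 'e_i).
Proof.
move=> Pv ne; have [p [q [-> H]]] := rs_string RS Pv ne => pq.
rewrite -['e_i]scale1r -scaleNr H; lia.
Qed.

(* When v - e_i is not a root, the string through v starts at v. *)
Lemma root_addsimpleE v i : Phi v -> (exists2 j, j != i & v 0 j != 0) ->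
  ~~ Phi (v - 'e_i) -> (<<v, i>> <= 0) && (Phi (v + 'e_i) == (<<v, i>> < 0)).
Proof.
move=> Pv ne; have [p [q [-> H]]] := rs_string RS Pv ne.
have := H (-1); rewrite scaleN1r => -> nP.
have := H 1; rewrite scale1r => ->; lia.
Qed.

Lemma simple_sub_nroot i j : i != j -> ~~ Phi ('e_i - 'e_j).
Proof.
move=> ij; apply: (@rs_mixed _ j i); rewrite !mxE !eqxx ?(eq_sym j) (negPf ij) //.
Qed.

Lemma simple_other i j : i != j -> exists2 k, k != j & ('e_i : 'rV[int]_r) 0 k != 0.
Proof. by exists i; rewrite // e_E eqxx. Qed.

Lemma cartan_offdiag i j : i != j -> (A i j <= 0) && (Phi ('e_i + 'e_j) == (A i j < 0)).
Proof.
move=> ij; rewrite -pairing_e; apply: root_addsimpleE; first exact: rs_simple RS _.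
  exact: simple_other.
exact: simple_sub_nroot.
Qed.

Lemma cartan_le0 i j : i != j -> A i j <= 0.
Proof. by case/cartan_offdiag/andP. Qed.

Lemma cartan_sym0 i j : (A i j == 0) = (A j i == 0).
Proof.
have [->//|ij] := eqVneq i j.
have /andP[l1 /eqP e1] := cartan_offdiag ij; rewrite eq_sym in ij.
have /andP[l2 /eqP e2] := cartan_offdiag ij.
by rewrite addrC e1 in e2; rewrite !eq_le l1 l2 /= !leNgt e2.
Qed.

Lemma only_coord v i : (forall j, j != i -> v 0 j = 0) -> v = v 0 i *: 'e_i.
Proof.
move=> H; apply/rowP => j; rewrite mxE e_E; have [<-|ij] := eqVneq i j.
  by rewrite mulr1.
by rewrite H ?mulr0 // eq_sym.
Qed.

Lemma simple_or_other v i : Phi v -> vge0 v -> v = 'e_i \/ exists2 j, j != i & v 0 j != 0.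
Proof.
move=> Pv /vge0P v0; case: (pselect (exists2 j, j != i & v 0 j != 0)) => H; [by right|left].
have vE : v = v 0 i *: 'e_i.
  by apply: only_coord => j ji; apply/eqP; apply: contraT => vj; case: H; exists j.
move: Pv (v0 i); rewrite vE mxE e_E eqxx mulr1.
by case: (v 0 i) => // k /(rs_mul RS)-> _; rewrite scale1r.
Qed.

(** [rs_pos] supplies an index at which the pairing is positive; the simple root there can be
    subtracted unless it is [v] itself. *)
Lemma root_descend v : Phi v -> vge0 v ->
  (exists i, v = 'e_i) \/ exists i, [/\ 0 < v 0 i, Phi (v - 'e_i) & vge0 (v - 'e_i)].
Proof.
move=> Pv v0; have [i vi pi] := rs_pos RS v0 (rs_neq0 Pv).
have [->|ne] := simple_or_other i Pv v0; [by left; exists i|right; exists i].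
have Pu := root_subsimple Pv ne pi; split=> //.
case: ne => j ji vj; apply: (rs_ge0 (i := j)) => //.
by rewrite !mxE eqxx (negPf ji) subr0 lt_def vj; apply/vge0P.
Qed.

Definition root_height v : nat := absz (\sum_i v 0 i).

Lemma height_sum v : vge0 v -> (root_height v)%:Z = \sum_i v 0 i.
Proof. by move=> /vge0P v0; rewrite /root_height gez0_abs // sumr_ge0. Qed.

Lemma sum_e i : \sum_j ('e_i : 'rV[int]_r) 0 j = 1.
Proof.
rewrite (bigD1 i) //= e_E eqxx big1 ?addr0 // => j ji.
by rewrite e_E eq_sym (negPf ji).
Qed.

Lemma heightD v u : vge0 v -> vge0 u -> root_height (v + u) = (root_height v + root_height u)%N.
Proof.
move=> v0 u0; have vu0 : vge0 (v + u).
  by apply/vge0P => i; rewrite mxE addr_ge0 // vge0_coord.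
apply/eqP; rewrite -eqz_nat PoszD !height_sum // -big_split /=.
by apply/eqP/eq_bigr => i _; rewrite mxE.
Qed.

Lemma e_ge0 i : vge0 'e_i.
Proof. by apply/vge0P => j; rewrite e_E ler0n. Qed.

Lemma height_e i : root_height 'e_i = 1%N.
Proof. by rewrite /root_height sum_e. Qed.

Lemma pos_root_ind (P : 'rV[int]_r -> Prop) : (forall i, P 'e_i) ->
  (forall v i, Phi v -> vge0 v -> Phi (v + 'e_i) -> P v -> P (v + 'e_i)) ->
  forall v, Phi v -> vge0 v -> P v.
Proof.
move=> P1 PS v; have [k] := ubnP (root_height v); elim: k v => // k IH v.
rewrite ltnS => hv Pv v0; case: (root_descend Pv v0) => [[i ->]//|[i [vi Pu u0]]].
rewrite -(subrK 'e_i v); apply: PS; rewrite ?subrK //; apply: IH => //.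
by move: hv; rewrite -{1}(subrK 'e_i v) heightD ?e_ge0 // height_e addn1.
Qed.

Lemma root_extend_adj v i : Phi v -> vge0 v -> Phi (v + 'e_i) -> v 0 i = 0 ->
  exists2 k, 0 < v 0 k & A k i != 0.
Proof.
move=> Pv v0 Pvi vi0.
have [ne|ne] := simple_or_other i Pv v0; first by move: vi0; rewrite ne e_E eqxx.
have nP : ~~ Phi (v - 'e_i).
  have [j ji vj] := ne; apply: (@rs_mixed _ i j); rewrite !mxE !eqxx ?vi0 //.
  by rewrite (negPf ji) subr0 lt_def vj vge0_coord.
have /andP[_ /eqP] := root_addsimpleE Pv ne nP; rewrite Pvi => /esym pi.
apply: contrapT => H; move: pi; rewrite /pairing big1 ?ltxx // => j _.
have [->|vj] := eqVneq (v 0 j) 0; first by rewrite mul0r.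
have [->|Aj] := eqVneq (A j i) 0; first by rewrite mulr0.
by case: H; exists j; rewrite // lt_def vj vge0_coord.
Qed.

(** Connectedness of the support, phrased for a set [T] of nodes that is not joined, inside the
    support, to its complement. A simple root added at a new node is adjacent to the support built
    so far, hence on the same side. *)
Lemma support_connected (T : pred 'I_r) v : Phi v -> vge0 v ->
  (forall i j, 0 < v 0 i -> 0 < v 0 j -> T i -> ~~ T j -> A i j = 0) ->
  (forall i, 0 < v 0 i -> T i) \/ (forall i, 0 < v 0 i -> ~~ T i).
Proof.
move: v; apply: pos_root_ind => [i _|v i Pv v0 Pvi IH H].
  have E j : 0 < ('e_i : 'rV[int]_r) 0 j -> j = i.
    by rewrite e_E; have [->|_] := eqVneq i j.
  by case: (boolP (T i)) => Ti; [left|right] => j /E ->.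
have vE j : (v + 'e_i) 0 j = v 0 j + (i == j)%:R by rewrite mxE e_E.
have vl j : 0 < v 0 j -> 0 < (v + 'e_i) 0 j.
  by move=> vj; rewrite vE ltr_wpDr // ler0n.
have vi : 0 < (v + 'e_i) 0 i by rewrite vE eqxx ltr_wpDl // vge0_coord.
have supp j : 0 < (v + 'e_i) 0 j -> j = i \/ 0 < v 0 j.
  by rewrite vE; have [->|_] := eqVneq i j; [left|rewrite addr0; right].
have vi0 : ~~ (0 < v 0 i) -> v 0 i = 0.
  by rewrite -leNgt => vi0; apply/eqP; rewrite eq_le vi0 vge0_coord.
have [|side|side] := IH; first by move=> j k /vl vj /vl vk; apply: H.
- case: (boolP (T i)) => Ti; first by left=> j /supp[->//|]; apply: side.
  have /vi0 vi_0 : ~~ (0 < v 0 i) by apply: contra Ti; apply: side.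
  have [k vk] := root_extend_adj Pv v0 Pvi vi_0.
  by rewrite (H k i) ?eqxx // ?vl // side.
- case: (boolP (T i)) => Ti; last by right=> j /supp[->//|]; apply: side.
  have /vi0 vi_0 : ~~ (0 < v 0 i) by apply/negP => /side; rewrite Ti.
  have [k vk] := root_extend_adj Pv v0 Pvi vi_0.
  by rewrite cartan_sym0 (H i k) ?eqxx // ?vl // side.
Qed.

Lemma shape_height1_ge0 S u : Phi u -> shape_height S u = 1 -> vge0 u.
Proof. by move=> Pu hu; apply: (@rs_height_ge0 S) => //; rewrite hu. Qed.

(** The root is built up from simple roots. One in [S] makes the step from height 1 to height 2 and
    is itself a summand; one outside [S] is passed by the Jacobi identity to one of the two summands
    already found. *)
Lemma height2_split S v : Phi v -> vge0 v -> shape_height S v = 2 ->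
  exists u x, [/\ Phi u, Phi x, shape_height S u = 1, shape_height S x = 1 & v = u + x].
Proof.
move: v; apply: pos_root_ind => [i|v i Pv v0 Pvi IH].
  by rewrite shape_height_e; case: (i \in S).
rewrite shape_heightD shape_height_e; have [iS|iS] := boolP (i \in S).
  move=> hv; exists v, 'e_i; split=> //; rewrite ?shape_height_e ?iS //.
    exact: rs_simple RS _.
  by apply: (addIr 1); rewrite hv.
rewrite addr0 => /IH[u [x [Pu Px hu hx vE]]].
have nz y : shape_height S y = 1 -> y + 'e_i != 0.
  move=> hy; apply/eqP => /(congr1 (shape_height S)).
  by rewrite shape_heightD shape_height_e (negPf iS) addr0 hy /shape_height big1 // => j; rewrite mxE.
have := rs_jacobi RS Pu Px (rs_simple RS i); rewrite -vE => /(_ Pv Pvi).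
rewrite (negPf (nz _ hu)) (negPf (nz _ hx)) /= orbF => /orP[P'|P'].
  exists (u + 'e_i), x; split=> //; last by rewrite vE addrAC.
  by rewrite shape_heightD shape_height_e (negPf iS) addr0.
exists u, (x + 'e_i); split=> //; last by rewrite vE addrA.
by rewrite shape_heightD shape_height_e (negPf iS) addr0.
Qed.

(** Along the chain of roots leading up to [v] the height grows by at most 1 per step, so it takes
    the value 2. *)
Lemma height2_below S v : Phi v -> vge0 v -> 2 <= shape_height S v ->
  exists u, [/\ Phi u, vge0 u, shape_height S u = 2 & forall i, u 0 i <= v 0 i].
Proof.
move: v; apply: pos_root_ind => [i|v i Pv v0 Pvi IH].
  by rewrite shape_height_e; case: (i \in S).
rewrite shape_heightD shape_height_e => h2.
have [/IH[u [Pu u0 hu uv]]|hv] := lerP 2 (shape_height S v).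
  exists u; split=> // j; apply: le_trans (uv j) _.
  by rewrite mxE e_E lerDl ler0n.
exists (v + 'e_i); split=> //; last first.
- by rewrite shape_heightD shape_height_e; move: h2 hv; clear; case: (i \in S) => /=; lia.
- apply/vge0P => j; rewrite mxE e_E addr_ge0 ?vge0_coord // ler0n.
Qed.

(** Descent may remove a simple root of [S]. Then a root of height 0 remains, and one of its simple
    summands, all outside [S], has to be removed instead. *)
Lemma height1_descend S z : Phi z -> shape_height S z = 1 ->
  (exists2 a, a \in S & z = 'e_a) \/ (exists2 j, j \notin S & Phi (z - 'e_j)).
Proof.
move=> Pz hz; have z0 := shape_height1_ge0 Pz hz.
case: (root_descend Pz z0) => [[i zi]|[i [zi Pu u0]]].
  by left; exists i => //; move: hz; rewrite zi shape_height_e; case: (i \in S).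
have [iS|iS] := boolP (i \in S); last by right; exists i.
right; move: Pu u0 zi; set u := z - 'e_i => Pu u0 _.
have hu : shape_height S u = 0.
  by rewrite shape_heightD shape_heightN shape_height_e iS hz subrr.
have : z = u + 'e_i by rewrite subrK.
have : Phi 'e_i by apply: rs_simple RS _.
have : shape_height S 'e_i = 1 by rewrite shape_height_e iS.
(* With ['e_i] generalized to a root [y] of height one, the Jacobi identity either removes the last
   simple summand of the height 0 root or moves it into [y], which shortens that root. *)
move: ('e_i) hu; move: (u) Pu u0; apply: pos_root_ind => {u} [j|u j Pu u0 Puj IH] y.
  rewrite shape_height_e => jS hy Py ->; exists j; last by rewrite addrAC subrr add0r.
  by apply/negP => jS'; rewrite jS' in jS.
rewrite shape_heightD shape_height_e => huj hy Py zE.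
have hu0 : 0 <= shape_height S u.
  by rewrite /shape_height sumr_ge0 // => k _; rewrite vge0_coord.
have jS : j \notin S by apply/negP => jS; move: huj hu0; rewrite jS; clear; lia.
have hu : shape_height S u = 0 by move: huj; rewrite (negPf jS) addr0.
have nz w : shape_height S w = 1 -> w != 0.
  by apply: contra_eq_neq => ->; rewrite /shape_height big1 // => k _; rewrite mxE.
have := rs_jacobi RS Pu (rs_simple RS j) Py Puj; rewrite -zE => /(_ Pz).
case/or4P => [Puy|/eqP e|Pjy|/eqP e].
- by exists j => //; rewrite zE addrAC addrK.
- by have := nz (u + y); rewrite shape_heightD hu hy add0r e eqxx => /(_ erefl).
- apply: (IH ('e_j + y)) => //; last by rewrite zE addrA.
  by rewrite shape_heightD shape_height_e (negPf jS) add0r.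
by have := nz ('e_j + y); rewrite shape_heightD shape_height_e (negPf jS) hy add0r e eqxx => /(_ erefl).
Qed.

Lemma cartan_prod_lt4 i j : i != j -> A i j * A j i < 4.
Proof.
move=> ij; have l1 := cartan_le0 ij; have l2 : A j i <= 0 by apply: cartan_le0; rewrite eq_sym.
rewrite ltNge; apply/negP => ge4.
(* Chosen to pair to 0 with [i] and to [4 - A i j * A j i] with [j], against positivity if the
   product is at least 4. *)
pose v : 'rV[int]_r := (- A j i) *: 'e_i + 2%:Z *: 'e_j.
have vE k : v 0 k = - A j i * (i == k)%:R + 2%:Z * (j == k)%:R by rewrite mxE !mxE !eqxx !(eq_sym k).
have ji : (j == i) = false by rewrite eq_sym (negPf ij).
have vi : v 0 i = - A j i by rewrite vE eqxx ji mulr1 mulr0 addr0.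
have vj : v 0 j = 2 by rewrite vE eqxx (negPf ij) mulr1 mulr0 add0r.
have v0 : vge0 v.
  by apply/vge0P => k; rewrite vE addr_ge0 // mulr_ge0 ?ler0n // oppr_ge0.
have vn0 : v != 0 by apply/eqP => /rowP/(_ j); rewrite vj mxE.
have [k vk] := rs_pos RS v0 vn0.
rewrite pairingD !pairingZ !pairing_e.
have [<-|ik] := eqVneq i k; first by rewrite (rs_diag RS); lia.
have [<-|jk] := eqVneq j k; first by rewrite (rs_diag RS); lia.
by move: vk; rewrite vE (negPf ik) (negPf jk) !mulr0 ltxx.
Qed.

(* A vertex set in which every vertex has two neighbours carries a nonzero
   nonnegative vector pairing nonpositively with all its vertices. *)
Lemma no_cycle (e : rel 'I_r) (c : seq 'I_r) : (forall i j, e i j -> A i j != 0) ->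
  uniq c -> cycle e c -> (2 < size c)%N -> False.
Proof.
move=> eA uc cc sc.
pose v : 'rV[int]_r := \row_j (j \in c)%:R.
have vE j : v 0 j = (j \in c)%:R by rewrite mxE.
have v0 : vge0 v by apply/vge0P => j; rewrite vE ler0n.
have vn0 : v != 0.
  case: (c) sc vE => // k s _ vE; apply/eqP => /rowP/(_ k).
  by rewrite vE mxE inE eqxx.
case: (rs_pos RS v0 vn0) => i; rewrite vE; case: (boolP (i \in c)) => // ic _.
have [m s Ds] := rot_to ic.
have us : uniq (i :: s) by rewrite -Ds rot_uniq.
have cs : cycle e (i :: s) by rewrite -Ds rot_cycle.
have ss : (2 < size (i :: s))%N by rewrite -Ds size_rot.
have sc' : c =i i :: s by move=> j; rewrite -Ds mem_rot.
case: s us cs ss sc' {Ds} => [|j [|k s]] //= us cs _ sc'.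
move: cs; rewrite rcons_path /= => /and3P[eij ejk /andP[_ eli]].
set l := last k s in eli; have lks : l \in k :: s by apply: mem_last.
have [ij ijl jl] : [/\ j != i, l != i & l != j].
  move: us; rewrite !inE !negb_or => /and3P[/and3P[ij ik ins] /andP[jk jns] _].
  by move: lks; rewrite inE => /predU1P[->|ls]; split; rewrite 1?eq_sym //;
    apply: contraTneq ls => <-.
rewrite ltNge => /negP; apply.
rewrite /pairing (bigD1 i) //= (bigD1 j) //= (bigD1 l) /=; last by rewrite ijl.
have -> : v 0 i = 1 by rewrite vE ic.
have -> : v 0 j = 1 by rewrite vE sc' !inE eqxx orbT.
have -> : v 0 l = 1 by rewrite vE sc' !inE -in_cons lks !orbT.
rewrite !mul1r (rs_diag RS).
have Aj : A j i <= -1.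
  by rewrite lez_m1 ?cartan_le0 // cartan_sym0 eA.
have Al : A l i <= -1 by rewrite lez_m1 ?cartan_le0 ?eA.
apply: sum_le0 Aj Al _; apply: sumr_le0 => t /andP[/andP[ti _] _].
by rewrite mulr_ge0_le0 ?vge0_coord // cartan_le0.
Qed.

End Theory.
End RootSystem.

(** * A root system is determined by its Cartan matrix *)

Section Uniqueness.
Variables (r : nat) (A : 'I_r -> 'I_r -> int).
Implicit Types (u v x y : 'rV[int]_r) (i j : 'I_r).

(** [v] is [u + 'e_i] for a positive root [u] of smaller height. By induction the string through [u]
    has the same lower end in both systems, and the pairing, which depends only on [A], then fixes
    the upper end. *)
Lemma root_system_step (P Q : pred 'rV[int]_r) (k : nat) :
  root_system A P -> root_system A Q ->
  (forall u, vge0 u -> (root_height u < k)%N -> P u = Q u) ->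
  forall v, vge0 v -> (root_height v < k.+1)%N -> P v -> Q v.
Proof.
move=> RP RQ IH v v0 hv Pv.
case: (root_descend RP Pv v0) => [[i ->]|[i [vi Pu u0]]]; first exact: rs_simple RQ i.
have vE := subrK 'e_i v; set u := v - 'e_i in Pu u0 vE.
have hu : (root_height u < k)%N by move: hv; rewrite -vE heightD ?e_ge0 // height_e addn1.
have Qu : Q u by rewrite -IH.
have [ui|ne] := simple_or_other RP i Pu u0.
  have /(rs_mul RP)// : P (2%:Z *: 'e_i) by rewrite -natz scaler_nat mulr2n -{1}ui vE.
have [p [q [pq HP]]] := rs_string RP Pu ne; have [p' [q' [pq' HQ]]] := rs_string RQ Qu ne.
(* Going down, a vector is either nonnegative and of height at most that of [u], or it has
   coordinates of both signs and is a root in neither system. *)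
have down (m : nat) : P (u + (- m%:Z) *: 'e_i) = Q (u + (- m%:Z) *: 'e_i).
  have [um|um] := boolP (vge0 (u + (- m%:Z) *: 'e_i)).
    apply: IH => //; apply: leq_ltn_trans hu.
    rewrite -lez_nat !height_sum //; apply: ler_sum => j _; rewrite addeE mulNr.
    by rewrite gerBl mulr_ge0 ?ler0n.
  have [j ji uj] := ne.
  have mixed (B : pred 'rV[int]_r) : root_system A B -> B (u + (- m%:Z) *: 'e_i) = false.
    move=> RB; apply/negbTE/negP => Bu; case/negP: um; apply: (rs_ge0 RB (i := j) Bu).
    by rewrite addeE eq_sym (negPf ji) mulr0 addr0 lt_def uj vge0_coord.
  by rewrite !mixed.
have pp : p = p'.
  have := down p; have := down p'; rewrite !HP !HQ; clear; lia.
have : P (u + 1 *: 'e_i) by rewrite scale1r vE.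
rewrite HP => q1; have : Q (u + 1 *: 'e_i) by rewrite HQ; move: q1 pp pq pq'; clear; lia.
by rewrite scale1r vE.
Qed.

Lemma root_system_unique (P Q : pred 'rV[int]_r) : root_system A P -> root_system A Q -> P =1 Q.
Proof.
move=> RP RQ.
have pos k v : vge0 v -> (root_height v < k)%N -> P v = Q v.
  elim: k v => // k IH v v0 hv; apply/idP/idP; first exact: (root_system_step RP RQ IH).
  by apply: (root_system_step RQ RP) v0 hv => u u0 hu; rewrite IH.
have imp (B C : pred 'rV[int]_r) v : root_system A B -> root_system A C ->
    (forall u, vge0 u -> B u = C u) -> B v -> C v.
  move=> RB RC E Bv; case/orP: (rs_sign RB Bv) => v0; first by rewrite -E.
  by rewrite -[v]opprK; apply: (rs_opp RC); rewrite -E // (rs_opp RB).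
have E u : vge0 u -> P u = Q u by move=> u0; apply: (pos (root_height u).+1).
move=> v; apply/idP/idP; apply: imp => //.
by move=> u u0; rewrite E.
Qed.
End Uniqueness.

(** * Restriction of a root system to a set of nodes *)

Section Pullback.
Variables (r s : nat) (f : 'I_s -> 'I_r) (f_inj : injective f).
Variables (A : 'I_r -> 'I_r -> int) (Phi : pred 'rV[int]_r).
Hypothesis RS : root_system A Phi.
Implicit Types (v u : 'rV[int]_s).

Definition push v : 'rV[int]_r := \sum_i v 0 i *: 'e_(f i).

Lemma push_coord v i : push v 0 (f i) = v 0 i.
Proof.
rewrite summxE (bigD1 i) //= mxE e_E eqxx mulr1 big1 ?addr0 // => j ji.
by rewrite mxE e_E (inj_eq f_inj) (negPf ji) mulr0.
Qed.

Lemma push_coord0 v k : k \notin codom f -> push v 0 k = 0.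
Proof.
move=> kf; rewrite summxE big1 // => j _; rewrite mxE e_E.
have [e|_] := eqVneq (f j) k; last by rewrite mulr0.
by rewrite -e codom_f in kf.
Qed.

Lemma pushD u v : push (u + v) = push u + push v.
Proof. by rewrite /push -big_split; apply: eq_bigr => i _; rewrite mxE scalerDl. Qed.
Lemma pushZ k v : push (k *: v) = k *: push v.
Proof. by rewrite /push scaler_sumr; apply: eq_bigr => i _; rewrite mxE scalerA. Qed.
Lemma pushN v : push (- v) = - push v.
Proof. by rewrite -scaleN1r pushZ scaleN1r. Qed.
Lemma push_e i : push 'e_i = 'e_(f i).
Proof.
rewrite /push (bigD1 i) //= e_E eqxx scale1r big1 ?addr0 // => j ji.
by rewrite e_E eq_sym (negPf ji) scale0r.
Qed.

Lemma push_ge0 v : vge0 (push v) = vge0 v.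
Proof.
apply/vge0P/vge0P => [H i|H k]; first by rewrite -push_coord.
case: (boolP (k \in codom f)) => [/codomP[i ->]|kf]; first by rewrite push_coord.
by rewrite push_coord0.
Qed.

Lemma push_eq0 v : (push v == 0) = (v == 0).
Proof.
apply/eqP/eqP => [H|->]; last by rewrite /push big1 // => i _; rewrite mxE scale0r.
by apply/rowP => i; rewrite -push_coord H !mxE.
Qed.

Lemma push_pairing v i : pairing A (push v) (f i) = pairing (fun i j => A (f i) (f j)) v i.
Proof.
rewrite /push (big_morph (fun x => pairing A x (f i)) (id1 := 0) (op1 := +%R)).
- by apply: eq_bigr => j _; rewrite pairingZ pairing_e.
- by move=> x y; rewrite pairingD.
by rewrite /pairing big1 // => j _; rewrite mxE mul0r.
Qed.

(** Strings move only in simple directions, so they stay on the image of [f]; the index supplied by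
    positivity has a nonzero coordinate, so it lies in the image as well. *)
Lemma pullback_root_system :
  root_system (fun i j => A (f i) (f j)) (fun v => Phi (push v)).
Proof.
split.
- by move=> v; rewrite pushN; apply: rs_opp RS _.
- by move=> i; rewrite push_e; apply: rs_simple RS _.
- by move=> v /(rs_sign RS); rewrite -pushN !push_ge0.
- by move=> v /(rs_double RS); rewrite pushD.
- by move=> i k; rewrite pushZ push_e => /(rs_mul RS).
- by move=> i; apply: rs_diag RS _.
- move=> v i Pv [j ji vj].
  have [|p [q [pq H]]] := rs_string RS (i := f i) Pv.
    by exists (f j); rewrite ?(inj_eq f_inj) ?push_coord.
  exists p, q; split=> [|k]; first by rewrite -push_pairing.
  by rewrite -H pushD pushZ push_e.
- move=> v v0 vn0; have [||k vk pk] := @rs_pos _ _ _ RS (push v).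
  + by rewrite push_ge0.
  + by rewrite push_eq0.
  have [/codomP[i kE]|kf] := boolP (k \in codom f); last by rewrite push_coord0 ?ltxx in vk.
  by exists i; rewrite -?push_pairing -?push_coord -kE.
move=> u v x Pu Pv Px; rewrite !pushD => Puv Puvx.
by rewrite -!push_eq0 !pushD (rs_jacobi RS Pu Pv Px).
Qed.
End Pullback.

(** * Stars and their description in the Dynkin diagram *)

Section Star.
Variables (r : nat) (A : 'I_r -> 'I_r -> int) (Phi : pred 'rV[int]_r).
Hypothesis RS : root_system A Phi.
Variable S : {set 'I_r}.
Implicit Types (u v x y z : 'rV[int]_r) (i j a b : 'I_r).

Definition height1_root v := Phi v && (shape_height S v == 1).
Local Notation B := height1_root.

(* When the Monge condition holds, the root vectors of height one other than
   that of z span the abelian subalgebra. *)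
Definition star z := [/\ B z, (forall v, B v -> v != z -> Phi (v + z))
  & (forall u v, B u -> B v -> u != z -> v != z -> ~~ Phi (u + v))].

Definition cartan_adj i j := (i != j) && (A i j != 0).
Definition cartan_component c a : {set 'I_r} :=
  [set b | connect (fun i j => [&& i != c, j != c & cartan_adj i j]) a b].

Lemma height1_other v i : B v -> i \notin S -> exists2 j, j != i & v 0 j != 0.
Proof.
case/andP => Pv /eqP hv iS; have [|j jS vj] := @shape_height_gt0 _ S v; first by rewrite hv.
by exists j; [apply: contraNneq iS => <-|rewrite gt_eqF].
Qed.

Section FromStar.
Variable z : 'rV[int]_r.
Hypothesis zS : star z.
(** Two further roots of height one, provided by the bound on the dimension of degree -1. At least
    one of them differs from both [z] and a given reflection of [z]. *)
Hypothesis B3 : exists u v, [/\ B u, B v, u != z, v != z & u != v].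

Let refl i v := v - pairing A v i *: 'e_i.

Lemma refl_B i v : i \notin S -> B v -> B (refl i v).
Proof.
move=> iS Bv; have [Pv /eqP hv] := andP Bv; apply/andP; split.
  by apply: root_reflection RS _ _ Pv _; apply: height1_other.
by rewrite shape_heightD shape_heightN shape_heightZ shape_height_e (negPf iS) mulr0 subr0 hv.
Qed.

Lemma reflK i : involutive (refl i).
Proof.
move=> v; rewrite /refl; set p := pairing A v i.
have -> : pairing A (v - p *: 'e_i) i = - p.
  by rewrite pairingD -scaleNr pairingZ pairing_e (rs_diag RS) -/p; ring.
by rewrite scaleNr opprK subrK.
Qed.

(* A third height-one root g would satisfy both Phi (g + refl i z), by
   reflecting a sum with z, and its negation. *)
Lemma star_refl i : i \notin S -> refl i z = z.
Proof.
case: zS => Bz S1 S2 iS; apply/eqP; apply: contraT => rz.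
have [g [Bg gz gr]] : exists g, [/\ B g, g != z & g != refl i z].
  have [u [v [Bu Bv uz vz uv]]] := B3.
  have [e|ur] := eqVneq u (refl i z); last by exists u; split.
  by exists v; split=> //; rewrite -e eq_sym.
have Brg := refl_B iS Bg.
have rgz : refl i g != z by apply: contra_neq gr => <-; rewrite reflK.
have := S1 _ Brg rgz => Pgz.
have : Phi (refl i (refl i g + z)).
  apply: root_reflection RS _ _ Pgz _.
  have [|j jS vj] := @shape_height_gt0 _ S (refl i g + z).
    by have [/andP[_ /eqP h1] /andP[_ /eqP h2]] := (Brg, Bz); rewrite shape_heightD h1 h2.
  by exists j; [apply: contraNneq iS => <-|rewrite gt_eqF].
have -> : refl i (refl i g + z) = g + refl i z.
  rewrite -{2}(reflK i g) {1}/refl pairingD scalerDl opprD addrACA //.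
by rewrite (negPf (S2 _ _ Bg (refl_B iS Bz) gz rz)).
Qed.

Lemma star_pairing i : i \notin S -> pairing A z i = 0.
Proof.
move=> iS; have := star_refl iS; rewrite /refl => /eqP.
rewrite -subr_eq0 addrAC subrr add0r oppr_eq0 => /eqP/rowP/(_ i).
by rewrite !mxE !eqxx mulr1.
Qed.

Lemma star_simple : exists2 a, a \in S & z = 'e_a.
Proof.
case: zS => Bz S1 S2; have [Pz /eqP hz] := andP Bz.
case: (height1_descend RS Pz hz) => // -[j jS Pzj].
have ne := height1_other Bz jS.
have [p [q [pq H]]] := rs_string RS Pz ne.
rewrite star_pairing // in pq.
(* The pairing with [j] is 0, so the string through [z] is symmetric: with [z - 'e_j] also
   [z + 'e_j] is a root. *)
have Pzj' : Phi (z + 'e_j).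
  move: Pzj; rewrite -scaleN1r H -['e_j]scale1r H; move: pq; clear; lia.
have Bzj : B (z + 'e_j).
  by rewrite /height1_root Pzj' shape_heightD shape_height_e (negPf jS) hz addr0 eqxx.
have zjz : z + 'e_j != z.
  apply/eqP => /rowP/(_ j); rewrite !mxE !eqxx; clear; lia.
have P2 := S1 _ Bzj zjz.
have : Phi (z + z).
  have -> : z + z = z + 'e_j + z - 'e_j by rewrite [z + 'e_j + z]addrAC addrK.
  apply: root_subsimple RS _ _ P2 _ _.
    have [k kj zk] := ne; exists k => //; rewrite !mxE eqxx (negPf kj) addr0.
    by rewrite -mulr2n mulrn_eq0.
  by rewrite !pairingD star_pairing // pairing_e (rs_diag RS).
by rewrite (negPf (rs_double RS Pz)).
Qed.

(** For the last condition: a positive root without [a] of height at least 2 lies above a root of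
    height exactly 2, again without [a], and this one splits into two roots of height one different
    from [z], against the star property. *)
Lemma star_conditions : exists2 a, a \in S &
  [/\ z = 'e_a, forall b, b \in S -> b != a -> cartan_adj a b,
      forall b, cartan_adj a b -> b \in S
    & forall v, Phi v -> vge0 v -> v 0 a = 0 -> shape_height S v <= 1].
Proof.
have [a aS za] := star_simple; exists a => //; case: zS => Bz S1 S2.
have e_inj i j : 'e_i = 'e_j :> 'rV[int]_r -> i = j.
  by move/rowP/(_ i); rewrite !e_E eqxx; case: eqP.
split=> // [b bS ba|b /andP[ab Aab]|v Pv v0 va].
- rewrite /cartan_adj eq_sym ba /= (cartan_sym0 RS).
  have Bb : B 'e_b by rewrite /height1_root (rs_simple RS) shape_height_e bS.
  have /(S1 _ Bb) : 'e_b != z by apply: contra_neq ba; rewrite za => /e_inj.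
  have /andP[_ /eqP] := cartan_offdiag RS ba; rewrite za => -> lt.
  by rewrite lt_eqF.
- apply: contraT => bS; have := star_pairing bS.
  by rewrite za pairing_e => /eqP; rewrite (negPf Aab).
rewrite leNgt; apply/negP => h2.
have [|u [Pu u0 hu uv]] := height2_below RS Pv v0 (S := S); first by move: h2; clear; lia.
have ua : u 0 a = 0 by apply/eqP; rewrite eq_le vge0_coord // andbT -va.
have [x [y [Px Py hx hy uE]]] := height2_split RS Pu u0 hu.
have x0 := vge0_coord a (shape_height1_ge0 RS Px hx).
have y0 := vge0_coord a (shape_height1_ge0 RS Py hy).
have [xa ya] : x 0 a = 0 /\ y 0 a = 0.
  by move/eqP: ua; rewrite uE mxE paddr_eq0 // => /andP[/eqP-> /eqP->].
have nz (w : 'rV[int]_r) : w 0 a = 0 -> w != z.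
  by move=> wa; apply/eqP => wz; move: wa; rewrite wz za e_E eqxx.
have Bx : B x by rewrite /height1_root Px hx eqxx.
have By : B y by rewrite /height1_root Py hy eqxx.
by have := S2 x y Bx By (nz _ xa) (nz _ ya); rewrite -uE Pu.
Qed.
End FromStar.

Section ToStar.
Variable a : 'I_r.
Hypothesis aS : a \in S.
Hypothesis S_adj : forall b, b \in S -> b != a -> cartan_adj a b.
Hypothesis adj_S : forall b, cartan_adj a b -> b \in S.
(** The form in which the |1|-grading of a component is used: a bound on the coefficient of [b] in
    the positive roots supported there. *)
Hypothesis comp1 : forall b v, b \in S -> b != a -> Phi v -> vge0 v ->
  (forall j, 0 < v 0 j -> j \in cartan_component a b) -> v 0 b <= 1.

Lemma cartan_adj_sym i j : cartan_adj i j = cartan_adj j i.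
Proof. by rewrite /cartan_adj eq_sym (cartan_sym0 RS). Qed.

Lemma height1_coords v i j : B v -> i \in S -> 0 < v 0 i -> j \in S -> j != i -> v 0 j = 0.
Proof.
case/andP => Pv /eqP hv iS vi jS ji; have v0 := rs_ge0 RS Pv vi.
move: hv; rewrite /shape_height (bigD1 i) //= (bigD1 j) /=; last by rewrite jS.
set q := \sum_(_ | _) _; have : 0 <= q by apply: sumr_ge0 => k _; apply: vge0_coord.
move: (vge0_coord j v0) vi; clear; lia.
Qed.

(** The neighbours of [a] lie in [S], so height one keeps them out of the support once [a] is in it,
    and connectedness leaves [a] alone. *)
Lemma height1_zeta v : B v -> 0 < v 0 a -> v = 'e_a.
Proof.
move=> Bv va; have [Pv _] := andP Bv; have v0 := rs_ge0 RS Pv va.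
have [|H|H] := support_connected RS (T := pred1 a) Pv v0.
- move=> i j vi vj /= /eqP ia ja; subst i; apply/eqP; apply: contraT => Aaj.
  have jS : j \in S by apply: adj_S; rewrite /cartan_adj eq_sym ja.
  by rewrite (height1_coords Bv aS va jS ja) ltxx in vj.
- case: (simple_or_other RS a Pv v0) => // -[j ja vj].
  have /H /= : 0 < v 0 j by rewrite lt_def vj vge0_coord.
  by rewrite (negPf ja).
by have := H a va; rewrite /= eqxx.
Qed.

Lemma height1_zeta0 v : B v -> v != 'e_a -> v 0 a = 0.
Proof.
move=> Bv vz; apply/eqP; rewrite eq_le.
have [Pv /eqP hv] := andP Bv; rewrite (vge0_coord _ (shape_height1_ge0 RS Pv hv)) andbT.
by rewrite leNgt; apply: contra_neqN vz => /(height1_zeta Bv).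
Qed.

(** The support is connected and avoids [a], so it lies in one component. As the coefficient at [b]
    is at most 1, that component contains a second element [c] of [S], and a path from [b] to [c]
    closes up through [a] to a cycle. *)
Lemma no_height2 v : Phi v -> vge0 v -> v 0 a = 0 -> shape_height S v = 2 -> False.
Proof.
move=> Pv v0 va hv.
have [|b bS vb] := @shape_height_gt0 _ S v; first by rewrite hv.
have ba : b != a by apply: contraTneq vb => ->; rewrite va ltxx.
set e := (fun i j => [&& i != a, j != a & cartan_adj i j]).
have [i j vi vj|supp|/(_ b vb)] := support_connected RS (T := mem (cartan_component a b)) Pv v0.
- rewrite /= !inE => bi bj; apply/eqP; apply: contraNT (bj) => Aij.
  apply: connect_trans (bi) (connect1 _).
  have na k : 0 < v 0 k -> k != a by move=> vk; apply: contraTneq vk => ->; rewrite va ltxx.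
  rewrite !na //= /cartan_adj Aij andbT.
  by apply: contraNneq bj => <-.
- have vb1 : v 0 b <= 1 by apply: comp1 => // j /supp.
  have [c [cS cb vc]] : exists c, [/\ c \in S, c != b & 0 < v 0 c].
    apply: contrapT => H; move: hv; rewrite /shape_height (bigD1 b) //= big1; first lia.
    move=> c /andP[cS cb]; apply/eqP; rewrite eq_le vge0_coord // andbT leNgt.
    by apply/negP => vc; apply: H; exists c.
  have ca : c != a by apply: contraTneq vc => ->; rewrite va ltxx.
  have := supp c vc; rewrite /= inE => /connectP[p ep cE].
  move: ep cE; case/shortenP => p' ep' up' _ cE.
  apply: (no_cycle RS (e := cartan_adj) (c := a :: b :: p')).
  + by move=> i j /andP[].
  + rewrite cons_uniq up' andbT in_cons negb_or eq_sym ba /=.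
    have : all (predC1 a) p'.
      elim: p' (b) ep' {up' cE} => //= x p' IH y /andP[/and3P[_ -> _]]; exact: IH.
    by move/allP => H; apply/negP => /H; rewrite /= eqxx.
  + rewrite /= rcons_path S_adj //= -cE cartan_adj_sym S_adj // andbT.
    by apply: sub_path ep' => i j /and3P[].
  by case: p' {ep' up'} cE cb => //= ->; rewrite eqxx.
by rewrite /= inE connect0.
Qed.

Lemma to_star : star 'e_a.
Proof.
split=> [|v Bv vz|u v Bu Bv uz vz].
- by rewrite /height1_root (rs_simple RS) shape_height_e aS.
- have [Pv /eqP hv] := andP Bv; have v0 := shape_height1_ge0 RS Pv hv.
  have va := height1_zeta0 Bv vz.
  have [|b bS vb] := @shape_height_gt0 _ S v; first by rewrite hv.
  have ba : b != a by apply: contraTneq vb => ->; rewrite va ltxx.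
  have ne : exists2 j, j != a & v 0 j != 0 by exists b; rewrite // gt_eqF.
  apply: (root_addsimple RS Pv ne).
  (* In the pairing with [a] the node [b] contributes a negative term, and the other nodes
     contribute at most 0 because [v] misses [a]. *)
  rewrite /pairing (bigD1 b) //=.
  have : A b a < 0.
    have /andP[_ Aba] : cartan_adj b a by rewrite cartan_adj_sym S_adj.
    by rewrite lt_neqAle Aba (cartan_le0 RS).
  have : \sum_(i | i != b) v 0 i * A i a <= 0.
    apply: sumr_le0 => i ib; have [->|ia] := eqVneq i a; first by rewrite va mul0r.
    by rewrite mulr_ge0_le0 ?vge0_coord // (cartan_le0 RS).
  by move=> s0 Aba; rewrite -[ltRHS]addr0 ltr_leD // pmulr_rlt0.
have [[Pu /eqP hu] [Pv /eqP hv]] := (andP Bu, andP Bv); apply/negP => Puv.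
have [u0 v0] := (shape_height1_ge0 RS Pu hu, shape_height1_ge0 RS Pv hv).
apply: (no_height2 Puv); last by rewrite shape_heightD hu hv.
  by apply/vge0P => i; rewrite mxE addr_ge0 // vge0_coord.
by rewrite mxE !height1_zeta0.
Qed.
End ToStar.
End Star.

(** * The root system of a simple Lie algebra *)

Section LieRootSystem.
Variables (K : numClosedFieldType) (g : lieAlgType K) (h : {vspace g}).
Variables (r : nat) (D : r.-tuple (dualv K h)).
Hypothesis (gS : simple_lie g) (hC : cartan_subalgebra h) (DS : simple_roots D).
Hypothesis (r_gt0 : (0 < r)%N).
Local Notation n := (\dim {:g}).
Variables (X : n.-tuple g) (w : 'I_n -> dualv K h).
Hypothesis (bX : basis_of fullv X) (Xw : forall i : 'I_n, X`_i \in root_space (w i)).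
Implicit Types (a b c : dualv K h) (u v : 'rV[int]_r).

Local Notation t := coroot_dual.
Local Notation is_weight := (is_weight w).

Definition lin_root (v : 'rV[int]_r) : dualv K h := \sum_i tnth D i *~ v 0 i.
Definition is_rootv (v : 'rV[int]_r) := (v != 0) && is_weight (lin_root v).

Lemma weval_lin_root v (u : g) : weval (lin_root v) u = \sum_i (v 0 i)%:~R * weval (tnth D i) u.
Proof.
rewrite /lin_root weval_suml; apply: eq_bigr => i _.
by rewrite weval_mulrz -mulrzl.
Qed.

Lemma lin_rootD u v : lin_root (u + v) = lin_root u + lin_root v.
Proof. by rewrite /lin_root -big_split; apply: eq_bigr => i _; rewrite mxE mulrzDr. Qed.
Lemma lin_rootN v : lin_root (- v) = - lin_root v.
Proof. by rewrite /lin_root -sumrN; apply: eq_bigr => i _; rewrite mxE mulrNz. Qed.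
Lemma lin_root_e i (k : int) : lin_root (k *: 'e_i) = tnth D i *~ k.
Proof.
rewrite /lin_root (bigD1 i) //= mxE e_E eqxx mulr1 big1 ?addr0 // => j ji.
by rewrite mxE e_E eq_sym (negPf ji) mulr0 mulr0z.
Qed.

Lemma coord_lin_root v (i : 'I_r) : coord D i (lin_root v) = (v 0 i)%:~R.
Proof.
case: DS => _ bD _; rewrite /lin_root linear_sum (bigD1 i) //= big1 ?addr0.
  rewrite (tnth_nth 0) -scaler_int linearZ /= coord_free ?(basis_free bD) // eqxx.
  by rewrite mulr1.
move=> j ji; rewrite (tnth_nth 0) -scaler_int linearZ /= coord_free ?(basis_free bD) //.
by rewrite (negPf ji) mulr0.
Qed.

Lemma lin_root_inj : injective lin_root.
Proof.
move=> u v e; apply/rowP => i; have := congr1 (coord D i) e.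
by rewrite !coord_lin_root => /eqP; rewrite eqr_int => /eqP.
Qed.

Lemma lin_root0 : lin_root 0 = 0.
Proof. by rewrite /lin_root big1 // => i _; rewrite mxE mulr0z. Qed.

Lemma lin_root_eq0 v : (lin_root v == 0) = (v == 0).
Proof. by rewrite -lin_root0 (inj_eq lin_root_inj). Qed.

Lemma root_lin_root b : is_weight b -> exists v, b = lin_root v /\ (vge0 v || vge0 (- v)).
Proof.
move=> wb; have [->|b0] := eqVneq b 0.
  by exists 0; rewrite lin_root0; split=> //; apply/orP; left; apply/vge0P => i; rewrite mxE.
have br : is_root b by apply/(is_rootE bX Xw); rewrite b0.
case: DS => _ _ /(_ b br)[n [E|E]].
  exists (\row_i (n i)%:Z); split; last first.
    by apply/orP; left; apply/vge0P => i; rewrite mxE.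
  by rewrite E; apply: eq_bigr => i _; rewrite mxE pmulrn.
exists (- \row_i (n i)%:Z); split; last first.
  by apply/orP; right; rewrite opprK; apply/vge0P => i; rewrite mxE.
by rewrite E lin_rootN; congr (- _); apply: eq_bigr => i _; rewrite mxE pmulrn.
Qed.

Lemma simple_root_neq0 i : tnth D i != 0.
Proof. by case: DS => /(_ i)[]. Qed.

Lemma is_weight_simple i : is_weight (tnth D i).
Proof. by have /andP[] := simple_weight DS bX Xw i. Qed.

Lemma not_multiple_simple v i j : j != i -> v 0 j != 0 -> not_multiple (tnth D i) (lin_root v).
Proof.
move=> ji vj k; rewrite -lin_root_e -lin_rootD lin_root_eq0.
by apply/eqP => /rowP/(_ j); rewrite addeE mxE eq_sym (negPf ji) mulr0 addr0 => /eqP; apply/negP.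
Qed.

(** The entry [A i j] is normalized by the root [j]; off the diagonal it is p - q for the string of
    root [i] in the direction of root [j]. *)
Lemma cartan_int_ex : exists A : 'I_r -> 'I_r -> int, forall i j,
  2 * weval (tnth D i) (t (tnth D j)) = weval (tnth D j) (t (tnth D j)) * (A i j)%:~R.
Proof.
have H i j : exists m : int,
  2 * weval (tnth D i) (t (tnth D j)) = weval (tnth D j) (t (tnth D j)) * m%:~R.
  have [->|ij] := eqVneq i j; first by exists 2; rewrite mulrC.
  have nm : not_multiple (tnth D j) (tnth D i).
    have := @not_multiple_simple 'e_i j i ij; rewrite -['e_i]scale1r lin_root_e mulr1z.
    by apply; rewrite scale1r e_E eqxx.
  have [p [q [pq _]]] := root_string gS hC DS r_gt0 bX Xw (simple_root_neq0 j)
    (is_weight_simple j) (is_weight_simple i) nm.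
  by exists (p%:Z - q%:Z); rewrite pq intrB.
by exists (fun i => projT1 (choice (H i))) => i j; apply: (projT2 (choice (H i))).
Qed.

(** Among the integer multiples of [a] only 0, [a] and [- a] can be weights; [b = a] would make 2 a
    a weight, and [b = - a] is excluded by the nonzero sum. *)
Lemma root_not_multiple a b : a != 0 -> b != 0 -> is_weight a -> is_weight b ->
  is_weight (a + b) -> a + b != 0 -> not_multiple a b.
Proof.
move=> a0 b0 wa wb wab ab0 k; apply/eqP => /eqP; rewrite addr_eq0 => /eqP bE.
have na0 : - a != 0 by rewrite oppr_eq0.
have wna := weightN gS hC DS r_gt0 bX Xw wa.
have [_ Ha] := root_mult gS hC DS r_gt0 bX Xw a0.
have [_ Hna] := root_mult gS hC DS r_gt0 bX Xw na0.
case/is_weightP: (wb) => j wj; case/is_weightP: wab => l wl.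
case: k bE => [[|[|k]]|[|k]] bE.
- by move/eqP: b0; apply; rewrite bE mulr0z oppr0.
- by move/eqP: ab0; apply; rewrite bE mulr1z subrr.
- have := Hna j k.+2 isT wna; rewrite wj bE -pmulrn mulNrn eqxx //.
- have e : b = a by rewrite bE NegzE mulrNz opprK mulr1z.
  by have := Ha l 2 isT wa; rewrite wl e mulr2n eqxx.
have := Ha j k.+2 isT wa; rewrite wj bE NegzE mulrNz opprK -pmulrn eqxx //.
Qed.

Section CartanMatrix.
Variable A : 'I_r -> 'I_r -> int.
Hypothesis AE : forall i j,
  2 * weval (tnth D i) (t (tnth D j)) = weval (tnth D j) (t (tnth D j)) * (A i j)%:~R.

Lemma simple_norm_gt0 i : 0 < weval (tnth D i) (t (tnth D i)).
Proof. exact: (coroot_norm_gt0 gS hC DS r_gt0 bX Xw (simple_root_neq0 i) (is_weight_simple i)). Qed.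

Lemma weval_pairing (v : 'rV[int]_r) i :
  2 * weval (lin_root v) (t (tnth D i)) = weval (tnth D i) (t (tnth D i)) * (pairing A v i)%:~R.
Proof.
rewrite weval_lin_root mulr_sumr /pairing rmorph_sum mulr_sumr; apply: eq_bigr => j _.
by rewrite mulrCA AE rmorphM mulrCA.
Qed.

(** [T] is the Killing dual of [lin_root v]. Its square norm is a sum of squares of real numbers,
    not all zero since the simple roots separate points; if no index qualified, expanding it along
    the t_j would make it at most 0. *)
Lemma pairing_pos v : vge0 v -> v != 0 -> exists2 i, 0 < v 0 i & 0 < pairing A v i.
Proof.
move=> /vge0P v0 vn0.
pose T := \sum_j (v 0 j)%:~R *: t (tnth D j).
have Th : T \in h by apply: rpred_sum => j _; rewrite memvZ // coroot_dual_h.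
have TE (u : g) : u \in h -> killing T u = weval (lin_root v) u.
  move=> uh; rewrite weval_lin_root killing_sym (linear_sum (killing u : g -> K^o)) /=.
  apply: eq_bigr => j _; rewrite killingZr killing_sym.
  by rewrite (coroot_dualE gS hC DS r_gt0 bX Xw).
have wTr i : weval (w i) T \is Num.real.
  rewrite /T /weval !linear_sum rpred_sum // => j _; rewrite !linearZ /= realM ?realz //.
  exact: (weval_real gS hC DS r_gt0 bX Xw i (simple_root_neq0 j) (is_weight_simple j)).
have TT : killing T T = \sum_i weval (w i) T ^+ 2.
  by rewrite (killing_weights bX Xw).
have T0 : 0 < killing T T.
  have ge0 i : 0 <= weval (w i) T ^+ 2 by rewrite real_exprn_even_ge0.
  rewrite lt_def TT sumr_ge0 // andbT; apply: contra_neq vn0 => /psumr_eq0P H.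
  have Ti i : weval (w i) T = 0 by apply/eqP; rewrite -sqrf_eq0 H.
  apply/eqP; rewrite -lin_root_eq0; apply/eqP/weval_inj => u uh.
  rewrite weval0l -TE // (_ : T = 0); first by have := killingZl 0 0 u; rewrite scaler0 mul0r.
  apply: (dual_sep DS Th) => k.
  by have /is_weightP[i <-] := is_weight_simple k.
apply: contrapT => H; move: T0; apply/negP; rewrite -real_leNgt ?real0 //; last first.
  by rewrite TT rpred_sum // => i _; rewrite realX.
rewrite TE // /T /weval !linear_sum; apply: sumr_le0 => j _; rewrite !linearZ /=.
have : v 0 j = 0 \/ pairing A v j <= 0.
  have [->|vj] := eqVneq (v 0 j) 0; [by left|right].
  by rewrite leNgt; apply/negP => pj; apply: H; exists j; rewrite // lt_def vj v0.
case=> [->|pj]; first by rewrite scale0r.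
have := weval_pairing v j; rewrite /weval => e.
rewrite mulr_ge0_le0 ?ler0z // -(pmulr_rle0 _ (ltr0n K 2)) e.
by rewrite mulr_ge0_le0 ?lerz0 // ltW // simple_norm_gt0.
Qed.

Lemma lie_root_system : root_system A is_rootv.
Proof.
have at0 i : weval (tnth D i) (t (tnth D i)) != 0 by rewrite gt_eqF ?simple_norm_gt0.
split.
- move=> v /andP[v0 wv]; rewrite /is_rootv oppr_eq0 v0 lin_rootN /=.
  exact: (weightN gS hC DS r_gt0 bX Xw).
- move=> i; rewrite /is_rootv -['e_i]scale1r lin_root_e mulr1z is_weight_simple andbT.
  by apply/eqP => /rowP/(_ i); rewrite !mxE !eqxx.
- move=> v /andP[v0 /root_lin_root[u [/lin_root_inj ->]]] //.
- move=> v /andP[v0 wv]; rewrite negb_and negbK; apply/orP; right.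
  rewrite lin_rootD -mulr2n; apply/negP => /is_weightP[i wi].
  have [_ H] := root_mult gS hC DS r_gt0 bX Xw (a := lin_root v) (negbT (etrans (lin_root_eq0 v) (negbTE v0))).
  by have := H i 2 isT wv; rewrite wi eqxx.
- move=> i [|[|k]] /andP[v0 //]; first by rewrite scale0r eqxx in v0.
  rewrite lin_root_e => /is_weightP[j wj].
  have [_ H] := root_mult gS hC DS r_gt0 bX Xw (simple_root_neq0 i).
  by have := H j k.+2 isT (is_weight_simple i); rewrite wj pmulrn eqxx.
- move=> i; have := AE i i; rewrite mulrC => /(mulfI (at0 i))/eqP.
  by rewrite -[2]/(2%:~R) eqr_int eq_sym => /eqP.
- move=> v i /andP[v0 wv] [j ji vj].
  have nm := not_multiple_simple ji vj.
  have [p [q [pq H]]] := root_string gS hC DS r_gt0 bX Xw (simple_root_neq0 i)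
    (is_weight_simple i) wv nm.
  exists p, q; split=> [|k].
    have := weval_pairing v i; rewrite pq => /(mulfI (at0 i))/eqP.
    by rewrite -[p%:R]/(p%:Z%:~R) -[q%:R]/(q%:Z%:~R) -intrB eqr_int => /eqP.
  rewrite /is_rootv -lin_root_eq0 lin_rootD lin_root_e nm /=; exact: H.
- exact: pairing_pos.
(* For root vectors of [x], [u], [v], two uses of [root_bracket] give [x, [u, v]] != 0; by the
   Jacobi identity [x, u] or [x, v] is nonzero. *)
move=> u v x /andP[u0 wu] /andP[v0 wv] /andP[x0 wx] /andP[uv0 wuv] /andP[uvx0 wuvx].
rewrite -!lin_root_eq0 in u0 v0 x0 uv0 uvx0.
rewrite !lin_rootD in uv0 uvx0 wuv wuvx.
case/is_weightP: (wu) => iu wiu; case/is_weightP: (wv) => iv wiv.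
case/is_weightP: (wx) => ix wix.
have Xu : X`_iu \in root_space (lin_root u) by rewrite -wiu.
have Xv : X`_iv \in root_space (lin_root v) by rewrite -wiv.
have Xx : X`_ix \in root_space (lin_root x) by rewrite -wix.
have nm1 := root_not_multiple u0 v0 wu wv wuv uv0.
have b1 := root_bracket gS hC DS r_gt0 bX Xw u0 wu wv nm1 wuv Xu Xv (X_neq0 bX iu) (X_neq0 bX iv).
have Xuv := root_space_lieb Xu Xv.
rewrite addrC in wuvx; rewrite addrC in uvx0.
have nm2 := root_not_multiple x0 uv0 wx wuv wuvx uvx0.
have b2 := root_bracket gS hC DS r_gt0 bX Xw x0 wx wuv nm2 wuvx Xx Xuv (X_neq0 bX ix) b1.
have [xu0|xu0] := eqVneq (lieb X`_ix X`_iu) 0; last first.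
  have := root_space_weight bX Xw (root_space_lieb Xx Xu) xu0.
  rewrite addrC -lin_rootD /is_rootv => ->.
  by rewrite andbT; case: eqP.
have [xv0|xv0] := eqVneq (lieb X`_ix X`_iv) 0.
  by rewrite lieb_der xu0 xv0 lieb0l linear0 addr0 eqxx in b2.
have := root_space_weight bX Xw (root_space_lieb Xx Xv) xv0.
rewrite addrC -lin_rootD /is_rootv => ->.
by rewrite andbT; case: (v + x =P 0); rewrite /= !orbT.
Qed.

Lemma root_formE b c : root_form b c = weval b (t c).
Proof. by rewrite /root_form (coroot_dualE gS hC DS r_gt0 bX Xw) // coroot_dual_h. Qed.

Lemma cartan_integerE i j : cartan_integer D i j = (A i j)%:~R.
Proof.
rewrite /cartan_integer !root_formE AE mulrAC mulfV ?mul1r //.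
by rewrite gt_eqF ?simple_norm_gt0.
Qed.

Lemma dynkin_edgesE i j : dynkin_edges D i j = (A i j * A j i)%:~R.
Proof. by rewrite /dynkin_edges !cartan_integerE -intrM. Qed.

Lemma dynkin_adjE i j : dynkin_adj D i j = cartan_adj A i j.
Proof.
rewrite /dynkin_adj dynkin_edgesE intr_eq0 mulf_eq0 /cartan_adj.
by rewrite (cartan_sym0 lie_root_system j i) orbb.
Qed.

(** Symmetry of the form reads N_j A_ij = N_i A_ji for the squared lengths N; as both entries are
    negative, the longer root [i] goes with the smaller entry [A i j]. *)
Lemma dynkin_arrowE i j : dynkin_arrow D i j = cartan_adj A i j && (A i j < A j i).
Proof.
rewrite /dynkin_arrow dynkin_adjE; case: (boolP (cartan_adj A i j)) => //= /andP[ij Aij].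
rewrite !root_formE.
set Ni := weval (tnth D i) _; set Nj := weval (tnth D j) _.
have Ni0 : 0 < Ni := simple_norm_gt0 i; have Nj0 : 0 < Nj := simple_norm_gt0 j.
have sym : weval (tnth D i) (t (tnth D j)) = weval (tnth D j) (t (tnth D i)).
  rewrite -!(coroot_dualE gS hC DS r_gt0 bX Xw) ?coroot_dual_h //.
  exact: killing_sym.
have e : Nj * (A i j)%:~R = Ni * (A j i)%:~R by rewrite -!AE sym.
have Aij0 : (A i j)%:~R < 0 :> K.
  by rewrite ltrz0 lt_neqAle Aij (cartan_le0 lie_root_system).
by rewrite -(ltr_int K) -[RHS](ltr_pM2l Ni0) -e ltr_nM2r.
Qed.
End CartanMatrix.
End LieRootSystem.

(** * Gradings *)

Section Grading.
Variables (K : numClosedFieldType) (g : lieAlgType K) (h : {vspace g}).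
Variables (r : nat) (D : r.-tuple (dualv K h)).
Hypothesis (gS : simple_lie g) (hC : cartan_subalgebra h) (DS : simple_roots D).
Hypothesis (r_gt0 : (0 < r)%N).
Local Notation n := (\dim {:g}).
Variables (X : n.-tuple g) (w : 'I_n -> dualv K h).
Hypothesis (bX : basis_of fullv X) (Xw : forall i : 'I_n, X`_i \in root_space (w i)).
Implicit Types (a b c : dualv K h) (u v : 'rV[int]_r).


Local Notation lin_root := (lin_root D).
Local Notation is_rootv := (is_rootv D w).
Variable vec : 'I_n -> 'rV[int]_r.
Hypothesis vecE : forall i, w i = lin_root (vec i).
Variable S : {set 'I_r}.
Local Notation G := (parabolic_grading D S).

Definition basis_height i : int := shape_height S (vec i).
Local Notation hw := basis_height.

Lemma height_basis i : height D S (w i) = (hw i)%:~R.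
Proof.
rewrite vecE /height /basis_height /shape_height rmorph_sum; apply: eq_bigr => j _.
exact: coord_lin_root.
Qed.

Lemma basis_height0 i : w i = 0 -> hw i = 0.
Proof.
move=> wi; have := height_basis i; rewrite wi /height big1 => [/esym/eqP|j _].
  by rewrite intr_eq0 => /eqP.
by rewrite linear0.
Qed.

(** The sum in the grading ranges over a set of functionals; it has its intended value because these
    are all weights of the basis, hence finitely many. The basis vectors of weight 0 lie in [h],
    which belongs to degree 0. *)
Lemma mem_grading (j : int) x :
  (x \in G j) = [forall i, (coord X i x != 0) ==> (hw i == j)].
Proof.
pose s := undup [seq w i | i in [pred i | (w i != 0) && (hw i == j)]].
have sP b : b \in s -> is_root b /\ (height D S b = j%:~R)%R.
  rewrite mem_undup => /fintype.imageP[i + ->]; rewrite inE => /andP[wi /eqP hi]; split.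
    by apply/(is_rootE bX Xw); rewrite wi; apply/is_weightP; exists i.
  by rewrite height_basis hi.
rewrite /parabolic_grading (@fsbigE _ _ _ _ _ s) ?undup_uniq //; last first.
  move=> b [/(is_rootE bX Xw)/andP[b0 /is_weightP[i wi]] hb] /negP[].
  rewrite mem_undup; apply/fintype.imageP; exists i => //; rewrite inE wi b0 /=.
  by rewrite -wi height_basis in hb; move/eqP: hb; rewrite eqr_int.
rewrite [\big[_/_]_(b <- s | _) _](_ : _ = \big[addv/0%VS]_(b <- s) root_space b); last first.
  rewrite big_mkcond /=; apply: eq_big_seq => b bs.
  by case: ifPn => // /negP[]; rewrite classical_sets.inE; apply: sP.
apply/idP/forallP => [|H].
  case/memv_addP => u uh [v vs ->] i; apply/implyP => xi.
  have [ui|ui] := eqVneq (coord X i u) 0; last first.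
    move: uh; case: eqP => [-> uh|_]; last by rewrite memv0 => /eqP u0; rewrite u0 linear0 eqxx in ui.
    by rewrite basis_height0 //; apply: (coord_root_space bX Xw _ ui); rewrite (root_space0 hC DS).
  rewrite linearD /= ui add0r in xi.
  move: vs; rewrite (big_nth 0) big_mkord => /memv_sumP[z zs vE].
  have [k zk] : exists k, coord X i (z k) != 0.
    apply/existsP; apply: contraNT xi; rewrite negb_exists => /forallP H.
    by rewrite vE linear_sum big1 // => k _; have /negPn/eqP := H k.
  have wi := coord_root_space bX Xw (zs k isT) zk.
  have [] := sP (s`_k); first by rewrite mem_nth.
  by rewrite -wi height_basis => _ /eqP; rewrite eqr_int.
rewrite (coordXE bX x); apply: rpred_sum => i _.
have [->|xi] := eqVneq (coord X i x) 0; first by rewrite scale0r mem0v.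
rewrite memvZ //; have /implyP/(_ xi)/eqP hi := H i.
have [wi|wi] := eqVneq (w i) 0.
  rewrite -hi basis_height0 // eqxx; apply: (subvP (addvSl _ _)).
  by rewrite -(root_space0 hC DS) -wi.
apply: (subvP (addvSr _ _)).
have ws : w i \in s by rewrite mem_undup; apply/fintype.imageP; exists i; rewrite // inE wi hi eqxx.
rewrite (big_rem _ ws) /=; apply: (subvP (addvSl _ _)); exact: Xw.
Qed.

Lemma basis_in_grading (i : 'I_n) j : (X`_i \in G j) = (hw i == j).
Proof.
rewrite mem_grading; apply/forallP/idP => [/(_ i)|/eqP hi k].
  by rewrite (coordX bX) eqxx oner_neq0.
by rewrite (coordX bX); have [<-|] := eqVneq i k; rewrite ?hi ?eqxx ?implybT.
Qed.

Lemma grading_span j : G j = <<image_mem (fun i : 'I_n => X`_i) (mem [pred i | hw i == j])>>%VS.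
Proof.
apply/vspaceP => x; apply/idP/idP => [|xs].
  rewrite mem_grading => /forallP H; rewrite (coordXE bX x); apply: rpred_sum => i _.
  have [->|xi] := eqVneq (coord X i x) 0; first by rewrite scale0r mem0v.
  by rewrite memvZ // memv_span //; apply/fintype.imageP; exists i => //; rewrite inE; apply: (implyP (H i)).
apply: (subvP _ _ xs); apply/span_subvP => _ /fintype.imageP[i + ->].
by rewrite inE basis_in_grading.
Qed.

Lemma free_basis_sub (P : pred 'I_n) : free (image_mem (fun i : 'I_n => X`_i) (mem P)).
Proof.
have E : [seq X`_(i : 'I_n) | i <- enum 'I_n] = X.
  by rewrite -[RHS]map_tnth_enum; apply: eq_map => i; rewrite (tnth_nth 0).
apply: (catl_free (Y := [seq X`_(i : 'I_n) | i <- filter (predC P) (enum 'I_n)])).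
rewrite /image_mem enumT -map_cat (perm_free (Y := X)) ?(basis_free bX) //.
by rewrite -{2}E; apply: perm_map; rewrite enumT; apply: permEl (perm_filterC P _).
Qed.

Lemma dim_basis_sub (P : pred 'I_n) : \dim <<(image_mem (fun i : 'I_n => X`_i) (mem P))>> = #|P|.
Proof. by rewrite (eqP (free_basis_sub P)) size_image; apply: eq_card. Qed.

Lemma dim_grading j : \dim (G j) = #|[pred i | hw i == j]|.
Proof. by rewrite grading_span dim_basis_sub. Qed.


Lemma basis_heightD i j k : w k = w i + w j -> hw k = hw i + hw j.
Proof.
rewrite !vecE -lin_rootD => /(lin_root_inj DS); rewrite /basis_height => ->.
exact: shape_heightD.
Qed.

Lemma grading_sum (j : int) x : x \in G j -> x = \sum_(i | hw i == j) coord X i x *: X`_i.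
Proof.
rewrite mem_grading => /forallP H; rewrite {1}(coordXE bX x) [RHS]big_mkcond /=.
apply: eq_bigr => i _; case: ifPn => // hi.
by have := H i; rewrite implybE negbK (negPf hi) orbF => /eqP->; rewrite scale0r.
Qed.

Lemma grading_lieb (a b : int) : (liev (G a) (G b) <= G (a + b))%VS.
Proof.
apply/liev_subP => x y /grading_sum-> /grading_sum->.
rewrite lieb_suml rpred_sum // => i /eqP hi; rewrite liebZl memvZ //.
rewrite lieb_sumr rpred_sum // => j /eqP hj; rewrite liebZr memvZ //.
rewrite mem_grading; apply/forallP => k; apply/implyP => kn.
have wk := coord_lieb_root bX Xw (Xw i) kn.
by rewrite (basis_heightD wk) hi hj.
Qed.

Lemma grading_eq0 j : (forall i, hw i != j) -> G j = 0%VS.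
Proof.
move=> H; apply/eqP; rewrite -dimv_eq0 dim_grading; apply/eqP/eq_card0 => i.
by rewrite !inE (negPf (H i)).
Qed.

Lemma basis_opp i : exists i', vec i' = - vec i.
Proof.
have [x wx] : exists i', w i' = - w i.
  by apply/is_weightP; apply: (weightN gS hC DS r_gt0 bX Xw); apply/is_weightP; exists i.
by exists x; apply: (lin_root_inj DS); rewrite lin_rootN -!vecE.
Qed.

(** The generation condition for m < 0 asks for an equality in degree m - 1 <= -2, where both sides
    vanish. A root of height 1 and its opposite make the two ends nonzero. *)
Lemma kgrading1P : (exists i, hw i = 1) ->
  is_kgrading 1 G <-> forall i, `|hw i| <= 1.
Proof.
move=> [i1 hi1]; split=> [[G0 _] i|H].
  rewrite leNgt; apply/negP => hi; have /G0 Gi : (1 < `|hw i|)%N by rewrite -ltz_nat abszE.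
  by have := basis_in_grading i (hw i); rewrite eqxx Gi memv0 (negPf (X_neq0 bX i)).
have G0 (j : int) : 1 < `|j| -> G j = 0%VS.
  by move=> j1; apply: grading_eq0 => i; apply: contraTneq j1 => <-; rewrite -leNgt.
have full : (\sum_(i < 3) G (i%:Z - 1%:Z) = fullv)%VS.
  apply/eqP; rewrite eqEsubv subvf /= -(span_basis bX); apply/span_subvP => _ /(nthP 0)[k kn <-].
  rewrite size_tuple in kn; set i := Ordinal kn.
  have hm := H i; have ji : (absz (hw i + 1)%R < 3)%N by move: hm; clear; lia.
  apply: (subvP (sumv_sup (Ordinal ji) _ (subvv _))) => //=.
  rewrite (basis_in_grading i); move: hm; clear; lia.
split; [|split; [split|split; [|split; [|split]]]].
- by move=> i hi; apply: G0; rewrite -abszE ltz_nat.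
- rewrite directvEgeq /= full (eq_bigr _ (fun i _ => dim_grading _)).
  rewrite (_ : \sum_i _ = n)%N // -[RHS]card_ord -sum1_card.
  have inj (i : 'I_n) (j : 'I_3) : (inord (absz (hw i + 1)%R) == j) = (hw i == j%:Z - 1).
    have hm := H i; have ji : (absz (hw i + 1)%R < 3)%N by move: hm; clear; lia.
    by rewrite -val_eqE /= inordK //; move: hm; clear; lia.
  rewrite (partition_big (fun i => inord (absz (hw i + 1)%R) : 'I_3) xpredT) //=.
  by apply: eq_bigr => j _; rewrite -sum1_card; apply: eq_bigl => i; rewrite inj.
- exact: full.
- exact: grading_lieb.
- move=> m m0; have m1 : 1 < `|m - 1| by move: m0; clear; lia.
  rewrite (G0 _ m1); apply/eqP; rewrite -subv0 -(G0 _ m1).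
  by rewrite (addrC m); apply: grading_lieb.
- by apply/eqP => G1; have := basis_in_grading i1 1; rewrite G1 hi1 memv0 (negPf (X_neq0 bX _)).
have [i2 vi2] := basis_opp i1.
have hi2 : hw i2 = -1 by rewrite /basis_height vi2 shape_heightN -/(hw i1) hi1.
by apply/eqP => G1; have := basis_in_grading i2 (-1); rewrite G1 hi2 memv0 (negPf (X_neq0 bX _)).
Qed.

Lemma vec_neq0 i : hw i != 0 -> vec i != 0.
Proof.
apply: contra_neq => v0; rewrite /basis_height v0 /shape_height big1 // => j _.
by rewrite mxE.
Qed.

Lemma vec_weight i : is_weight w (lin_root (vec i)).
Proof. by apply/is_weightP; exists i; apply: vecE. Qed.

Lemma is_rootv_vec i : is_rootv (vec i) = (vec i != 0).
Proof. by rewrite /is_rootv vec_weight andbT. Qed.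

Lemma rootv_index v : is_rootv v -> exists i, vec i = v.
Proof.
case/andP => _ /is_weightP[i wi]; exists i; apply: (lin_root_inj DS).
by rewrite -vecE.
Qed.

Lemma vec_inj i j : vec i != 0 -> vec i = vec j -> i = j.
Proof.
rewrite -(lin_root_eq0 DS) => v0 e.
by have [+ _] := root_mult gS hC DS r_gt0 bX Xw v0; apply; rewrite vecE // -e.
Qed.

Lemma bracket_neq0 i j : vec i != 0 -> vec j != 0 -> is_rootv (vec i + vec j) ->
  lieb X`_i X`_j != 0.
Proof.
rewrite -!(lin_root_eq0 DS) => i0 j0 /andP[ij0 wij].
rewrite -(lin_root_eq0 DS) lin_rootD in ij0; rewrite lin_rootD in wij.
have nm := root_not_multiple gS hC DS r_gt0 bX Xw i0 j0 (vec_weight i) (vec_weight j) wij ij0.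
apply: (root_bracket gS hC DS r_gt0 bX Xw i0 (vec_weight i) (vec_weight j) nm wij).
- by rewrite -vecE.
- by rewrite -vecE.
- exact: X_neq0.
- exact: X_neq0.
Qed.

Lemma bracket_rootv i j : vec i + vec j != 0 -> lieb X`_i X`_j != 0 ->
  is_rootv (vec i + vec j).
Proof.
move=> ij0 ne; rewrite /is_rootv ij0 lin_rootD -!vecE.
exact: (root_space_weight bX Xw (root_space_lieb (Xw i) (Xw j)) ne).
Qed.
End Grading.

(** * Monge type and stars *)

Section MongeStar.
Variables (K : numClosedFieldType) (g : lieAlgType K) (h : {vspace g}).
Variables (r : nat) (D : r.-tuple (dualv K h)).
Hypothesis (gS : simple_lie g) (hC : cartan_subalgebra h) (DS : simple_roots D).
Hypothesis (r_gt0 : (0 < r)%N).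
Local Notation n := (\dim {:g}).
Variables (X : n.-tuple g) (w : 'I_n -> dualv K h).
Hypothesis (bX : basis_of fullv X) (Xw : forall i : 'I_n, X`_i \in root_space (w i)).
Implicit Types (u v : 'rV[int]_r).

Local Notation lin_root := (lin_root D).
Local Notation is_rootv := (is_rootv D w).
Variable vec : 'I_n -> 'rV[int]_r.
Hypothesis vecE : forall i, w i = lin_root (vec i).
Variable S : {set 'I_r}.
Local Notation G := (parabolic_grading D S).

Local Notation hw := (basis_height vec S).
Variable A : 'I_r -> 'I_r -> int.
Hypothesis RS : root_system A is_rootv.
Hypothesis dim1 : (2 < \dim (G (-1)))%N.

Local Notation C1 := [pred i | hw i == -1].
Local Notation C2 := [pred i | hw i == -2].
Local Notation dimG := (dim_grading hC DS bX Xw vecE S).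
Local Notation inG := (basis_in_grading hC DS bX Xw vecE S).

Lemma vec1_neq0 i : i \in C1 -> vec i != 0.
Proof. by rewrite inE => /eqP hi; apply: (vec_neq0 (S := S)); rewrite hi. Qed.

Lemma card_C1 : (2 < #|C1|)%N.
Proof. by rewrite -(dimG (-1)). Qed.

(** Stars are roots of height 1, while the Monge condition concerns degree -1; negation translates
    between them. *)
Lemma height1_opp i : (i \in C1) = height1_root is_rootv S (- vec i).
Proof.
rewrite inE /height1_root shape_heightN -/(hw i) -(inj_eq oppr_inj) opprK.
case: (boolP (- hw i == 1)) => hi; rewrite ?andbF // andbT; apply/esym.
apply: (rs_opp RS); rewrite (is_rootv_vec vecE); apply: (vec_neq0 (S := S)).
by apply: contraTneq hi => ->; rewrite oppr0.
Qed.

Lemma height1_index v : height1_root is_rootv S v -> exists2 i, i \in C1 & vec i = - v.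
Proof.
move=> Bv; have [Pv _] := andP Bv; have [i vi] := rootv_index DS vecE (rs_opp RS Pv).
by exists i => //; rewrite height1_opp vi opprK.
Qed.

Lemma height2_decomp k : k \in C2 -> exists i j, [/\ i \in C1, j \in C1 & vec k = vec i + vec j].
Proof.
rewrite inE => /eqP hk.
have Pk : is_rootv (- vec k).
  by apply: (rs_opp RS); rewrite (is_rootv_vec vecE); apply: (vec_neq0 (S := S)); rewrite hk.
have hk' : shape_height S (- vec k) = 2 by rewrite shape_heightN -/(hw k) hk.
have k0 : vge0 (- vec k) by apply: (rs_height_ge0 RS (S := S)) => //; rewrite hk'.
have [u [x [Pu Px hu hx E]]] := height2_split RS Pk k0 hk'.
have [|i iC ui] := @height1_index u; first by rewrite /height1_root Pu hu eqxx.
have [|j jC xj] := @height1_index x; first by rewrite /height1_root Px hx eqxx.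
by exists i, j; split; rewrite // ui xj -opprD -E opprK.
Qed.

Lemma root_in_C2 i j : i \in C1 -> j \in C1 -> is_rootv (vec i + vec j) ->
  exists2 k, k \in C2 & vec k = vec i + vec j.
Proof.
rewrite !inE => /eqP hi /eqP hj /(rootv_index DS vecE)[k vk]; exists k => //.
by rewrite inE /basis_height vk shape_heightD -/(hw i) -/(hw j) hi hj.
Qed.

Lemma vec_sum_neq0 i j : i \in C1 -> j \in C1 -> vec i + vec j != 0.
Proof.
rewrite !inE => /eqP hi /eqP hj; apply/eqP => /(congr1 (shape_height S)).
rewrite shape_heightD -/(hw i) -/(hw j) hi hj /shape_height big1 // => k _.
by rewrite mxE.
Qed.

Lemma basis_of_bracket i j k : vec k = vec i + vec j -> vec k != 0 -> vec i != 0 -> vec j != 0 ->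
  exists c, X`_k = c *: lieb X`_i X`_j.
Proof.
move=> kE k0 i0 j0.
have ne : lieb X`_i X`_j != 0.
  by apply: (bracket_neq0 gS hC DS r_gt0 bX Xw vecE) => //; rewrite -kE (is_rootv_vec vecE).
have wk : w i + w j = w k by rewrite !vecE kE lin_rootD.
have mem : lieb X`_i X`_j \in root_space (w k) by rewrite -wk; apply: root_space_lieb.
have wk0 : w k != 0 by rewrite vecE (lin_root_eq0 DS).
have := root_space_dim1 gS hC DS r_gt0 bX Xw wk0 mem.
set c := coord X k _ => e; exists c^-1; rewrite e scalerA mulVf ?scale1r //.
by apply: contra_neq ne => c0; rewrite e c0 scale0r.
Qed.

Section FromMonge.
Variable y : {vspace g}.
Hypotheses (yG : (y <= G (-1))%VS) (yy : liev y y = 0%VS).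
Hypotheses (dG1 : \dim (G (-1)) = (\dim y).+1) (dG2 : \dim (G (-2)) = \dim y).

Lemma lieb_y a b : a \in y -> b \in y -> lieb a b = 0.
Proof. by move=> ay yb; apply/eqP; rewrite -memv0 -yy lieb_liev. Qed.

Section OutsideVector.
Variable i0 : 'I_n.
Hypotheses (i0C : i0 \in C1) (i0y : X`_i0 \notin y).

Lemma outside_split x : x \in G (-1) -> exists c, exists2 z, z \in y & x = c *: X`_i0 + z.
Proof.
have -> : G (-1) = (<[X`_i0]> + y)%VS.
  apply/eqP; rewrite eq_sym eqEdim subv_add yG andbT -memvE inG (eqP i0C) eqxx /= dG1.
  rewrite ltn_neqAle dimvS ?addvSr // andbT (dimv_leqif_eq (addvSr _ _)).
  apply: contraNneq i0y => E; rewrite E; apply: (subvP (addvSl _ _)); exact: memv_line.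
by case/memv_addP => _ /vlineP[c ->] [z zy ->]; exists c, z.
Qed.

(* ad X_i0 maps y onto G (-2), which has the same dimension. *)
Lemma outside_inj z : z \in y -> lieb X`_i0 z = 0 -> z = 0.
Proof.
have sub : (G (-2) <= ad X`_i0 @: y)%VS.
  rewrite (grading_span hC DS bX Xw vecE); apply/span_subvP => _ /fintype.imageP[k kC ->].
  have [i [j [iC jC kE]]] := height2_decomp kC.
  have k0 : vec k != 0 by rewrite kE vec_sum_neq0.
  have [c ->] := basis_of_bracket kE k0 (vec1_neq0 iC) (vec1_neq0 jC).
  rewrite memvZ //.
  have [|a [p py ->]] := @outside_split X`_i; first by rewrite inG.
  have [|b [q qy ->]] := @outside_split X`_j; first by rewrite inG.
  rewrite liebDl !liebDr !liebZl !liebZr liebxx !scaler0 add0r (lieb_y py qy) addr0.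
  rewrite (liebC p) scalerN -liebZr -[b *: _]liebZr -liebBr -adE memv_img //.
  by rewrite memvB // memvZ.
have dims := limg_ker_dim (ad X`_i0) y.
have le := dimvS sub; rewrite dG2 in le.
have ker0 : (y :&: lker (ad X`_i0) = 0)%VS.
  by apply/eqP; rewrite -dimv_eq0; move: dims le; clear; lia.
by move=> zy z0; apply/eqP; rewrite -memv0 -ker0 memv_cap zy memv_ker adE z0 eqxx.
Qed.

(** If the two root vectors commuted, the part of [X_j] in [y] would be annihilated by [X_i0], hence
    be zero, and two basis vectors would be proportional. *)
Lemma outside_star j : j \in C1 -> j != i0 -> is_rootv (vec j + vec i0).
Proof.
move=> jC ji; have [|c [z zy Ez]] := @outside_split X`_j; first by rewrite inG.
rewrite addrC; apply: (bracket_rootv bX Xw vecE); first exact: vec_sum_neq0.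
apply/eqP => b0; have z0 : z = 0.
  by apply: outside_inj => //; move: b0; rewrite Ez liebDr liebZr liebxx scaler0 add0r.
have := congr1 (coord X j) Ez; rewrite z0 addr0 linearZ /= !(coordX bX) eqxx.
by rewrite [i0 == j]eq_sym (negPf ji) mulr0 => /eqP; rewrite oner_eq0.
Qed.

Lemma card_C2 : #|C2| = #|C1|.-1.
Proof. by rewrite -(dimG (-1)) -(dimG (-2)) dG1 dG2. Qed.

(* Compared for two root vectors outside y, this identity forces them to
   coincide. *)
Lemma outside_sum : \sum_(k in C2) vec k = vec i0 *+ #|C1|.-2 + \sum_(k in C1) vec k.
Proof.
have /choice[f fE] : forall j, exists k, j \in C1 -> j != i0 -> k \in C2 /\ vec k = vec j + vec i0.
  move=> j; have [jC|jC] := boolP (j \in C1); last by exists j.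
  have [->|ji] := eqVneq j i0; first by exists i0.
  by have [k kC kE] := root_in_C2 jC i0C (outside_star jC ji); exists k.
pose C := [set j in C1 | j != i0].
have CP j : j \in C -> j \in C1 /\ j != i0 by rewrite !inE => /andP.
have f_inj : {in C &, injective f}.
  move=> j k /CP[jC ji] /CP[kC ki] e.
  have [_ ej] := fE j jC ji; have [_ ek] := fE k kC ki.
  apply: (vec_inj gS hC DS r_gt0 bX Xw vecE (vec1_neq0 jC)).
  by apply: (addIr (vec i0)); rewrite -ej -ek e.
have cC : #|C| = #|C1|.-1.
  rewrite [in RHS](cardD1 i0) i0C /= cardsE; apply: eq_card => j.
  by rewrite !inE andbC.
(* Injectivity together with the count of degree -2 makes [f] an enumeration of [C2]. *)
have im : f @: C = [set k in C2].
  apply/eqP; rewrite eqEcard card_in_imset // cC cardsE card_C2 leqnn andbT.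
  by apply/fintype.subsetP => _ /imsetP[j /CP[jC ji] ->]; rewrite inE; have [] := fE j jC ji.
rewrite (eq_bigl [in f @: C]) => [|k]; last by rewrite im !inE.
rewrite big_imset //= (eq_bigr (fun j => vec j + vec i0)) => [|j /CP[jC ji]]; last first.
  by have [] := fE j jC ji.
(* One of the [#|C1|.-1] copies of [vec i0] completes the sum over [C1], leaving [#|C1|.-2] of
   them. *)
rewrite big_split /= sumr_const cC addrC [in RHS](bigD1 i0) //= addrA.
congr (_ + _); last by apply: eq_bigl => j; rewrite !inE.
rewrite -mulrSr; congr (_ *+ _).
by move: card_C1; clear; lia.
Qed.
End OutsideVector.

Lemma outside_unique i0 i1 : i0 \in C1 -> i1 \in C1 -> X`_i0 \notin y -> X`_i1 \notin y -> i0 = i1.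
Proof.
move=> i0C i1C i0y i1y; have := outside_sum i0C i0y; rewrite (outside_sum i1C i1y).
move/addIr => e; apply: (vec_inj gS hC DS r_gt0 bX Xw vecE (vec1_neq0 i0C)).
apply/rowP => k; have := congr1 (fun v : 'rV[int]_r => v 0 k) e; rewrite !mulmxnE.
rewrite -(mulr_natr (vec i0 0 k)) -(mulr_natr (vec i1 0 k)) => /esym; apply: mulIf.
(* The factor [#|C1|.-2] can be cancelled because degree -1 has dimension greater than 2. *)
by rewrite pnatr_eq0; move: card_C1; clear; lia.
Qed.

Lemma monge_star_aux : exists z, star is_rootv S z.
Proof.
have [i0 i0C i0y] : exists2 i0, i0 \in C1 & X`_i0 \notin y.
  apply: contrapT => H; have : (G (-1) <= y)%VS.
    rewrite (grading_span hC DS bX Xw vecE); apply/span_subvP => _ /fintype.imageP[k kC ->].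
    by apply: contraT => ky; case: H; exists k.
  by move/dimvS; rewrite dG1 ltnn.
exists (- vec i0); split.
- by rewrite -height1_opp.
- move=> v Bv vz; have [j jC vj] := height1_index Bv.
  rewrite -[v]opprK -vj -opprD; apply: (rs_opp RS); apply: outside_star => //.
  by apply: contra_neq vz => ji; rewrite -ji vj opprK.
move=> u v Bu Bv uz vz; apply/negP => Puv.
have [j jC uj] := height1_index Bu; have [k kC vk] := height1_index Bv.
have iny i : i \in C1 -> - vec i0 != - vec i -> X`_i \in y.
  move=> iC ne; apply: contraT => iy; move: ne.
  by rewrite (outside_unique i0C iC i0y iy) eqxx.
have := rs_opp RS Puv; rewrite opprD -uj -vk => P'.
have := bracket_neq0 gS hC DS r_gt0 bX Xw vecE (vec1_neq0 jC) (vec1_neq0 kC) P'.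
by rewrite lieb_y ?eqxx // iny // ?uj ?vk ?opprK eq_sym.
Qed.
End FromMonge.

Lemma monge_star : monge_type G -> exists z, star is_rootv S z.
Proof. by case=> y [_ yG yy d1 d2]; apply: (monge_star_aux yG yy d1 d2). Qed.

Lemma star_others z : star is_rootv S z -> exists u v,
  [/\ height1_root is_rootv S u, height1_root is_rootv S v, u != z, v != z & u != v].
Proof.
case=> Bz _ _; have [i0 i0C vi0] := height1_index Bz.
have : (1 < #|[predD1 C1 & i0]|)%N.
  by move: card_C1; rewrite (cardD1 i0) i0C.
case/card_gt1P => j [k []]; rewrite [j \in _]inE [k \in _]inE => /andP[ji jC] /andP[ki kC] jk.
have ne i i' : i \in C1 -> i != i' -> - vec i != - vec i'.
  move=> iC; apply: contra_neq => /oppr_inj.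
  exact: (vec_inj gS hC DS r_gt0 bX Xw vecE (vec1_neq0 iC)).
exists (- vec j), (- vec k); rewrite -!height1_opp; split=> //.
- by rewrite -[z]opprK -vi0 ne.
- by rewrite -[z]opprK -vi0 ne.
- exact: ne.
Qed.

(** The abelian subalgebra is spanned by the root vectors of degree -1 other than that of [- z].
    Adding [vec i0] matches its basis with degree -2: when a root of height two is a sum of two of
    height one, exactly one of them is [z], as twice a root is not a root and two others do not add
    up to one. *)
Lemma star_monge z : star is_rootv S z -> monge_type G.
Proof.
case=> Bz S1 S2; have [i0 i0C vi0] := height1_index Bz.
pose C := [pred j in C1 | j != i0].
have CP j : j \in C -> j \in C1 /\ j != i0 by rewrite !inE => /andP.
have cC : #|C1| = #|C|.+1.
  by rewrite (cardD1 i0) i0C add1n; congr _.+1; apply: eq_card => j; rewrite !inE andbC.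
have nez j : j \in C -> - vec j != z.
  case/CP => jC; apply: contra_neq => jz.
  by apply: (vec_inj gS hC DS r_gt0 bX Xw vecE (vec1_neq0 jC)); rewrite vi0 -jz opprK.
exists <<image_mem (fun i : 'I_n => X`_i) (mem C)>>%VS.
have dy := dim_basis_sub bX C.
have dC : \dim (G (-1)) = #|C|.+1 by rewrite dimG cC.
split.
- by rewrite -dimv_eq0 dy -lt0n -ltnS -dC (ltn_trans _ dim1).
- by apply/span_subvP => _ /fintype.imageP[k /CP[kC _] ->]; rewrite inG.
- apply/eqP; rewrite -subv0; apply/liev_span => _ _ /fintype.imageP[j jC ->] /fintype.imageP[k kC ->].
  have [jC1 _] := CP j jC; have [kC1 _] := CP k kC.
  rewrite memv0; apply: contraT => ne.
  have := rs_opp RS (bracket_rootv bX Xw vecE (vec_sum_neq0 jC1 kC1) ne).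
  by rewrite opprD (negPf (S2 _ _ _ _ (nez _ jC) (nez _ kC))) // -height1_opp.
- by rewrite dC dy.
rewrite dy dimG.
have /choice[f fE] : forall j, exists k, j \in C -> k \in C2 /\ vec k = vec j + vec i0.
  move=> j; have [jC|jC] := boolP (j \in C); last by exists j.
  have [jC1 ji] := CP j jC.
  have P' : is_rootv (vec j + vec i0).
    rewrite vi0 -[vec j]opprK -opprD; apply: (rs_opp RS); apply: S1 (nez _ jC).
    by rewrite -height1_opp.
  by have [k kC kE] := root_in_C2 jC1 i0C P'; exists k.
have f_inj : {in C &, injective f}.
  move=> j k jC kC e; have [_ ej] := fE j jC; have [_ ek] := fE k kC.
  apply: (vec_inj gS hC DS r_gt0 bX Xw vecE (vec1_neq0 (proj1 (CP j jC)))).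
  by apply: (addIr (vec i0)); rewrite -ej -ek e.
rewrite -(card_in_image f_inj); apply: eq_card => k; apply/idP/fintype.imageP => [kC|[j jC ->]]; last first.
  by have [] := fE j jC.
have [i [j [iC jC kE]]] := height2_decomp kC.
have Pk : is_rootv (- vec i + - vec j).
  rewrite -opprD -kE; apply: (rs_opp RS); rewrite (is_rootv_vec vecE) kE.
  exact: vec_sum_neq0.
have fk l : l \in C -> vec k = vec l + vec i0 -> k = f l.
  move=> lC e; have [flC fl] := fE l lC.
  apply: (vec_inj gS hC DS r_gt0 bX Xw vecE); last by rewrite fl.
  by rewrite kE vec_sum_neq0.
have [ii|ii] := eqVneq i i0; have [ji|ji] := eqVneq j i0.
- by move: Pk; rewrite ii ji vi0 opprK (negPf (rs_double RS (proj1 (andP Bz)))).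
- by exists j; [rewrite !inE ji andbT|apply: fk; rewrite ?inE ?ji ?andbT // kE ii addrC].
- by exists i; [rewrite !inE ii andbT|apply: fk; rewrite ?inE ?ii ?andbT // kE ji].
have [iC' jC'] : i \in C /\ j \in C by rewrite !inE ii ji !andbT.
by move: Pk; rewrite (negPf (S2 _ _ _ _ (nez _ iC') (nez _ jC'))) // -height1_opp.
Qed.
End MongeStar.

(** * The subalgebra of a component of the Dynkin diagram *)

Section SubLie.
Variables (K : fieldType) (g : lieAlgType K) (U : {vspace g}).
Hypothesis UU : (liev U U <= U)%VS.

Definition sub_lieb (x y : subvs_of U) : subvs_of U := vsproj U (lieb (vsval x) (vsval y)).

Lemma sub_liebE x y : vsval (sub_lieb x y) = lieb (vsval x) (vsval y).
Proof. by rewrite vsprojK //; apply: (elimT (liev_subP _ _ _) UU); apply: subvsP. Qed.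

Fact sub_lieb_linearl y : linear (sub_lieb^~ y).
Proof.
by move=> a x z; apply: subvs_inj; rewrite [RHS]linearP /= !sub_liebE linearP /= liebDl liebZl.
Qed.
Fact sub_lieb_linearr x : linear (sub_lieb x).
Proof.
by move=> a y z; apply: subvs_inj; rewrite [RHS]linearP /= !sub_liebE [vsval (_ + _)]linearP /= liebDr liebZr.
Qed.
Fact sub_liebxx x : sub_lieb x x = 0.
Proof. by apply: subvs_inj; rewrite sub_liebE liebxx linear0. Qed.
Fact sub_lieb_jacobi x y z :
  sub_lieb x (sub_lieb y z) + sub_lieb y (sub_lieb z x) + sub_lieb z (sub_lieb x y) = 0.
Proof. by apply: subvs_inj; rewrite !linearD /= !sub_liebE; apply: lieb_jacobi. Qed.

(* The argument only makes the closure under brackets available to the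
   inference of the Lie structure. *)
Definition sublie of (liev U U <= U)%VS := subvs_of U.
Local Notation L := (sublie UU).

HB.instance Definition _ := Vector.on L.
HB.instance Definition _ := Vector_isLie.Build K L
  sub_lieb_linearl sub_lieb_linearr sub_liebxx sub_lieb_jacobi.

Definition sublie_val (x : L) : g := vsval x.
Lemma sublie_val_linear : linear sublie_val. Proof. by []. Qed.
HB.instance Definition _ := GRing.isSemilinear.Build K L g _ sublie_val
  (GRing.semilinear_linear sublie_val_linear).

Lemma sublie_val_inj : injective sublie_val. Proof. exact: val_inj. Qed.
Lemma sublie_valP x : sublie_val x \in U. Proof. exact: subvsP. Qed.
Lemma sublie_val_lieb (x y : L) : sublie_val (lieb x y) = lieb (sublie_val x) (sublie_val y).
Proof. exact: sub_liebE. Qed.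
Lemma sublie_lift u : u \in U -> exists x : L, sublie_val x = u.
Proof. by move=> uU; exists (vsproj U u); apply: vsprojK. Qed.

Definition sublie_incl : 'Hom(L, g) := linfun sublie_val.
Lemma sublie_inclE x : sublie_incl x = sublie_val x. Proof. exact: lfunE. Qed.
End SubLie.

(** * Brackets and ideals of the subalgebra attached to a set of nodes *)

Section ComponentSubalgebra.
Variables (K : numClosedFieldType) (g : lieAlgType K) (h : {vspace g}).
Variables (r : nat) (D : r.-tuple (dualv K h)).
Hypothesis (gS : simple_lie g) (hC : cartan_subalgebra h) (DS : simple_roots D).
Hypothesis (r_gt0 : (0 < r)%N).
Local Notation n := (\dim {:g}).
Variables (X : n.-tuple g) (w : 'I_n -> dualv K h).
Hypothesis (bX : basis_of fullv X) (Xw : forall i : 'I_n, X`_i \in root_space (w i)).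

Local Notation t := coroot_dual.

Local Notation lin_root := (lin_root D).
Local Notation is_rootv := (is_rootv D w).
Variable vec : 'I_n -> 'rV[int]_r.
Hypothesis vecE : forall i, w i = lin_root (vec i).
Variable A : 'I_r -> 'I_r -> int.
Hypothesis AE : forall i j,
  2 * weval (tnth D i) (t (tnth D j)) = weval (tnth D j) (t (tnth D j)) * (A i j)%:~R.
Let RS : root_system A is_rootv := lie_root_system gS hC DS r_gt0 bX Xw AE.
Variable Y : {set 'I_r}.

Local Notation kE := (coroot_dualE gS hC DS r_gt0 bX Xw).

Definition supp_in (v : 'rV[int]_r) := [forall j, (j \notin Y) ==> (v 0 j == 0)].
Lemma supp_inP (v : 'rV[int]_r) : reflect (forall j, j \notin Y -> v 0 j = 0) (supp_in v).
Proof.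
by apply: (iffP forallP) => H j; [move=> jY; apply/eqP/(implyP (H j))|apply/implyP => /H ->].
Qed.

Lemma supp_inD u v : supp_in u -> supp_in v -> supp_in (u + v).
Proof. by move=> /supp_inP uY /supp_inP vY; apply/supp_inP => j jY; rewrite mxE uY ?vY ?addr0. Qed.
Lemma supp_inN v : supp_in v -> supp_in (- v).
Proof. by move=> /supp_inP vY; apply/supp_inP => j jY; rewrite mxE vY ?oppr0. Qed.
Lemma supp_in_e j : j \in Y -> supp_in 'e_j.
Proof.
by move=> jY; apply/supp_inP => k kY; rewrite e_E; case: eqP jY kY => [-> ->|].
Qed.

Definition comp_index i := (vec i != 0) && supp_in (vec i).
(** Only the t_j of the nodes in [Y] are taken: together with the root vectors supported in [Y] they
    span the derived algebra of the corresponding Levi subalgebra. *)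
Definition comp_cartan : {vspace g} := (\sum_(j in Y) <[t (tnth D j)]>)%VS.
Definition comp_roots : {vspace g} := (\sum_(i | comp_index i) <[X`_i]>)%VS.
Definition comp_alg : {vspace g} := (comp_cartan + comp_roots)%VS.
Local Notation RI := comp_index.
Local Notation hY := comp_cartan.
Local Notation U := comp_alg.

Lemma coroot_in_cartan j : j \in Y -> t (tnth D j) \in hY.
Proof. by move=> jY; apply: (subvP (sumv_sup j jY (subvv _))); apply: memv_line. Qed.
Lemma coroot_in_alg j : j \in Y -> t (tnth D j) \in U.
Proof. by move=> jY; apply: (subvP (addvSl _ _)); apply: coroot_in_cartan. Qed.
Lemma cartan_in_alg u : u \in hY -> u \in U.
Proof. exact: (subvP (addvSl _ _)). Qed.
Lemma root_in_roots (i : 'I_n) : RI i -> X`_i \in comp_roots.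
Proof. by move=> iR; apply: (subvP (sumv_sup i iR (subvv _))); apply: memv_line. Qed.
Lemma root_in_alg (i : 'I_n) : RI i -> X`_i \in U.
Proof. by move=> iR; apply: (subvP (addvSr _ _)); apply: root_in_roots. Qed.

Lemma comp_cartan_sub u : u \in hY -> u \in h.
Proof.
apply: subvP; apply/subv_sumP => j _; rewrite -memvE; exact: coroot_dual_h.
Qed.

Lemma comp_cartanP u : u \in hY -> exists c : 'I_r -> K, u = \sum_(j in Y) c j *: t (tnth D j).
Proof.
case/memv_sumP => z zl ->.
have /choice[c cE] : forall j, exists a, j \in Y -> z j = a *: t (tnth D j).
  move=> j; case: (boolP (j \in Y)) => jY; last by exists 0.
  by have /vlineP[a ->] := zl j jY; exists a.
by exists c; apply: eq_bigr => j jY; rewrite cE.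
Qed.

Lemma coord_h u i : u \in h -> w i != 0 -> coord X i u = 0.
Proof.
move=> uh wi; apply/eqP; apply: contraNT wi => ne; apply/eqP.
by apply: (coord_root_space bX Xw _ ne); rewrite (root_space0 hC DS).
Qed.

Lemma comp_weight_neq0 i : RI i -> w i != 0.
Proof. by case/andP => vi _; rewrite vecE (lin_root_eq0 DS). Qed.

Lemma comp_algP x : x \in U -> exists2 u, u \in hY & x = u + \sum_(i | RI i) coord X i x *: X`_i.
Proof.
case/memv_addP => u uh [v vR xE]; exists u => //; rewrite {1}xE; congr (_ + _).
case/memv_sumP: vR => z zl vE; rewrite vE; apply: eq_bigr => i iR.
have -> : coord X i x = coord X i v.
  by rewrite xE linearD /= coord_h ?add0r ?comp_cartan_sub ?comp_weight_neq0.
have /vlineP[a za] := zl i iR; rewrite za vE linear_sum (bigD1 i) //= za linearZ /=.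
rewrite (coordX bX) eqxx mulr1 big1 ?addr0 // => j /andP[jR ji].
have /vlineP[a' ->] := zl j jR.
by rewrite linearZ /= (coordX bX) (negPf ji) mulr0.
Qed.

(* Pairing x with its conjugate in the basis of coroots, on which the weights
   take real values, gives a sum of squared norms. *)
Lemma coroot_conj0 (c : 'I_r -> K) : let x := \sum_j c j *: t (tnth D j) in
  killing x (\sum_j (c j)^* *: t (tnth D j)) = 0 -> x = 0.
Proof.
move=> x; set xc := \sum_j _.
have xh : x \in h by apply: rpred_sum => j _; rewrite memvZ // coroot_dual_h.
have xch : xc \in h by apply: rpred_sum => j _; rewrite memvZ // coroot_dual_h.
have wc i : weval (w i) xc = (weval (w i) x)^*.
  rewrite /weval !linear_sum rmorph_sum; apply: eq_bigr => j _; rewrite !linearZ /= rmorphM.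
  congr (_ * _); apply/esym/CrealP.
  exact: (weval_real gS hC DS r_gt0 bX Xw i (simple_root_neq0 DS j) (is_weight_simple DS bX Xw j)).
rewrite (killing_weights bX Xw) // (eq_bigr (fun i => `|weval (w i) x| ^+ 2)) => [|i _]; last first.
  by rewrite wc normCK.
move/psumr_eq0P => H; apply: (dual_sep DS xh) => k.
have /is_weightP[i <-] := is_weight_simple DS bX Xw k.
by apply/eqP; rewrite -normr_eq0 -sqrf_eq0 H // => l _; rewrite exprn_ge0.
Qed.

Lemma sum_inY (c : 'I_r -> K) :
  \sum_(j in Y) c j *: t (tnth D j) = \sum_j (if j \in Y then c j else 0) *: t (tnth D j).
Proof. by rewrite big_mkcond; apply: eq_bigr => j _; case: ifP; rewrite ?scale0r. Qed.

(** If the simple roots of [Y] vanish at [u], then [u] is orthogonal to every t_j with [j] in [Y],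
    hence to its own conjugate, which is a combination of these. *)
Lemma comp_cartan_sep u : u \in hY -> (forall j, j \in Y -> weval (tnth D j) u = 0) -> u = 0.
Proof.
move=> uY Du; have uh := comp_cartan_sub uY; have [c uE] := comp_cartanP uY.
rewrite uE sum_inY; apply: coroot_conj0.
rewrite -sum_inY -uE (linear_sum (killing u : g -> K^o)) /=; apply: big1 => j _.
rewrite killingZr killing_sym kE //; case: ifPn => jY; last by rewrite conjC0 mul0r.
by rewrite Du ?mulr0.
Qed.

Lemma coroot_lin_root v : t (lin_root v) = \sum_j (v 0 j)%:~R *: t (tnth D j).
Proof.
apply/eqP; rewrite -subr_eq0; apply/eqP; apply: (killing_h_nondeg gS hC DS r_gt0 bX Xw).
  rewrite memvB ?coroot_dual_h //; apply: rpred_sum => j _; rewrite memvZ // coroot_dual_h //.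
move=> u uh; rewrite killingDl -scaleN1r killingZl kE // weval_lin_root.
rewrite [X in _ + -1 * X]killing_sym (linear_sum (killing u : g -> K^o)) /=.
rewrite mulN1r -sumrB big1 // => j _.
by rewrite killingZr killing_sym kE // subrr.
Qed.

Lemma coroot_comp v : supp_in v -> t (lin_root v) \in hY.
Proof.
move=> /supp_inP vY; rewrite coroot_lin_root; apply: rpred_sum => j _.
have [jY|jY] := boolP (j \in Y); first by rewrite memvZ // coroot_in_cartan.
by rewrite vY // scale0r mem0v.
Qed.

(** The dual vector t of [lin_root v] lies in the span of the t_j with [j] in [Y], and by symmetry
    of the form its values under the simple roots are those of [lin_root v] at the t_j. *)
Lemma comp_root_sep v : supp_in v -> v != 0 ->
  exists2 j, j \in Y & weval (lin_root v) (t (tnth D j)) != 0.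
Proof.
move=> vY v0; apply: contrapT => H; move/eqP: v0; apply.
have T0 : t (lin_root v) = 0.
  apply: comp_cartan_sep; first exact: coroot_comp.
  move=> j jY; rewrite -kE ?coroot_dual_h // killing_sym kE ?coroot_dual_h //.
  by apply: contrapT => ne; apply: H; exists j => //; apply/eqP.
apply/eqP; rewrite -(lin_root_eq0 DS); apply/eqP/weval_inj => u uh.
by rewrite weval0l -kE // T0; have := killingZl 0 0 u; rewrite scaler0 mul0r.
Qed.

Lemma comp_alg_lie : (liev U U <= U)%VS.
Proof.
have hX j (i : 'I_n) : j \in Y -> RI i -> lieb (t (tnth D j)) X`_i \in U.
  by move=> jY iR; rewrite (lieb_hX Xw _ (coroot_dual_h _)) memvZ // root_in_alg.
have XX (i k : 'I_n) : RI i -> RI k -> lieb X`_i X`_k \in U.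
  move=> iR kR; have [i0 iY] := andP iR; have [k0 kY] := andP kR.
  have [e|ik0] := eqVneq (vec i + vec k) 0.
    have wk : w k = - w i by apply/eqP; rewrite -addr_eq0 addrC !vecE -lin_rootD e (lin_root0 D).
    have Xk : X`_k \in root_space (- w i) by rewrite -wk.
    rewrite (lieb_coroot gS hC DS r_gt0 bX Xw (Xw i) Xk) memvZ // cartan_in_alg // vecE.
    exact: coroot_comp.
  have [->|ne] := eqVneq (lieb X`_i X`_k) 0; first exact: mem0v.
  have [m vm] := rootv_index DS vecE (bracket_rootv bX Xw vecE ik0 ne).
  have mR : RI m by rewrite /comp_index vm ik0 supp_inD.
  have Xm : lieb X`_i X`_k \in root_space (w m).
    by rewrite vecE vm lin_rootD -!vecE; apply: root_space_lieb.
  rewrite (root_space_dim1 gS hC DS r_gt0 bX Xw (comp_weight_neq0 mR) Xm) memvZ //.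
  exact: root_in_alg.
apply/liev_subP => x y /comp_algP[u /comp_cartanP[c ->] ->] /comp_algP[v /comp_cartanP[d ->] ->].
rewrite liebDl !liebDr !lieb_suml; apply: memvD; apply: memvD; apply: rpred_sum => i iY;
  rewrite liebZl memvZ // lieb_sumr; apply: rpred_sum => j jY; rewrite liebZr memvZ //.
- by rewrite (cartan_abelian hC DS) ?mem0v ?coroot_dual_h.
- exact: hX.
- by rewrite liebC memvN hX.
exact: XX.
Qed.

Lemma comp_opp (i : 'I_n) : RI i -> exists2 i' : 'I_n, RI i' & killing X`_i X`_i' != 0 /\ w i' = - w i.
Proof.
case/andP => i0 iY; have [k [wk kk]] := killing_pair gS hC DS r_gt0 bX Xw (Xw i) (X_neq0 bX i).
exists k => //; have vk : vec k = - vec i.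
  by apply: (lin_root_inj DS); rewrite lin_rootN -!vecE.
by rewrite /comp_index vk oppr_eq0 i0 supp_inN.
Qed.

Lemma coord_hlieb u x i : u \in h -> coord X i (lieb u x) = weval (w i) u * coord X i x.
Proof.
move=> uh; rewrite {1}(coordXE bX x) lieb_sumr linear_sum (bigD1 i) //= liebZr.
rewrite (lieb_hX Xw _ uh) !linearZ /= (coordX bX) eqxx mulr1 mulrC big1 ?addr0 // => j ji.
by rewrite liebZr (lieb_hX Xw _ uh) !linearZ /= (coordX bX) (negPf ji) !mulr0.
Qed.

Lemma simple_index j : exists2 i, vec i = 'e_j & w i = tnth D j.
Proof.
have [i vi] := rootv_index DS vecE (rs_simple RS j); exists i => //.
by rewrite vecE vi -['e_j]scale1r lin_root_e mulr1z.
Qed.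

Section Ideal.
Variable I : {vspace g}.
Hypothesis IU : (I <= U)%VS.
Hypothesis Iid : forall x y, x \in U -> y \in I -> lieb x y \in I.

(** As for eigenvectors with distinct eigenvalues: while a second root component [k] is present,
    [lieb u x - weval (w k) u *: x] has fewer components, for some t_j separating the two weights.
    Once [i] is alone, one more bracket removes the Cartan part. *)
Lemma ideal_root_component x (i : 'I_n) : x \in I -> RI i -> coord X i x != 0 -> X`_i \in I.
Proof.
move=> + iR; have [m] := ubnP #|[pred k | RI k && (coord X k x != 0)]|.
elim: m x => // m IH x; rewrite ltnS => xm xI xi.
case: (pickP [pred k | [&& k != i, RI k & coord X k x != 0]]) => [k /and3P[ki kR xk]|none].
  have [[i0 iY] [k0 kY]] := (andP iR, andP kR).
  have ik0 : vec i - vec k != 0.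
    rewrite subr_eq0; apply: contra_neq ki => e; apply/esym.
    exact: (vec_inj gS hC DS r_gt0 bX Xw vecE i0 e).
  have [j jY] := comp_root_sep (supp_inD iY (supp_inN kY)) ik0.
  set u := t (tnth D j); have uh : u \in h := coroot_dual_h _.
  rewrite lin_rootD lin_rootN -!vecE wevalDl wevalNl => dj.
  pose x' := lieb u x - weval (w k) u *: x.
  have x'E l : coord X l x' = (weval (w l) u - weval (w k) u) * coord X l x.
    by rewrite linearB linearZ /= coord_hlieb // mulrBl.
  apply: (IH x'); last by rewrite x'E mulf_neq0.
    apply: leq_trans xm; apply: proper_card; apply/fintype.properP; split.
      apply/fintype.subsetP => l; rewrite !inE x'E => /andP[->] /=.
      by apply: contraNneq => ->; rewrite mulr0.
    by exists k; rewrite !inE ?kR ?xk // x'E subrr mul0r eqxx andbF.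
  by rewrite memvB ?memvZ // Iid // coroot_in_alg.
have [i0 iY] := andP iR; have [j jY dj] := comp_root_sep iY i0.
set u := t (tnth D j) in dj *; have uh : u \in h := coroot_dual_h _.
have [u0 u0Y xE] := comp_algP (subvP IU _ xI).
have := Iid (coroot_in_alg jY) xI; rewrite -/u {1}xE liebDr.
rewrite (cartan_abelian hC DS uh (comp_cartan_sub u0Y)) add0r (bigD1 i) //= big1 ?addr0.
  rewrite liebZr (lieb_hX Xw _ uh) scalerA vecE => H.
  have /(memvZ (coord X i x * weval (lin_root (vec i)) u)^-1) := H.
  by rewrite scalerA mulVf ?scale1r // mulf_neq0.
move=> k /andP[kR ki]; have := none k; rewrite inE /= ki kR /= => /negbFE/eqP->.
by rewrite scale0r.
Qed.

(** Connectedness of [Y] as an induction principle along edges, to be applied to the nodes [j] whose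
    t_j lies in the ideal. *)
Hypothesis Yconn : forall P : pred 'I_r, (exists2 j, j \in Y & P j) ->
  (forall j k, j \in Y -> k \in Y -> P j -> cartan_adj A j k -> P k) -> forall k, k \in Y -> P k.

Lemma ideal_coroot (i : 'I_n) : RI i -> X`_i \in I -> t (w i) \in I.
Proof.
move=> iR iI; have [k kR [kk wk]] := comp_opp iR.
have Xk : X`_k \in root_space (- w i) by rewrite -wk.
have := Iid (root_in_alg kR) iI; rewrite liebC memvN.
rewrite (lieb_coroot gS hC DS r_gt0 bX Xw (Xw i) Xk) => /(memvZ (killing X`_i X`_k)^-1).
by rewrite scalerA mulVf ?scale1r.
Qed.

Lemma ideal_coroot_root u (i : 'I_n) : u \in I -> u \in h -> RI i -> weval (w i) u != 0 -> X`_i \in I.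
Proof.
move=> uI uh iR ne; have := Iid (root_in_alg iR) uI.
rewrite liebC memvN (lieb_hX Xw _ uh) => /(memvZ (weval (w i) u)^-1).
by rewrite scalerA mulVf ?scale1r.
Qed.

(** A nonzero ideal contains a root vector, since a nonzero element of the Cartan part acts
    nontrivially on some simple root vector. Hence it contains the vector t of a root, then some
    t_j, then along the edges all of them, and with these all root vectors. *)
Lemma comp_ideal : I != 0%VS -> (U <= I)%VS.
Proof.
move=> I0.
have [i iR iI] : exists2 i : 'I_n, RI i & X`_i \in I.
  apply: contrapT => H.
  have := memv_pick I; have := vpick0 I; rewrite (negPf I0) => /negbT; set x := vpick I => x0 xI.
  have [u uY xE] := comp_algP (subvP IU _ xI).
  have {}xE : x = u.
    rewrite xE big1 ?addr0 // => i iR; apply/eqP; rewrite scaler_eq0.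
    apply: contraT; rewrite negb_or => /andP[xi _]; case: H; exists i => //.
    exact: ideal_root_component xi.
  move/eqP: x0; apply; rewrite xE in xI *; apply: comp_cartan_sep => // j jY.
  have [i vi wi] := simple_index j.
  have iR : RI i.
    by rewrite /comp_index vi supp_in_e // andbT; apply/eqP => /rowP/(_ j); rewrite !mxE !eqxx.
  rewrite -wi; apply/eqP; apply: contraT => ne; case: H; exists i => //.
  exact: ideal_coroot_root xI (comp_cartan_sub uY) iR ne.
have sR j : j \in Y -> exists i, [/\ RI i & w i = tnth D j].
  move=> jY; have [k vk wk] := simple_index j; exists k; split=> //.
  by rewrite /comp_index vk supp_in_e // andbT; apply/eqP => /rowP/(_ j); rewrite !mxE !eqxx.
have step u j : u \in I -> u \in h -> j \in Y -> weval (tnth D j) u != 0 -> t (tnth D j) \in I.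
  move=> uI uh jY ne; have [k [kR wk]] := sR j jY.
  by rewrite -wk; apply: ideal_coroot => //; apply: (ideal_coroot_root uI uh kR); rewrite wk.
have [i0 iY] := andP iR; have TI := ideal_coroot iR iI.
have TY : t (w i) \in hY by rewrite vecE; apply: coroot_comp.
have T0 : t (w i) != 0.
  apply: contra_neq i0 => T0; apply/eqP; rewrite -(lin_root_eq0 DS) -vecE; apply/eqP/weval_inj => u uh.
  by rewrite weval0l -kE // T0; have := killingZl 0 0 u; rewrite scaler0 mul0r.
have allY : forall j, j \in Y -> t (tnth D j) \in I.
  apply: (Yconn (P := fun j => t (tnth D j) \in I)).
    apply: contrapT => H; move/eqP: T0; apply; apply: comp_cartan_sep => // j jY.
    apply/eqP; apply: contraT => ne; case: H; exists j => //.
    exact: step TI (comp_cartan_sub TY) jY ne.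
  move=> j k jY kY jI /andP[jk Ajk]; apply: (step _ _ jI) => //; first exact: coroot_dual_h.
  have := AE k j; apply: contra_eq_neq => ->; rewrite mulr0 eq_sym mulf_neq0 //.
    by rewrite gt_eqF // (simple_norm_gt0 gS hC DS r_gt0 bX Xw).
  by rewrite intr_eq0 (cartan_sym0 RS).
rewrite /comp_alg subv_add; apply/andP; split; apply/subv_sumP => j jY; rewrite -memvE.
  exact: allY.
have [j0 jS] := andP jY; have [k kY ne] := comp_root_sep jS j0.
by apply: (ideal_coroot_root (allY k kY)); rewrite ?coroot_dual_h // vecE.
Qed.
End Ideal.
End ComponentSubalgebra.

(** * Simplicity, Cartan subalgebra and simple roots of the component subalgebra *)

Section ComponentSimple.
Variables (K : numClosedFieldType) (g : lieAlgType K) (h : {vspace g}).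
Variables (r : nat) (D : r.-tuple (dualv K h)).
Hypothesis (gS : simple_lie g) (hC : cartan_subalgebra h) (DS : simple_roots D).
Hypothesis (r_gt0 : (0 < r)%N).
Local Notation n := (\dim {:g}).
Variables (X : n.-tuple g) (w : 'I_n -> dualv K h).
Hypothesis (bX : basis_of fullv X) (Xw : forall i : 'I_n, X`_i \in root_space (w i)).

Local Notation t := coroot_dual.

Local Notation lin_root := (lin_root D).
Local Notation is_rootv := (is_rootv D w).
Variable vec : 'I_n -> 'rV[int]_r.
Hypothesis vecE : forall i, w i = lin_root (vec i).
Variable A : 'I_r -> 'I_r -> int.
Hypothesis AE : forall i j,
  2 * weval (tnth D i) (t (tnth D j)) = weval (tnth D j) (t (tnth D j)) * (A i j)%:~R.
Let RS : root_system A is_rootv := lie_root_system gS hC DS r_gt0 bX Xw AE.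
Variable Y : {set 'I_r}.

Hypothesis Y0 : Y != set0.
Hypothesis Yconn : forall P : pred 'I_r, (exists2 j, j \in Y & P j) ->
  (forall j k, j \in Y -> k \in Y -> P j -> cartan_adj A j k -> P k) -> forall k, k \in Y -> P k.
Local Notation RI := (comp_index vec Y).
Local Notation hY := (comp_cartan D Y).
Local Notation U := (comp_alg D X vec Y).

Local Notation UU := (comp_alg_lie gS hC DS r_gt0 bX Xw vecE Y).
Local Notation L := (sublie UU).
Local Notation val := (@sublie_val _ _ _ UU).

Definition comp_h : {vspace L} := (sublie_incl UU @^-1: hY)%VS.
Local Notation h' := comp_h.

Lemma mem_comp_h (z : L) : (z \in h') = (val z \in hY).
Proof. by rewrite -memv_preim sublie_inclE. Qed.

Lemma comp_h_sub (z : L) : z \in h' -> val z \in h.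
Proof. by rewrite mem_comp_h => /comp_cartan_sub. Qed.

Lemma simple_comp j : j \in Y -> exists i : 'I_n, RI i /\ w i = tnth D j /\ vec i = 'e_j.
Proof.
move=> jY; have [k vk wk] := simple_index gS hC DS r_gt0 bX Xw vecE AE j.
exists k; split=> //; rewrite /comp_index vk supp_in_e // andbT.
by apply/eqP => /rowP/(_ j); rewrite !mxE !eqxx.
Qed.

Lemma comp_coroot_lift j : j \in Y -> exists2 z : L, z \in h' & val z = t (tnth D j).
Proof.
move=> jY; have tU : t (tnth D j) \in U by apply: coroot_in_alg.
have [z zE] := sublie_lift UU tU.
by exists z; rewrite // mem_comp_h zE coroot_in_cartan.
Qed.

Lemma comp_root_lift i : RI i -> exists z : L, val z = X`_i.
Proof. by move=> iR; apply/sublie_lift/root_in_alg. Qed.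

Lemma norm_neq0 j : weval (tnth D j) (t (tnth D j)) != 0.
Proof. by rewrite gt_eqF // (simple_norm_gt0 gS hC DS r_gt0 bX Xw). Qed.

Lemma comp_simple : simple_lie L.
Proof.
split.
  have /set0Pn[j jY] := Y0; have [i [iR [wi _]]] := simple_comp jY.
  have [u uh uE] := comp_coroot_lift jY; have [z zE] := comp_root_lift iR.
  exists u, z; apply: contra_neq (norm_neq0 j) => /(congr1 val).
  rewrite sublie_val_lieb uE zE (lieb_hX Xw _ (coroot_dual_h _)) wi linear0 => /eqP.
  by rewrite scaler_eq0 (negPf (X_neq0 bX _)) orbF => /eqP.
move=> I Iid; have [->|I0] := eqVneq I 0%VS; [by left|right].
pose J := (sublie_incl UU @: I)%VS.
have JU : (J <= U)%VS.
  by apply/subvP => _ /memv_imgP[z _ ->]; rewrite sublie_inclE sublie_valP.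
have Jid x y : x \in U -> y \in J -> lieb x y \in J.
  move=> xU /memv_imgP[z zI ->].
  have [x' <-] := sublie_lift UU xU.
  by rewrite sublie_inclE -sublie_val_lieb -sublie_inclE memv_img // Iid.
have J0 : J != 0%VS.
  apply: contraNneq I0 => J0; rewrite -vpick0; apply/eqP/sublie_val_inj.
  rewrite linear0 -sublie_inclE; apply/eqP; rewrite -memv0 -J0 memv_img //; exact: memv_pick.
have UJ := comp_ideal gS hC DS r_gt0 bX Xw vecE AE JU Jid Yconn J0.
apply/vspaceP => z; rewrite memvf.
have /(subvP UJ)/memv_imgP[z' z'I] := sublie_valP z.
by rewrite sublie_inclE => /sublie_val_inj ->.
Qed.

Lemma comp_h_abelian (u v : L) : u \in h' -> v \in h' -> lieb u v = 0.
Proof.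
move=> uh vh; apply/sublie_val_inj; rewrite sublie_val_lieb linear0.
by rewrite (cartan_abelian hC DS) ?comp_h_sub.
Qed.

Lemma comp_val_split (z : L) : exists2 u, u \in hY & val z = u + \sum_(i | RI i) coord X i (val z) *: X`_i.
Proof. exact: (comp_algP hC DS bX Xw vecE (sublie_valP z)). Qed.

(** An element normalizing the Cartan part has no root components, since every root supported in [Y]
    is nonzero at some t_j with [j] in [Y]. *)
Lemma comp_cartan_subalgebra : cartan_subalgebra h'.
Proof.
have hh : (liev h' h' <= 0)%VS.
  by apply/liev_subP => u v uh vh; rewrite comp_h_abelian // mem0v.
split.
- exact: subv_trans hh (sub0v _).
- by exists 1%N; apply/eqP; rewrite -subv0.
move=> z Hz; have [u uY zE] := comp_val_split z.
suff C0 i : RI i -> coord X i (val z) = 0.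
  rewrite mem_comp_h zE big1 ?addr0 // => i iR; by rewrite C0 ?scale0r.
move=> iR; have [i0 iY] := andP iR.
have [j jY ne] := comp_root_sep gS hC DS r_gt0 bX Xw iY i0.
have [x xh xE] := comp_coroot_lift jY.
have /comp_h_sub Hh := Hz x xh; apply: (mulfI ne); rewrite mulr0 -vecE.
rewrite -(coord_hlieb bX Xw _ _ (coroot_dual_h _)) -xE liebC linearN /= -sublie_val_lieb.
by rewrite (coord_h hC DS bX Xw Hh) ?oppr0 // (comp_weight_neq0 DS vecE iR).
Qed.

Definition comp_res (b : dualv K h) : dualv K h' :=
  linfun (fun z : subvs_of h' => weval b (val (vsval z)) : K^o).

Lemma weval_res b (z : L) : z \in h' -> weval (comp_res b) z = weval b (val z).
Proof.
move=> zh; rewrite {1}/weval /comp_res linfun_linear ?vsprojK //.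
move=> a p q; have -> : val (vsval (a *: p + q)) = a *: val (vsval p) + val (vsval q).
  by [].
by rewrite wevalD wevalZ.
Qed.

Lemma comp_res_lin_root v : supp_in Y v ->
  comp_res (lin_root v) = \sum_(j in Y) comp_res (tnth D j) *~ v 0 j.
Proof.
move=> /supp_inP vY; apply: weval_inj => z zh; rewrite weval_res // weval_lin_root weval_suml.
rewrite [RHS]big_mkcond; apply: eq_bigr => j _; case: ifPn => jY.
  by rewrite weval_mulrz weval_res // mulrzl.
by rewrite vY // mul0r.
Qed.

Definition comp_simple_roots : #|Y|.-tuple (dualv K h') :=
  [tuple comp_res (tnth D (enum_val i)) | i < #|Y|].
Local Notation D' := comp_simple_roots.

Lemma tnth_comp_roots i : tnth D' i = comp_res (tnth D (enum_val i)).
Proof. by rewrite tnth_mktuple. Qed.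

Lemma comp_root_space i (z : L) : RI i -> val z = X`_i -> z \in root_space (comp_res (w i)).
Proof.
move=> iR zE; apply/root_spaceP => u uh; apply: sublie_val_inj.
rewrite sublie_val_lieb linearZ /= zE (lieb_hX Xw _ (comp_h_sub uh)).
by rewrite weval_res.
Qed.

Lemma comp_res_neq0 i : RI i -> comp_res (w i) != 0.
Proof.
case/andP => i0 iY; have [j jY] := comp_root_sep gS hC DS r_gt0 bX Xw iY i0.
apply: contra_neq => e; have [x xh xE] := comp_coroot_lift jY.
by rewrite -vecE -xE -weval_res // e weval0l.
Qed.

Lemma comp_is_root i : RI i -> is_root (comp_res (w i)).
Proof.
move=> iR; split; first exact: comp_res_neq0.
have [z zE] := comp_root_lift iR.
apply: contraNneq (X_neq0 bX i) => rs0; rewrite -zE.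
by have := comp_root_space iR zE; rewrite rs0 memv0 => /eqP->; rewrite linear0.
Qed.

Lemma comp_rootP (b : dualv K h') : is_root b -> exists2 i, RI i & b = comp_res (w i).
Proof.
case=> b0 rs0; have z0 : vpick (root_space b) != 0 by rewrite vpick0.
have /root_spaceP zb := memv_pick (root_space b); set z := vpick _ in z0 zb.
have [u uY zE] := comp_val_split z.
have [i iR zi] : exists2 i, RI i & coord X i (val z) != 0.
  apply: contrapT => H; move/eqP: b0; apply; apply: weval_inj => x xh.
  have zh : z \in h'.
    rewrite mem_comp_h zE big1 ?addr0 // => i iR; apply/eqP; rewrite scaler_eq0.
    by apply: contraT; rewrite negb_or => /andP[zi _]; case: H; exists i.
  apply/eqP; rewrite weval0l; have /esym/eqP := zb x xh.
  by rewrite comp_h_abelian // scaler_eq0 (negPf z0) orbF.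
exists i => //; apply: weval_inj => x xh; rewrite weval_res //.
have := congr1 (fun y => coord X i (val y)) (zb x xh).
rewrite sublie_val_lieb (coord_hlieb bX Xw _ _ (comp_h_sub xh)) !linearZ /= => /(mulIf zi).
by move=> ->.
Qed.

Lemma comp_simple_rootsP : simple_roots D'.
Proof.
split.
- move=> k; rewrite tnth_comp_roots; have jY := enum_valP k.
  by have [i [iR [<- _]]] := simple_comp jY; apply: comp_is_root.
- have hdim : (\dim {: dualv K h'} <= #|Y|)%N.
    rewrite dimvf /dim /= muln1.
    have ker0 : lker (sublie_incl UU) == 0%VS.
      by apply/lker0P => x y; rewrite !sublie_inclE => /sublie_val_inj.
    change (\dim h' <= #|Y|)%N.
    rewrite -(limg_dim_eq (f := sublie_incl UU)) ?(eqP ker0) ?capv0 //.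
    apply: leq_trans (dimvS (_ : _ <= hY)%VS) _.
      by apply/subvP => _ /memv_imgP[z zh ->]; rewrite sublie_inclE -mem_comp_h.
    apply: leq_trans (dimv_leq_sum _ _ _) _; rewrite -sum1_card.
    by apply: leq_sum => j _; rewrite dim_vline leq_b1.
  rewrite basisEfree subvf size_tuple hdim !andbT.
  apply/freeP => c c0 k.
  pose c' j := if [pick i | enum_val i == j] is Some i then c i else 0.
  have c'E i : c' (enum_val i) = c i.
    rewrite /c'; case: pickP => [i' /eqP/enum_val_inj->//|/(_ i)]; by rewrite eqxx.
  have c'0 j : j \notin Y -> c' j = 0.
    rewrite /c'; case: pickP => // i /eqP <-; by rewrite enum_valP.
  have res0 u : u \in hY -> \sum_j c' j * weval (tnth D j) u = 0.
    move=> uY; have uU : u \in U by apply: cartan_in_alg.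
    have [z zE] := sublie_lift UU uU.
    have zh : z \in h' by rewrite mem_comp_h zE.
    rewrite (bigID (mem Y)) /= [X in _ + X]big1 ?addr0 => [|j jY]; last by rewrite c'0 ?mul0r.
    rewrite big_enum_val; have := congr1 (fun b : dualv K h' => weval b z) c0.
    rewrite weval0l weval_suml => e; rewrite -[RHS]e; apply: eq_bigr => i _.
    by rewrite wevalZl -tnth_nth tnth_comp_roots weval_res // zE c'E.
  (* A relation among the restrictions makes this sum orthogonal to the Cartan part, which contains
     its conjugate; so the sum is 0 and the relation already holds on all of [h]. *)
  have x0 : \sum_j c' j *: t (tnth D j) = 0.
    apply: (coroot_conj0 gS hC DS r_gt0 bX Xw).
    set xc := \sum_j (c' j)^* *: _.
    have xcY : xc \in hY.
      apply: rpred_sum => j _; have [jY|jY] := boolP (j \in Y).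
        by rewrite memvZ // coroot_in_cartan.
      by rewrite c'0 // conjC0 scale0r mem0v.
    have := res0 xc xcY; rewrite killing_sym (linear_sum (killing xc : g -> K^o)) /= => e; rewrite -[RHS]e.
    apply: eq_bigr => j _; rewrite killingZr killing_sym (coroot_dualE gS hC DS r_gt0 bX Xw) //.
    exact: comp_cartan_sub xcY.
  have : \sum_j c' j *: D`_j = 0.
    apply: weval_inj => u uh; rewrite weval_suml weval0l.
    have := congr1 (fun y => @killing K g y u) x0; rewrite killing_sym (linear_sum (killing u : g -> K^o)) /=.
    rewrite (_ : killing 0 u = 0) => [e|]; last by have := killingZl 0 0 u; rewrite scaler0 mul0r.
    rewrite -[RHS]e; apply: eq_bigr => j _; rewrite wevalZl -tnth_nth killingZr killing_sym.
    by rewrite (coroot_dualE gS hC DS r_gt0 bX Xw).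
  by case: DS => _ /basis_free/freeP/(_ c') H _ /H/(_ (enum_val k)); rewrite c'E.
move=> b /comp_rootP[i iR ->]; have [i0 iY] := andP iR.
have Pi : is_rootv (vec i) by rewrite (is_rootv_vec vecE).
have E v : supp_in Y v -> vge0 v -> comp_res (lin_root v) = \sum_k tnth D' k *+ absz (v 0 (enum_val k)).
  move=> vY v0; rewrite comp_res_lin_root // big_enum_val; apply: eq_bigr => k _.
  by rewrite tnth_comp_roots pmulrn gez0_abs // vge0_coord.
rewrite vecE; case/orP: (rs_sign RS Pi) => v0.
  by exists (fun k => absz (vec i 0 (enum_val k))); left; apply: E.
exists (fun k => absz ((- vec i) 0 (enum_val k))); right.
rewrite -(E _ (supp_inN iY) v0) lin_rootN; apply: weval_inj => z zh.
by rewrite wevalNl !weval_res // wevalNl opprK.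
Qed.
End ComponentSimple.

Lemma lie_frame (K : numClosedFieldType) (g : lieAlgType K) (h : {vspace g}) (r : nat)
    (D : r.-tuple (dualv K h)) :
  simple_lie g -> cartan_subalgebra h -> simple_roots D -> (0 < r)%N ->
  exists (X : (\dim {:g}).-tuple g) (w : 'I_(\dim {:g}) -> dualv K h)
         (vec : 'I_(\dim {:g}) -> 'rV[int]_r) (A : 'I_r -> 'I_r -> int),
  [/\ basis_of fullv X, forall i : 'I_(\dim {:g}), X`_i \in root_space (w i),
      forall i, w i = lin_root D (vec i)
    & forall i j, 2 * weval (tnth D i) (coroot_dual (tnth D j)) =
        weval (tnth D j) (coroot_dual (tnth D j)) * (A i j)%:~R].
Proof.
move=> gS hC DS r_gt0; have [X [w [bX Xw]]] := weight_basis gS hC DS r_gt0.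
have [A AE] := cartan_int_ex gS hC DS r_gt0 bX Xw.
have /choice[vec vecE] : forall i, exists v, w i = lin_root D v.
  move=> i; have wi : is_weight w (w i) by apply/is_weightP; exists i.
  by have [v [-> _]] := root_lin_root DS bX Xw wi; exists v.
by exists X, w, vec, A.
Qed.

(** * Dynkin diagram and grading of the component subalgebra *)

Section ComponentDiagram.
Variables (K : numClosedFieldType) (g : lieAlgType K) (h : {vspace g}).
Variables (r : nat) (D : r.-tuple (dualv K h)).
Hypothesis (gS : simple_lie g) (hC : cartan_subalgebra h) (DS : simple_roots D).
Hypothesis (r_gt0 : (0 < r)%N).
Local Notation n := (\dim {:g}).
Variables (X : n.-tuple g) (w : 'I_n -> dualv K h).
Hypothesis (bX : basis_of fullv X) (Xw : forall i : 'I_n, X`_i \in root_space (w i)).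

Local Notation t := coroot_dual.

Local Notation is_rootv := (is_rootv D w).
Variable vec : 'I_n -> 'rV[int]_r.
Hypothesis vecE : forall i, w i = lin_root D (vec i).
Variable A : 'I_r -> 'I_r -> int.
Hypothesis AE : forall i j,
  2 * weval (tnth D i) (t (tnth D j)) = weval (tnth D j) (t (tnth D j)) * (A i j)%:~R.
Variable Y : {set 'I_r}.

Hypothesis Y0 : Y != set0.
Hypothesis Yconn : forall P : pred 'I_r, (exists2 j, j \in Y & P j) ->
  (forall j k, j \in Y -> k \in Y -> P j -> cartan_adj A j k -> P k) -> forall k, k \in Y -> P k.
Local Notation RI := (comp_index vec Y).

Local Notation UU := (comp_alg_lie gS hC DS r_gt0 bX Xw vecE Y).
Local Notation L := (sublie UU).
Local Notation val := (@sublie_val _ _ _ UU).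
Local Notation h' := (comp_h gS hC DS r_gt0 bX Xw vecE Y).
Local Notation D' := (comp_simple_roots gS hC DS r_gt0 bX Xw vecE Y).
Local Notation res := (comp_res gS hC DS r_gt0 bX Xw vecE Y).
Let LS := comp_simple gS hC DS r_gt0 bX Xw vecE AE Y0 Yconn.
Let LC := comp_cartan_subalgebra gS hC DS r_gt0 bX Xw vecE Y.
Let LR := comp_simple_rootsP gS hC DS r_gt0 bX Xw vecE AE Y.
Let card_Y : (0 < #|Y|)%N. Proof. by rewrite card_gt0. Qed.

Lemma comp_resN b : res (- b) = - res b.
Proof. by apply: weval_inj => z zh; rewrite wevalNl !weval_res // wevalNl. Qed.

Variables (X' : (\dim {:L}).-tuple L) (w' : 'I_(\dim {:L}) -> dualv K h').
Hypothesis (bX' : basis_of fullv X').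
Hypothesis (Xw' : forall i : 'I_(\dim {:L}), X'`_i \in root_space (w' i)).
Variable vec' : 'I_(\dim {:L}) -> 'rV[int]_#|Y|.
Hypothesis vecE' : forall i, w' i = lin_root D' (vec' i).
Variable A' : 'I_#|Y| -> 'I_#|Y| -> int.
Hypothesis AE' : forall i j,
  2 * weval (tnth D' i) (t (tnth D' j)) = weval (tnth D' j) (t (tnth D' j)) * (A' i j)%:~R.

(** The Killing form of the subalgebra is in general not the restriction of that of g, so the two
    versions of t_j need not be equal. Computing one bracket of opposite root vectors in both
    algebras shows that they are proportional. *)
Lemma comp_coroot i : exists c d : K,
  [/\ c != 0, d != 0 & c *: val (t (tnth D' i)) = d *: t (tnth D (enum_val i))].
Proof.
have iY := enum_valP i.
have [k [kR [wk _]]] := simple_comp gS hC DS r_gt0 bX Xw vecE AE iY.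
have [l lR [kl wl]] := comp_opp gS hC DS r_gt0 bX Xw vecE kR.
have [x xE] := comp_root_lift gS hC DS r_gt0 bX Xw vecE kR.
have [y yE] := comp_root_lift gS hC DS r_gt0 bX Xw vecE lR.
have xs := comp_root_space kR xE; have ys := comp_root_space lR yE.
rewrite wk -tnth_comp_roots in xs; rewrite wl wk comp_resN -tnth_comp_roots in ys.
have Xl : X`_l \in root_space (- w k) by rewrite -wl.
have e : killing x y *: val (t (tnth D' i)) = killing X`_k X`_l *: t (tnth D (enum_val i)).
  have := congr1 val (lieb_coroot LS LC LR card_Y bX' Xw' xs ys).
  rewrite sublie_val_lieb xE yE (lieb_coroot gS hC DS r_gt0 bX Xw (Xw k) Xl) wk => ->.
  by rewrite linearZ.
exists (killing x y), (killing X`_k X`_l); split=> //.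
apply: contra_neq (norm_neq0 gS hC DS r_gt0 bX Xw (enum_val i)) => c0.
have /eqP := e; rewrite c0 scale0r eq_sym scaler_eq0 (negPf kl) => /eqP->.
by rewrite /weval !linear0.
Qed.

(** The factor between the two versions of t_j cancels from the quotient that defines a Cartan
    integer. *)
Lemma comp_cartan_matrix i j : A' i j = A (enum_val i) (enum_val j).
Proof.
have [c [d [c0 d0 e]]] := comp_coroot j.
have ev k : c * weval (tnth D' k) (t (tnth D' j)) =
            d * weval (tnth D (enum_val k)) (t (tnth D (enum_val j))).
  by rewrite tnth_comp_roots weval_res ?coroot_dual_h // -!wevalZ e.
apply/eqP; rewrite -(eqr_int K); apply/eqP.
apply: (mulfI (mulf_neq0 d0 (norm_neq0 gS hC DS r_gt0 bX Xw (enum_val j)))).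
by rewrite -[in LHS]ev -!mulrA -AE' -AE mulrCA ev mulrCA.
Qed.

Lemma comp_dynkin_iso : dynkin_iso D' D Y enum_val.
Proof.
split.
- exact: enum_val_inj.
- apply/setP => j; apply/imsetP/idP => [[i _ ->]|jY]; first exact: enum_valP.
  by exists (enum_rank_in jY j); rewrite ?inE // enum_rankK_in.
- move=> i j _; rewrite (dynkin_edgesE gS hC DS r_gt0 bX Xw AE).
  by rewrite (dynkin_edgesE LS LC LR card_Y bX' Xw' AE') !comp_cartan_matrix.
move=> i j; rewrite (dynkin_arrowE gS hC DS r_gt0 bX Xw AE).
rewrite (dynkin_arrowE LS LC LR card_Y bX' Xw' AE') /cartan_adj !comp_cartan_matrix.
by rewrite (inj_eq enum_val_inj).
Qed.

Lemma comp_root_index v : is_rootv v -> supp_in Y v ->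
  exists k, forall i, vec' k 0 i = v 0 (enum_val i).
Proof.
move=> Pv vY; have [i vi] := rootv_index DS vecE Pv.
have iR : RI i by rewrite /comp_index vi vY (andP Pv).1.
have /(is_rootE bX' Xw')/andP[_ /is_weightP[k wk]] := comp_is_root gS hC DS r_gt0 bX Xw vecE iR.
exists k => l; suff -> : vec' k = \row_l v 0 (enum_val l) by rewrite mxE.
apply: (lin_root_inj LR); rewrite -vecE' wk vecE vi comp_res_lin_root //.
rewrite big_enum_val; apply: eq_bigr => m _.
by rewrite tnth_comp_roots mxE.
Qed.

Lemma comp_kgrading1 a v : is_kgrading 1 (parabolic_grading D' [set a]) ->
  is_rootv v -> supp_in Y v -> v 0 (enum_val a) <= 1.
Proof.
move=> G1 Pv vY; have [k vk] := comp_root_index Pv vY.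
have RL := lie_root_system LS LC LR card_Y bX' Xw' AE'.
have hwE i : basis_height vec' [set a] i = vec' i 0 a.
  by rewrite /basis_height /shape_height big_set1.
have [l vl] := rootv_index LR vecE' (rs_simple RL a).
have ex1 : exists i, basis_height vec' [set a] i = 1.
  by exists l; rewrite hwE vl e_E eqxx.
have /(_ k) := (kgrading1P LS LC LR card_Y bX' Xw' vecE' ex1).1 G1.
by rewrite hwE vk; apply: le_trans; apply: ler_norm.
Qed.
End ComponentDiagram.

(** * Isomorphic diagrams and the characterization *)

Section CartanEntries.

(** A product below 4 and zeros occurring together bound all four numbers by 3, and a finite check
    remains. Up to order the pairs are 0, 0 and 1, m with m at most 3: the product gives m, the
    comparisons give the order. *)
Let entry_eq_nat (x y x' y' : nat) : (x * y = x' * y')%N -> (x * y < 4)%N ->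
  (x == 0%N) = (y == 0%N) -> (x' == 0%N) = (y' == 0%N) ->
  (x != 0%N) && (y < x)%N = (x' != 0%N) && (y' < x')%N ->
  (y != 0%N) && (x < y)%N = (y' != 0%N) && (x' < y')%N -> x = x'.
Proof.
move=> e lt4 e0 e0'; have lt4' : (x' * y' < 4)%N by rewrite -e.
have small a b : (a * b < 4)%N -> (a == 0%N) = (b == 0%N) -> (a < 4)%N /\ (b < 4)%N.
  by move=> ab ab0; split; move: ab ab0; clear; case: a => [|a]; case: b => [|b] //; rewrite ?mulnS; nia.
have [x4 y4] := small _ _ lt4 e0; have [x4' y4'] := small _ _ lt4' e0'.
move: e e0 e0'; clear small lt4 lt4'.
by case: x x4 => [|[|[|[|//]]]] _; case: y y4 => [|[|[|[|//]]]] _;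
  case: x' x4' => [|[|[|[|//]]]] _; case: y' y4' => [|[|[|[|//]]]] _.
Qed.

Lemma cartan_entry_eq (a b a' b' : int) : a <= 0 -> b <= 0 -> a' <= 0 -> b' <= 0 ->
  a * b = a' * b' -> a * b < 4 -> (a == 0) = (b == 0) -> (a' == 0) = (b' == 0) ->
  (a != 0) && (a < b) = (a' != 0) && (a' < b') ->
  (b != 0) && (b < a) = (b' != 0) && (b' < a') -> a = a'.
Proof.
have abs (c : int) : c <= 0 -> exists n : nat, c = - n%:Z.
  by move=> c0; exists (absz c); rewrite lez0_abs ?opprK.
move=> /abs[x ->] /abs[y ->] /abs[x' ->] /abs[y' ->].
rewrite !mulrNN !oppr_eq0 !ltrN2 -!PoszM !ltz_nat => - [] e lt4 e0 e0' l l'.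
by rewrite (entry_eq_nat e lt4 e0 e0' l l').
Qed.

Lemma cartan_matrix_eq r r' (A : 'I_r -> 'I_r -> int) Phi (A' : 'I_r' -> 'I_r' -> int) Phi'
    (f : 'I_r' -> 'I_r) : root_system A Phi -> root_system A' Phi' -> injective f ->
  (forall i j, i != j -> A' i j * A' j i = A (f i) (f j) * A (f j) (f i)) ->
  (forall i j, cartan_adj A' i j && (A' i j < A' j i) =
               cartan_adj A (f i) (f j) && (A (f i) (f j) < A (f j) (f i))) ->
  forall i j, A' i j = A (f i) (f j).
Proof.
move=> RS RS' f_inj edges arrows i j; have [<-|ij] := eqVneq i j.
  by rewrite (rs_diag RS) (rs_diag RS').
have ji : j != i by rewrite eq_sym.
have [fij fji] : f i != f j /\ f j != f i by rewrite !(inj_eq f_inj).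
have := arrows i j; have := arrows j i; rewrite /cartan_adj ij ji fij fji /=.
move=> a1 a2; apply: (cartan_entry_eq _ _ _ _ (edges i j ij)) => //.
- exact: cartan_le0 RS' _ _ ij.
- exact: cartan_le0 RS' _ _ ji.
- exact: cartan_le0 RS _ _ fij.
- exact: cartan_le0 RS _ _ fji.
- exact: cartan_prod_lt4 RS' _ _ ij.
- exact: cartan_sym0 RS' i j.
exact: cartan_sym0 RS (f i) (f j).
Qed.
End CartanEntries.

(** * The two directions of the characterization *)

Section StarNode.
Variables (K : numClosedFieldType) (g : lieAlgType K) (h : {vspace g}).
Variables (r : nat) (D : r.-tuple (dualv K h)) (S : {set 'I_r}).
Hypothesis (gS : simple_lie g) (hC : cartan_subalgebra h) (DS : simple_roots D).
Hypothesis (S0 : S != set0).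
Hypothesis dim1 : (2 < \dim (parabolic_grading D S (-1)))%N.

Let r_gt0 : (0 < r)%N.
Proof. by have /set0Pn[i _] := S0; apply: leq_ltn_trans (ltn_ord i). Qed.

Lemma component_connected (A : 'I_r -> 'I_r -> int) Phi z a : root_system A Phi ->
  forall P : pred 'I_r, (exists2 j, j \in cartan_component A z a & P j) ->
  (forall j k, j \in cartan_component A z a -> k \in cartan_component A z a ->
     P j -> cartan_adj A j k -> P k) ->
  forall k, k \in cartan_component A z a -> P k.
Proof.
move=> RS P [j + Pj] step k; rewrite !inE => aj ak.
set e := fun i j => _ in aj ak.
have e_sym : symmetric e.
  by move=> x y; rewrite /e (cartan_adj_sym RS x y) andbCA.
have /connectP[p] : connect e j k.
  by apply: connect_trans ak; rewrite (sym_connect_sym e_sym).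
elim: p j aj Pj => [|l p IH] j aj Pj /=; first by move=> _ ->.
case/andP=> jl pl lk; have al := connect_trans aj (connect1 jl).
apply: (IH l) => //; apply: (step j) => //; rewrite ?inE //.
by case/and3P: jl.
Qed.

Lemma componentE (A : 'I_r -> 'I_r -> int) z a :
  (forall i j, dynkin_adj D i j = cartan_adj A i j) ->
  dynkin_component D z a = cartan_component A z a.
Proof.
move=> AD; apply/setP => b; rewrite !inE; apply: eq_connect => i j.
by rewrite AD.
Qed.

Lemma component_avoid (A : 'I_r -> 'I_r -> int) z a : a != z -> z \notin cartan_component A z a.
Proof.
move=> az; rewrite inE; apply/negP => /connectP[p].
case/lastP: p => [_ /= e|p x]; first by rewrite e eqxx in az.
rewrite rcons_path last_rcons => /andP[_ /and3P[_ + _]] e.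
by rewrite e eqxx.
Qed.

Definition star_node z :=
  [/\ z \in S, (forall b, b \in S -> b != z -> dynkin_adj D z b),
      (forall b, dynkin_adj D z b -> b \in S)
    & forall a, a \in S -> a != z ->
        forall (g' : lieAlgType K) (h' : {vspace g'}) (r' : nat)
          (D' : r'.-tuple (dualv K h')) (f : 'I_r' -> 'I_r) (a' : 'I_r'),
          simple_lie g' -> cartan_subalgebra h' -> simple_roots D' ->
          dynkin_iso D' D (dynkin_component D z a) f -> f a' = a ->
          is_kgrading 1 (parabolic_grading D' [set a'])].

(** Condition (ii) is applied to the component subalgebra, with [enum_val] identifying its nodes
    with those of the component; it bounds the coefficient at [b] of the positive roots supported
    there. *)
Lemma star_node_monge z : star_node z -> monge_type (parabolic_grading D S).
Proof.
case=> zS S_adj adj_S comp1.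
have [X [w [vec [A [bX Xw vecE AE]]]]] := lie_frame gS hC DS r_gt0.
have RS := lie_root_system gS hC DS r_gt0 bX Xw AE.
have AD := dynkin_adjE gS hC DS r_gt0 bX Xw AE.
apply: (star_monge gS hC DS r_gt0 bX Xw vecE RS dim1 (z := 'e_z)).
apply: (to_star RS zS) => [b bS bz|b|b v bS bz Pv v0 vY].
- by rewrite -AD S_adj.
- by rewrite -AD; apply: adj_S.
pose Y := cartan_component A z b.
have bY : b \in Y by rewrite inE connect0.
have Y0 : Y != set0 by apply/set0Pn; exists b.
have Yconn := component_connected (z := z) (a := b) RS.
have LS := comp_simple gS hC DS r_gt0 bX Xw vecE AE Y0 Yconn.
have LC := comp_cartan_subalgebra gS hC DS r_gt0 bX Xw vecE Y.
have LR := comp_simple_rootsP gS hC DS r_gt0 bX Xw vecE AE Y.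
have card_Y : (0 < #|Y|)%N by rewrite card_gt0.
have [X' [w' [vec' [A' [bX' Xw' vecE' AE']]]]] := lie_frame LS LC LR card_Y.
have iso := comp_dynkin_iso AE Y0 Yconn bX' Xw' AE'.
have fb : enum_val (enum_rank_in bY b) = b by rewrite enum_rankK_in.
rewrite -fb; apply: (comp_kgrading1 AE Y0 Yconn bX' Xw' vecE' AE' _ Pv).
  by apply: (comp1 b bS bz _ _ _ _ enum_val) => //; rewrite (componentE _ _ AD).
apply/supp_inP => j jY; apply/eqP; rewrite eq_le vge0_coord // andbT leNgt.
by apply: contra jY; apply: vY.
Qed.

(** The diagram of an arbitrary [g'] determines its Cartan matrix and thereby its roots, which
    become the roots of g supported in the component. For a positive one, the coefficient at [a'] is
    at most the height of the corresponding root of g, which omits [z] and so has height at most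
    1. *)
Lemma monge_star_node : monge_type (parabolic_grading D S) -> exists z, star_node z.
Proof.
have [X [w [vec [A [bX Xw vecE AE]]]]] := lie_frame gS hC DS r_gt0.
have RS := lie_root_system gS hC DS r_gt0 bX Xw AE.
have AD := dynkin_adjE gS hC DS r_gt0 bX Xw AE.
move=> /(monge_star gS hC DS r_gt0 bX Xw vecE RS dim1)[v vS].
have others := star_others gS hC DS r_gt0 bX Xw vecE RS dim1 vS.
have [z zS [_ S_adj adj_S h1]] := star_conditions RS vS others.
exists z; split=> // [b bS bz|b|a aS az g' h' r' D' f a' gS' hC' DS' [f_inj fY edges arrows] fa].
- by rewrite AD S_adj.
- by rewrite AD; apply: adj_S.
have r'_gt0 : (0 < r')%N by apply: leq_ltn_trans (ltn_ord a').
have [X' [w' [vec' [A' [bX' Xw' vecE' AE']]]]] := lie_frame gS' hC' DS' r'_gt0.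
have RS' := lie_root_system gS' hC' DS' r'_gt0 bX' Xw' AE'.
have AA : forall i j, A' i j = A (f i) (f j).
  apply: (cartan_matrix_eq RS RS' f_inj) => [i j ij|i j].
    apply/eqP; rewrite -(eqr_int K) -(dynkin_edgesE gS' hC' DS' r'_gt0 bX' Xw' AE').
    by rewrite -(dynkin_edgesE gS hC DS r_gt0 bX Xw AE) edges.
  rewrite -(dynkin_arrowE gS' hC' DS' r'_gt0 bX' Xw' AE') arrows.
  exact: (dynkin_arrowE gS hC DS r_gt0 bX Xw AE).
have Phi_eq v' : is_rootv D' w' v' = is_rootv D w (push f v').
  have A'E : A' = fun i j => A (f i) (f j) by apply/funext => i; apply/funext => j.
  move: v'; apply: (root_system_unique RS'); rewrite A'E.
  exact: (pullback_root_system f_inj RS).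
have zf : z \notin codom f.
  apply/negP => /codomP[i zi]; move: (component_avoid A az).
  by rewrite -(componentE _ _ AD) -fY zi imset_f.
have le1 v' : is_rootv D' w' v' -> vge0 v' -> v' 0 a' <= 1.
  rewrite Phi_eq => Pv v0; rewrite -(push_coord f_inj) fa.
  have P0 : vge0 (push f v') by rewrite push_ge0.
  apply: le_trans (shape_height_ge P0 aS) (h1 _ Pv P0 _).
  exact: push_coord0.
have hwE i : basis_height vec' [set a'] i = vec' i 0 a'.
  by rewrite /basis_height /shape_height big_set1.
have [l vl] := rootv_index DS' vecE' (rs_simple RS' a').
apply/(kgrading1P gS' hC' DS' r'_gt0 bX' Xw' vecE').
  by exists l; rewrite hwE vl e_E eqxx.
move=> i; rewrite hwE; have [->|vi] := eqVneq (vec' i) 0; first by rewrite mxE normr0.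
have Pi : is_rootv D' w' (vec' i) by rewrite (is_rootv_vec vecE').
case/orP: (rs_sign RS' Pi) => v0; first by rewrite ger0_norm ?vge0_coord ?le1.
have := vge0_coord a' v0; have := le1 _ (rs_opp RS' Pi) v0; rewrite mxE oppr_ge0 => l1 l0.
by rewrite ler0_norm.
Qed.
End StarNode.

Theorem theorem2p4 (R : realType) (g : lieAlgType R[i]) (h : {vspace g})
    (r : nat) (D : r.-tuple (dualv R[i] h)) (Sigma : {set 'I_r}) :
  simple_lie g -> cartan_subalgebra h -> simple_roots D -> Sigma != set0 ->
  (2 < \dim (parabolic_grading D Sigma (-1)))%N ->
  (monge_type (parabolic_grading D Sigma) <->
   exists zeta : 'I_r,
     [/\ zeta \in Sigma,
         (forall b, b \in Sigma -> b != zeta -> dynkin_adj D zeta b),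
         (* needed: A_4 with Sigma = {alpha_2, alpha_3} satisfies the other
            clauses but is not of Monge type *)
         (forall b, dynkin_adj D zeta b -> b \in Sigma)
       & forall a, a \in Sigma -> a != zeta ->
           forall (g' : lieAlgType R[i]) (h' : {vspace g'}) (r' : nat)
             (D' : r'.-tuple (dualv R[i] h')) (f : 'I_r' -> 'I_r) (a' : 'I_r'),
             simple_lie g' -> cartan_subalgebra h' -> simple_roots D' ->
             dynkin_iso D' D (dynkin_component D zeta a) f -> f a' = a ->
             is_kgrading 1 (parabolic_grading D' [set a'])]).
Proof.
move=> gS hC DS S0 dim1; split; first exact: monge_star_node.
by case=> z; apply: star_node_monge.
Qed.
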